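(* Let $\sigma>0$, $\lambda>0$, let $K$ be a non-negative smooth function on $(\mathbb{T}^d)^2$ with $\int_{\mathbb{T}^d}K(x,y)dx=1$ for all $y\in\mathbb{T}^d$, with associated operators $\mathcal{T}(m)(x)=\int K(x,y)m(dy)$ and $\mathcal{T}^*(\phi)(y)=\int K(x,y)\phi(x)dx$. Let $H:\mathbb{T}^d\times\mathbb{R}^d\to\mathbb{R}$ be $\mathcal{C}^1$ and convex in its second argument, and let $f,U_0:\mathbb{T}^d\times\mathcal{P}(\mathbb{T}^d)\to\mathbb{R}$ be continuous and monotone, i.e. for $g\in\{f,U_0\}$, $\langle g(\cdot,\mu)-g(\cdot,\nu),\mu-\nu\rangle\ge0$ for all $\mu,\nu\in\mathcal{P}(\mathbb{T}^d)$. If $U$ and $V$ are two monotone solutions of the master equation with common jumps (MET), then there is a function $c:[0,\infty)\times\mathcal{P}(\mathbb{T}^d)\to\mathbb{R}$ such that $U(t,x,m)=V(t,x,m)+c(t,m)$ for all $(t,x,m)$. Moreover, if a monotone solution $U$ exists, then $U(t)$ is monotone for all $t\ge0$: $\langle U(t,\cdot,\mu)-U(t,\cdot,\nu),\mu-\nu\rangle\ge0$ for all $\mu,\nu\in\mathcal{P}(\mathbb{T}^d)$.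
   Context: Notation. $d$ is an integer greater than $1$; $\mathbb{T}^d$ is the $d$-dimensional torus; $\mathcal{M}(\mathbb{T}^d)$ is the set of (finite signed) measures; $\mathcal{P}(\mathbb{T}^d)$ is the set of probability measures with the 1-Wasserstein distance. $\|\cdot\|_2$ is the $\mathcal{C}^2(\mathbb{T}^d)$ norm. $\langle g,\mu\rangle=\int g\,d\mu$, $\langle g,\mathrm{div}(bm)\rangle=-\int\nabla g\cdot b\,dm$, $\langle g,\Delta m\rangle=\int\Delta g\,dm$. $D_pH$ is the gradient of $H$ in its second argument. $\mathcal{B}_t$ is the space of globally continuous $U:[0,\infty)\times\mathbb{T}^d\times\mathcal{P}(\mathbb{T}^d)\to\mathbb{R}$ with $\sup_{m,\,t\in[0,T]}\|U(t,\cdot,m)\|_2<\infty$ for all $T>0$. Master equation with common jumps (MET), on $(0,\infty)\times\mathbb{T}^d\times\mathcal{P}(\mathbb{T}^d)$: $$\partial_tU-\sigma\Delta U+H(x,\nabla_xU)-\Big\langle\tfrac{\delta U}{\delta m}(x,m,\cdot),\mathrm{div}\big(D_pH(\cdot,\nabla_xU(\cdot,m))m\big)\Big\rangle+\lambda\big(U-\mathcal{T}^*(U(t,\cdot,\mathcal{T}(m)))\big)-\sigma\Big\langle\tfrac{\delta U}{\delta m}(x,m,\cdot),\Delta m\Big\rangle=f(x,m),$$ with $U(0,x,m)=U_0(x,m)$. Monotone solution of (MET): $U\in\mathcal{B}_t$ with $U(0,\cdot,\cdot)=U_0$ such that for any $\mathcal{C}^2$ function $\phi:\mathbb{T}^d\to\mathbb{R}$,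 any $\nu\in\mathcal{M}(\mathbb{T}^d)$, any smooth $\vartheta:[0,\infty)\to\mathbb{R}$, any $T>0$ and any point $(t_0,m_0)\in(0,T]\times\mathcal{P}(\mathbb{T}^d)$ of strict minimum of $(t,m)\mapsto\langle U(t,\cdot,m)-\phi,m-\nu\rangle-\vartheta(t)$ on $[0,T]\times\mathcal{P}(\mathbb{T}^d)$ (strictly smaller than at any other point), $$\frac{d\vartheta}{dt}(t_0)+\big\langle-\sigma\Delta U+H(\cdot,\nabla_xU)+\lambda\big(U-\mathcal{T}^*(U(t_0,\cdot,\mathcal{T}(m_0)))\big),m_0-\nu\big\rangle\ge\langle f(\cdot,m_0),m_0-\nu\rangle-\langle U-\phi,\mathrm{div}(D_pH(\cdot,\nabla_xU)m_0)\rangle-\sigma\langle\Delta(U-\phi),m_0\rangle,$$ where $U$ stands for $U(t_0,\cdot,m_0)$. *)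

(* Defs.v *)
From HB Require Import structures.
From mathcomp Require Import all_boot all_order all_algebra generic_quotient.
From mathcomp Require Import all_classical all_reals all_analysis.
From mathcomp Require Import measurable_realfun.
Set Implicit Arguments.
Unset Strict Implicit.
Unset Printing Implicit Defensive.
Import Order.TTheory GRing.Theory Num.Theory.
Import numFieldNormedType.Exports.
Local Open Scope classical_set_scope.
Local Open Scope ring_scope.
Local Open Scope quotient_scope.

Definition torus_display : measure_display.
Proof. exact: default_measure_display. Qed.

Section torus.
Context (R : realType) (d : nat).

Definition zequiv (x y : 'rV[R]_d) : bool :=
  [forall i, x 0 i - y 0 i \is a Num.int].

Lemma zequiv_class : equiv_class_of zequiv.
Proof.
split=> [x|x y|y x z].
- by apply/forallP => i; rewrite subrr.
- by apply/eq_forallb => i; rewrite -opprB rpredN.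
- move=> /forallP xy /forallP yz; apply/forallP => i.
  by rewrite -(subrK (y 0 i) (x 0 i)) -addrA rpredD.
Qed.

Canonical zequiv_rel := EquivRelPack zequiv_class.

Definition torus : Type := quotient_topology {eq_quot zequiv_rel}.

HB.instance Definition _ := Topological.on torus.
HB.instance Definition _ := Pointed.on torus.
HB.instance Definition _ :=
  Quotient.copy torus (quotient_topology {eq_quot zequiv_rel}).

Definition torus_borel : set (set torus) := <<s @open torus >>.

Lemma borel0 : torus_borel set0. Proof. exact: sigma_algebra0. Qed.

Lemma borelC (A : set torus) : torus_borel A -> torus_borel (~` A).
Proof. exact: sigma_algebraC. Qed.

Lemma borelU (A : (set torus)^nat) :
  (forall i, torus_borel (A i)) -> torus_borel (\bigcup_i A i).
Proof. exact: sigma_algebra_bigcup. Qed.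

HB.instance Definition _ :=
  @isMeasurable.Build torus_display torus torus_borel borel0 borelC borelU.

Definition to_torus (x : 'rV[R]_d) : torus := \pi_torus x.

Lemma to_torusP x y : to_torus x = to_torus y <-> zequiv x y.
Proof.
split=> [e|/(@eqquotP _ zequiv_rel {eq_quot zequiv_rel}) //].
by apply/(@eqquotP _ zequiv_rel {eq_quot zequiv_rel}).
Qed.

Definition torus_of_tuple (t : d.-tuple (measurableTypeR R)) : torus :=
  to_torus (\row_i tnth t i).


Definition rat_vec (q : 'rV[rat]_d) : 'rV[R]_d := \row_i ratr (q 0 i).

Lemma rat_vec_dense (x : 'rV[R]_d) (e : R) : 0 < e ->
  exists q, ball (rat_vec q) e x.
Proof.
move=> e0.
have /choice[f fP] : forall i : 'I_d, exists q : rat, ball (ratr q : R) e (x 0 i).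
  move=> i.
  have [||y [/= xy [q _ qy]]] := @dense_rat R (ball (x 0 i) e).
  - by exists (x 0 i); exact: ballxx.
  - exact: ball_open.
  - by exists q; rewrite qy; exact: ball_sym.
exists (\row_i f i); split=> // i j; rewrite (ord1 i) /rat_vec !mxE; exact: fP.
Qed.

Lemma open_tuple_measurable (O : set 'rV[R]_d) : open O ->
  measurable [set t : d.-tuple (measurableTypeR R) | O (\row_i tnth t i)].
Proof.
move=> oO.
pose I (k : 'rV[rat]_d * nat) := ball (rat_vec k.1) k.2.+1%:R^-1 `<=` O.
pose B (k : 'rV[rat]_d * nat) : set (d.-tuple (measurableTypeR R)) :=
  if `[< I k >] then \bigcap_(i in [set: 'I_d])
     ((fun t => tnth t i) @^-1` (ball (rat_vec k.1 0 i) k.2.+1%:R^-1)) else set0.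
rewrite [X in measurable X](_ : _ = \bigcup_k B k).
  apply: countable_bigcupT_measurable; first exact: countableP.
  move=> k; rewrite /B; case: asboolP => // _.
  apply: fin_bigcap_measurable => // i _.
  rewrite -[X in measurable X]setTI; apply: measurable_tnth => //.
  by rewrite ball_itv; exact: measurable_itv.
apply/seteqP; split => [t /= Ot|t [k _]]; last first.
  rewrite /B; case: asboolP => // Ik tk; apply: Ik; split => [|i j]; first by rewrite invr_gt0.
  by rewrite (ord1 i) [X in ball _ _ X]mxE; exact: tk.
have /nbhs_ballP[e /= e0 eO] : nbhs (\row_i tnth t i) O by exact: open_nbhs_nbhs.
have [n ne] : exists n : nat, n.+1%:R^-1 < e / 2.
  exists (Num.truncn (e / 2)^-1); rewrite invf_plt ?posrE ?divr_gt0//.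
  exact: Num.Theory.truncnS_gt.
have [q qt] := @rat_vec_dense (\row_i tnth t i) n.+1%:R^-1 ltac:(by []).
exists (q, n) => //; rewrite /B asboolT /=; last first.
  move=> y qy; apply: eO; apply: (@le_ball _ _ _ (n.+1%:R^-1 + n.+1%:R^-1)).
    by rewrite (splitr e) lerD// ltW.
  by apply: ball_triangle qy; exact: ball_sym.
by move=> i _; have := qt.2 0 i; rewrite [X in ball _ _ X]mxE.
Qed.

Lemma torus_of_tuple_measurable : measurable_fun setT torus_of_tuple.
Proof.
apply: (measurability (@open torus) erefl).
move=> _ [A oA <-]; rewrite setTI.
exact: (open_tuple_measurable oA).
Qed.

HB.instance Definition _ :=
  isMeasurableFun.Build _ _ _ _ torus_of_tuple torus_of_tuple_measurable.

End torus.

Section lebesgue.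
Context (R : realType).

Definition cons_tuple n (x : measurableTypeR R * n.-tuple (measurableTypeR R)) :
  n.+1.-tuple (measurableTypeR R) := [the n.+1.-tuple _ of x.1 :: x.2].

Lemma cons_tuple_measurable n : measurable_fun setT (@cons_tuple n).
Proof. exact: measurable_cons. Qed.

HB.instance Definition _ n :=
  isMeasurableFun.Build _ _ _ _ (@cons_tuple n) (@cons_tuple_measurable n).

(* n-fold product of the Lebesgue measure of [0, 1] *)
Fixpoint cube_lebesgue n : probability (n.-tuple (measurableTypeR R)) R :=
  if n is n'.+1
  then distribution (uniform_prob (@ltr01 R) \x cube_lebesgue n')%E (@cons_tuple n')
  else dirac [tuple].

Definition torus_lebesgue d : probability (torus R d) R :=
  distribution (cube_lebesgue d) (@torus_of_tuple R d).

End lebesgue.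

Section calculus.
Context {R : realType}.

(* existence and continuity of all partial derivatives up to order k *)
Fixpoint class_C (n k : nat) (F : 'rV[R]_n -> R) : Prop :=
  continuous F /\
  (if k is k'.+1 then forall i : 'I_n,
     (forall x, derivable F x (delta_mx 0 i)) /\
     class_C k' (fun x => 'D_(delta_mx 0 i) F x)
   else True).

(* Smooth functions on [0, +oo[ are the restrictions of smooth functions on the
   line. *)
Definition smooth_on_line (v : R -> R) : Prop :=
  forall n t, derivable (derive1n n v) t 1.

Definition dot n (p q : 'rV[R]_n) : R := \sum_(i < n) p 0 i * q 0 i.

Context {d : nat}.
Local Notation T := (torus R d).

Definition torus_lift (g : T -> R) : 'rV[R]_d -> R := fun x => g (to_torus x).

Definition torus_C (k : nat) (g : T -> R) : Prop := class_C k (torus_lift g).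

Definition smooth2 (K : T -> T -> R) : Prop := forall k,
  class_C k (fun z : 'rV[R]_(d + d) =>
    K (to_torus (lsubmx z)) (to_torus (rsubmx z))).

(* the choice of the representative is irrelevant, torus_lift g being periodic *)
Definition partial (i : 'I_d) (g : T -> R) : T -> R :=
  fun x => 'D_(delta_mx 0 i) (torus_lift g) (repr x).

Definition grad (g : T -> R) (x : T) : 'rV[R]_d := \row_i partial i g x.

Definition laplacian (g : T -> R) (x : T) : R :=
  \sum_(i < d) partial i (partial i g) x.

Definition sup_norm (g : T -> R) : \bar R :=
  ereal_sup (range (fun x => `|g x|%:E)).

Definition C2_norm (g : T -> R) : \bar R :=
  (sup_norm g + \sum_(i < d) sup_norm (partial i g)
   + \sum_(i < d) \sum_(j < d) sup_norm (partial i (partial j g)))%E.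

Definition momentum_grad (H : T -> 'rV[R]_d -> R) (x : T) (p : 'rV[R]_d) :
  'rV[R]_d := \row_i 'D_(delta_mx 0 i) (H x) p.

(* Only the momentum derivative is required, but jointly continuous; this holds
   in particular when H is C^1 on the product of the torus and R^d. *)
Definition C1_momentum (H : T -> 'rV[R]_d -> R) : Prop :=
  [/\ continuous (fun z : T * 'rV[R]_d => H z.1 z.2),
      forall x p, differentiable (H x) p
    & continuous (fun z : T * 'rV[R]_d => momentum_grad H z.1 z.2)].

Definition convex_momentum (H : T -> 'rV[R]_d -> R) : Prop :=
  forall x, convex_function (E := 'rV[R]_d) setT (H x).

End calculus.

Section measures.
Context {R : realType} {d : nat}.
Local Notation T := (torus R d).
Local Notation P := (probability T R).
Local Notation M := ({charge set T -> \bar R})%type.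

(* The library's measures are functions on all sets, hence Leibniz equality is
   too fine: only the values on Borel sets are meaningful. *)
Definition same_measure (m n : P) : Prop :=
  forall A, measurable A -> m A = n A.

Lemma hahn_exists (nu : M) : exists PN, hahn_decomposition nu PN.1 PN.2.
Proof. by have [A [B AB]] := Hahn_decomposition nu; exists (A, B). Qed.

Definition charge_integral (nu : M) (g : T -> R) : R :=
  let h := svalP (cid (hahn_exists nu)) in
  \int[jordan_pos h]_x g x - \int[jordan_neg h]_x g x.

(* <g, m - nu> for a signed measure nu *)
Definition pairing_sub (g : T -> R) (m : P) (nu : M) : R :=
  \int[m]_x g x - charge_integral nu g.

(* <g, div (b m)> *)
Definition pairing_div (g : T -> R) (b : T -> 'rV[R]_d) (m : P) : R :=
  - \int[m]_x dot (grad g x) (b x).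

(* <g, Delta m> *)
Definition pairing_laplacian (g : T -> R) (m : P) : R :=
  \int[m]_x laplacian g x.

Definition torus_dist (x y : T) : R :=
  inf [set r | exists a b : 'rV[R]_d, [/\ to_torus a = x, to_torus b = y
                & r = Num.sqrt (dot (a - b) (a - b))]].

Definition coupling (m n : P) : set (probability (T * T)%type R) :=
  [set g | forall A : set T, measurable A ->
     g (A `*` setT) = m A /\ g (setT `*` A) = n A].

Definition wasserstein1 (m n : P) : \bar R :=
  ereal_inf [set (\int[g]_z (torus_dist z.1 z.2)%:E)%E | g in coupling m n].

Definition continuous_xm (g : T -> P -> R) : Prop :=
  forall x m e, 0 < e -> exists2 r, 0 < r & forall y n,
    torus_dist x y < r -> (wasserstein1 m n < r%:E)%E ->
    `|g x m - g y n| < e.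

Definition continuous_txm (U : R -> T -> P -> R) : Prop :=
  forall t x m e, 0 <= t -> 0 < e -> exists2 r, 0 < r & forall s y n,
    0 <= s -> `|t - s| < r -> torus_dist x y < r ->
    (wasserstein1 m n < r%:E)%E ->
    `|U t x m - U s y n| < e.

Definition monotone_xm (g : T -> P -> R) : Prop :=
  forall mu nu : P,
    0 <= \int[mu]_x (g x mu - g x nu) - \int[nu]_x (g x mu - g x nu).


Lemma to_torus_open (B : set 'rV[R]_d) : open B ->
  open (@to_torus R d @` B).
Proof.
move=> oB; rewrite /open /= /quotient_open.
rewrite [X in open X](_ : _ =
  \bigcup_(k in [set k : 'rV[R]_d | zequiv k 0]) ((fun x => x + k) @^-1` B)).
  apply: bigcup_open => k _; apply: (@open_comp 'rV[R]_d 'rV[R]_d (fun x => x + k) B _ oB) => x _.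
  apply: continuousD; first by []. exact: cst_continuous.
apply/seteqP; split => [x [y By yx]|x [k /= k0 Bk]] /=.
  exists (y - x); last by rewrite /= addrC subrK.
  move/to_torusP : yx => /forallP yx; apply/forallP => i.
  by have := yx i; rewrite !mxE subr0.
exists (x + k) => //; apply/to_torusP/forallP => i.
by move/forallP : k0 => /(_ i); rewrite !mxE subr0 addrAC subrr add0r.
Qed.

Lemma torus2_measurable (O : set (T * T)) :
  (forall x y, O (to_torus x, to_torus y) -> exists2 e, 0 < e &
     forall x' y', ball x e x' -> ball y e y' -> O (to_torus x', to_torus y')) ->
  measurable O.
Proof.
move=> oO.
pose e (n : nat) : R := n.+1%:R^-1.
pose I (k : 'rV[rat]_d * 'rV[rat]_d * nat) := forall x y,
  ball (rat_vec R k.1.1) (e k.2) x -> ball (rat_vec R k.1.2) (e k.2) y ->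
  O (to_torus x, to_torus y).
pose B (k : 'rV[rat]_d * 'rV[rat]_d * nat) : set (T * T) := if `[< I k >]
  then (@to_torus R d @` ball (rat_vec R k.1.1) (e k.2)) `*`
       (@to_torus R d @` ball (rat_vec R k.1.2) (e k.2)) else set0.
rewrite [X in measurable X](_ : _ = \bigcup_k B k).
  apply: countable_bigcupT_measurable; first exact: countableP.
  move=> k; rewrite /B; case: asboolP => // _.
  by apply: measurableX; apply: sub_sigma_algebra; apply: to_torus_open;
    exact: ball_open.
apply/seteqP; split => [[p q] Opq|[p q] [k _]]; last first.
  rewrite /B; case: asboolP => // Ik [/= [x xk <-] [y yk <-]].
  exact: Ik.
have pE : p = to_torus (repr p) by rewrite /to_torus reprK.
have qE : q = to_torus (repr q) by rewrite /to_torus reprK.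
have [r r0 rO] : exists2 r, 0 < r & forall x' y', ball (repr p) r x' ->
    ball (repr q) r y' -> O (to_torus x', to_torus y').
  by apply: oO; rewrite -pE -qE.
have [n nr] : exists n, e n < r / 2.
  exists (Num.truncn (r / 2)^-1).
  by rewrite /e invf_plt ?posrE ?divr_gt0//; exact: Num.Theory.truncnS_gt.
have en0 : 0 < e n by rewrite invr_gt0.
have [a ap] := rat_vec_dense (repr p) en0.
have [b bq] := rat_vec_dense (repr q) en0.
have er : e n + e n <= r by rewrite (splitr r) lerD// ltW.
exists (a, b, n) => //; rewrite /B asboolT /=.
  by split; [exists (repr p)|exists (repr q)].
move=> x y ax bY; apply: rO; apply: le_ball er _ _.
  by apply: ball_triangle ax; exact: ball_sym.
by apply: ball_triangle bY; exact: ball_sym.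
Qed.

Lemma smooth2_measurable (K : T -> T -> R) : smooth2 K ->
  measurable_fun setT (fun z : T * T => K z.1 z.2).
Proof.
move=> /(_ 0%N) [cK _].
apply: (measurability _ (RGenOInfty.measurableE R)) => _ [_ [a ->] <-].
rewrite setTI; apply: torus2_measurable => x y /= Kxy.
pose F z := K (to_torus (lsubmx z)) (to_torus (@rsubmx R 1 d d z)).
have : nbhs (row_mx x y) (F @^-1` `]a, +oo[).
  apply: cK; apply: open_nbhs_nbhs; split; first exact: interval_open.
  by rewrite /F row_mxKl row_mxKr.
move=> /nbhs_ballP[r /= r0 rK]; exists r => // x' y' [_ xx] [_ yy].
have := rK (row_mx x' y'); rewrite /F /= row_mxKl row_mxKr; apply.
split => // i j; rewrite !mxE; case: (fintype.split j) => k; [exact: xx|exact: yy].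
Qed.

Definition jump_density (K : T -> T -> R) (m : P) (x : T) : \bar R :=
  (\int[m]_y (K x y)%:E)%E.

(* the probability measure with density [jump_density K m]; see [jumpE] *)
Definition jump (K : T -> T -> R) (m : P) : P :=
  xget m [set n : P | forall A, measurable A ->
    n A = (\int[torus_lebesgue R d]_(x in A) jump_density K m x)%E].

Lemma jumpE (K : T -> T -> R) (m : P) (A : set T) :
  smooth2 K -> (forall x y, 0 <= K x y) ->
  (forall y, \int[torus_lebesgue R d]_x K x y = 1) -> measurable A ->
  jump K m A = (\int[torus_lebesgue R d]_(x in A) jump_density K m x)%E.
Proof.
move=> sK K0 K1 mA; set l := torus_lebesgue R d.
have mK : measurable_fun setT (fun z : T * T => (K z.1 z.2)%:E).
  by apply/measurable_EFinP; exact: smooth2_measurable.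
have md : measurable_fun setT (jump_density K m).
  by apply: (measurable_fun_fubini_tonelli_F
    (fun z : T * T => (K z.1 z.2)%:E)) => // z; rewrite lee_fin.
have d0 x : (0 <= jump_density K m x)%E.
  by apply: integral_ge0 => y _; rewrite lee_fin.
pose n (B : set T) := (\int[l]_(x in B) jump_density K m x)%E.
have n0 : n set0 = 0%E by rewrite /n integral_set0.
have n_ge0 B : (0 <= n B)%E by apply: integral_ge0 => x _; exact: d0.
have n_add : semi_sigma_additive n by exact: semi_sigma_additive_nng_induced.
have n1 : n setT = 1%E.
  rewrite /n /jump_density (fubini_tonelli
    (fun z : T * T => (K z.1 z.2)%:E))//=; last by move=> z; rewrite lee_fin.
  rewrite (eq_integral (cst 1%E)) => [|y _].
    by rewrite integral_cst//= probability_setT mule1.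
  have := K1 y; rewrite /Rintegral -/l.
  by case: (integral _ _ _) => [r /= ->| |] //= /eqP; rewrite eq_sym oner_eq0.
pose nm := isMeasure.Build _ _ _ n n0 n_ge0 n_add.
pose nM : {measure set T -> \bar R} := HB.pack n nm.
pose np := Measure_isProbability.Build _ _ _ nM n1.
pose nP : P := HB.pack n nm np.
rewrite /jump; case: xgetP => [p _ /(_ A mA) //|/(_ nP) []].
by move=> B mB.
Qed.

Definition jump_adjoint (K : T -> T -> R) (phi : T -> R) (y : T) : R :=
  \int[torus_lebesgue R d]_x (K x y * phi x).

End measures.

Section master_equation.
Context {R : realType} {d : nat}.
Local Notation T := (torus R d).
Local Notation P := (probability T R).
Local Notation M := ({charge set T -> \bar R})%type.

Definition space_Bt (U : R -> T -> P -> R) : Prop :=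
  [/\ continuous_txm U,
      forall t m, 0 <= t -> torus_C 2 (fun x => U t x m)
    & forall S, 0 < S ->
      (ereal_sup [set C2_norm (fun x => U tm.1 x tm.2)
                 | tm in [set tm : R * P | (0 <= tm.1 <= S)%R]] < +oo)%E].

(* [same_measure] and not Leibniz equality tells points of the space apart *)
Definition strict_min (J : R -> P -> R) (S t0 : R) (m0 : P) : Prop :=
  forall t m, 0 <= t <= S -> (t <> t0 \/ ~ same_measure m m0) ->
    J t0 m0 < J t m.

Definition monotone_solution (sigma lambda : R) (K : T -> T -> R)
    (H : T -> 'rV[R]_d -> R) (f U0 : T -> P -> R) (U : R -> T -> P -> R) :
    Prop :=
  [/\ space_Bt U, forall x m, U 0 x m = U0 x m
  & forall (phi : T -> R) (nu : M) (theta : R -> R) (S t0 : R) (m0 : P),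
    torus_C 2 phi -> smooth_on_line theta -> 0 < S -> 0 < t0 <= S ->
    strict_min (fun t m =>
      pairing_sub (fun x => U t x m - phi x) m nu - theta t) S t0 m0 ->
    let u := fun x => U t0 x m0 in
    let b := fun x => momentum_grad H x (grad u x) in
    let w := fun x => u x - phi x in
    derive1 theta t0
    + pairing_sub (fun x => - sigma * laplacian u x + H x (grad u x)
        + lambda * (u x - jump_adjoint K (fun y => U t0 y (jump K m0)) x))
        m0 nu
    >= pairing_sub (fun x => f x m0) m0 nu
       - pairing_div w b m0 - sigma * pairing_laplacian w m0].

End master_equation.

(* Main.v *)
(* Doubling of variables. If the pairing <U(t,.,m) - V(t,.,n), m - n> were
   negative somewhere, one would minimise, over times and measures,
     <U(t,.,m) - V(s,.,n), m - n> + a (t - s)^2 + c (t + s)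
       - e (Q m + Q n + t^2 + s^2)
   with a large and c, e small. Here Q m is the sum of the <g_i, m>^2 for
   functions g_i that separate measures and decrease fast in C^2. As Q is
   strictly convex, replacing -e Q by its linearisation at a minimiser, which is
   an admissible perturbation of the test function, makes the minimum strict; no
   variational principle is needed. At positive times the inequalities of U in
   (t, m) and of V in (s, n) then add up to a contradiction: the Laplacians
   cancel, H is handled by convexity, f by monotonicity, and the jump term by
   comparing the minimum with the value at the images of m and n under the jump.
   If no minimum at positive times exists as a grows, the limit violates the
   monotonicity of U_0.

   The pairing is thus non-negative. Taking V = U gives monotonicity. Taking for
   n a mixture of m and a small Dirac mass at x shows that U - V at x is at most
   its mean under m; by symmetry U - V does not depend on x.

   The minimum exists because a sequence of probability measures on the torus has
   a subsequence with an almost surely convergent Skorokhod representation: a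
   space-filling curve reduces this to measures on [0, 1], hence to monotone
   quantile functions and Helly's selection. *)

Require Import Defs.
From HB Require Import structures.
From mathcomp Require Import all_boot all_order all_algebra.
From mathcomp Require Import generic_quotient.
From mathcomp Require Import all_classical all_reals all_analysis.
From mathcomp Require Import measurable_realfun ring lra.
Import Order.TTheory GRing.Theory Num.Theory.
Import numFieldNormedType.Exports.
Set Implicit Arguments.
Unset Strict Implicit.
Unset Printing Implicit Defensive.
Local Open Scope classical_set_scope.
Local Open Scope ring_scope.

(** * Geometric series and a space-filling curve *)

(** A solution is tested only at strict minima and only with perturbations that are affine in the
    measure, with a C^2 density. A penalty must therefore have a C^2 derivative in the measure,
    bounded uniformly in the point; hence the C^2 normalisation of the separating functions and the
    termwise differentiation of their series.

    The parameters are fixed in a definite order. Let - delta be the negative value, at time t. Then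
    c = delta / (8 t), and e is small with respect to c and delta. At a minimum with both times
    positive, summing the two inequalities cancels the derivatives 2 a (t - s), and 2 c is left; all
    other terms have a favourable sign or are at most a constant times e, uniformly in a. Uniformity
    rests on the gradient bound of the solution space, which keeps the momenta, hence the drifts
    D_pH, bounded. So for every a one of the two times of a minimiser vanishes, and letting a grow
    forces both limits to be 0. At the other end there is no boundary effect: the definition of a
    solution admits a minimum at the final time, so the horizon is t itself. *)

Section geometric_domination.
Context {R : realType}.
Implicit Types f g : nat -> R.

Definition dominated f := forall n, `|f n| <= 2^-1 ^+ n.

Definition gsum f : R := limn (series f).

Lemma half_ge0 n : 0 <= 2^-1 ^+ n :> R.
Proof. by apply: exprn_ge0; lra. Qed.

Lemma series_half n : series (fun k => 2^-1 ^+ k) n = 2 - 2 * 2^-1 ^+ n :> R.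
Proof.
elim: n => [|n IH]; first by rewrite /series /= big_geq// expr0; lra.
by rewrite seriesSr IH exprS; lra.
Qed.

Lemma cvg_half : 2^-1 ^+ n @[n --> \oo] --> (0 : R).
Proof. by apply: cvg_expr; rewrite ger0_norm; lra. Qed.

Lemma dominated_cvg f : dominated f -> cvgn (series f).
Proof.
move=> df; apply: normed_cvg; apply: (@series_le_cvg _ _ (fun k => 2^-1 ^+ k)) => [n|n|n|].
- exact: normr_ge0.
- exact: half_ge0.
- exact: df.
have -> : series (fun k => 2^-1 ^+ k) = (fun n => 2 - 2 * 2^-1 ^+ n) :> (R ^nat).
  by apply/funext => n; rewrite series_half.
apply: is_cvgB; first exact: is_cvg_cst.
by apply: is_cvgMr; apply/cvg_ex; exists 0; exact: cvg_half.
Qed.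

Lemma gsum_tail f n : dominated f ->
  `|gsum f - \sum_(k < n) f k| <= 2 * 2^-1 ^+ n.
Proof.
move=> df; have cf := dominated_cvg df.
have : `|gsum f - series f n| <= 2 * 2^-1 ^+ n.
  have cd : `|series f m - series f n| @[m --> \oo] --> `|gsum f - series f n|.
    by apply: cvg_norm; apply: cvgB => //; exact: cvg_cst.
  rewrite -(cvg_lim _ cd)//; apply: limr_le; first by apply/cvg_ex; eexists; exact: cd.
  exists n => // m /= nm.
  rewrite sub_series_geq//.
  apply: le_trans (ler_norm_sum _ _ _) _.
  apply: (@le_trans _ _ (\sum_(n <= k < m) 2^-1 ^+ k)).
    by apply: ler_sum => i _; exact: df.
  rewrite -[X in X <= _](@sub_series_geq _ (fun k => 2^-1 ^+ k))// !series_half.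
  by have := half_ge0 m; lra.
by rewrite /series /= big_mkord.
Qed.

Lemma gsum_bound f : dominated f -> `|gsum f| <= 2.
Proof. by move=> /(gsum_tail 0); rewrite big_ord0 subr0 expr0 mulr1. Qed.

Lemma gsumZ c f : dominated f -> gsum (fun n => c * f n) = c * gsum f.
Proof.
move=> df; apply/cvg_lim => //.
have -> : series (fun n => c * f n) = (fun n => c * series f n).
  by apply/funext => n; rewrite /series /= mulr_sumr.
by apply: cvgMr; exact: dominated_cvg.
Qed.

Lemma gsumZB c f g : dominated f -> dominated g ->
  gsum (fun n => c * (f n - g n)) = c * (gsum f - gsum g).
Proof.
move=> df dg; apply/cvg_lim => //.
have -> : series (fun n => c * (f n - g n)) = (fun n => c * (series f n - series g n)).
  by apply/funext => n; rewrite /series /= -sumrB mulr_sumr.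
by apply: cvgMr; apply: cvgB; exact: dominated_cvg.
Qed.

Lemma gsum_ge0 f : dominated f -> (forall n, 0 <= f n) -> 0 <= gsum f.
Proof.
move=> df f0; apply: limr_ge; first exact: dominated_cvg.
by apply: nearW => n; rewrite /series /=; apply: sumr_ge0.
Qed.

Lemma cvg_sumr {I J : Type} (F : set_system I) {FF : Filter F} (s : seq J)
    (f : J -> I -> R) (l : J -> R) : (forall k, f k i @[i --> F] --> l k) ->
  \sum_(k <- s) f k i @[i --> F] --> \sum_(k <- s) l k.
Proof.
move=> fl; elim: s => [|k s IH].
  by rewrite big_nil; under eq_fun do rewrite big_nil; exact: cvg_cst.
by rewrite big_cons; under eq_fun do rewrite big_cons; exact: cvgD.
Qed.

(** Exchange of limit and series, the tails being uniformly small. The filter is arbitrary because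
    the lemma serves for continuity at a point, for difference quotients as h tends to 0 and for
    sequences of measures. *)
Lemma gsum_cvg {I : Type} (F : set_system I) {FF : Filter F}
    (f : I -> nat -> R) (l : nat -> R) :
  (forall i, dominated (f i)) -> dominated l ->
  (forall n, f i n @[i --> F] --> l n) -> gsum (f i) @[i --> F] --> gsum l.
Proof.
move=> df dl fl; apply/cvgrPdist_le => e e0.
(* Each of the two tails is at most 2 e / 5, and the finite sums differ by at most e / 5. *)
have [N _ /(_ N (leqnn N)) hN] : \forall n \near \oo, 2^-1 ^+ n <= e / 5.
  have /cvgrPdist_le /(_ (e / 5)) : 2^-1 ^+ n @[n --> \oo] --> (0 : R) := cvg_half.
  case; first by lra.
  move=> N _ HN; exists N => // n /HN; rewrite sub0r normrN ger0_norm// half_ge0.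
have : \sum_(k < N) f i k @[i --> F] --> \sum_(k < N) l k.
  by apply: cvg_sumr => k; exact: fl.
move=> /cvgrPdist_le /(_ (e / 5)) H; have {}H := H ltac:(lra).
apply: filterS H => i.
move=> h1; have h2 := gsum_tail N dl; have h3 := gsum_tail N (df i).
rewrite /= in hN.
move: h1 h2 h3; rewrite !ler_norml.
by set a := \sum_(k < N) l k; set b := \sum_(k < N) _; lra.
Qed.

End geometric_domination.

Section peano.
Context {R : realType}.

(** The cosine at the end 1/3 of a plateau: [2^-1 - cos (pi * t) / (2 * kappa)] reaches 0 there, and
    the truncation in [tooth] flattens the rest. *)
Let kappa : R := cos (pi / 3).

Let kappa_gt0 : 0 < kappa.
Proof. by apply: cos_gt0_pihalf; have := @pi_gt0 R; lra. Qed.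

(* A continuous 2-periodic function equal to 0 on [0, 1/3] and to 1 on
   [1, 4/3]. *)
Definition tooth (t : R) : R :=
  Num.max 0 (Num.min 1 (2^-1 - cos (pi * t) / (2 * kappa))).

Lemma tooth_ge0 t : 0 <= tooth t.
Proof. by rewrite /tooth le_max lexx. Qed.

Lemma tooth_le1 t : tooth t <= 1.
Proof. by rewrite /tooth ge_max ler01 ge_min lexx. Qed.

Lemma continuous_tooth : continuous tooth.
Proof.
move=> t; apply: (@continuous_max R R (cst 0) (fun t => Num.min 1
  (2^-1 - cos (pi * t) / (2 * kappa)))); first exact: cst_continuous.
apply: (@continuous_min R R (cst 1) (fun t => 2^-1 - cos (pi * t) / (2 * kappa))).
  exact: cst_continuous.
apply: continuousB; first exact: cst_continuous.
apply: continuousM; last exact: cst_continuous.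
apply: (@continuous_comp _ _ _ (fun s => pi * s) (@cos R)); last exact: continuous_cos.
by apply: continuousM; [exact: cst_continuous|].
Qed.

Lemma cos_digit (a : bool) (n : nat) (r : R) :
  cos (pi * ((2 * n)%:R + a%:R + r)) = (-1) ^+ a * cos (pi * r).
Proof.
have -> : pi * ((2 * n)%:R + a%:R + r) = pi * r + pi *+ (a + 2 * n).
  rewrite natrM -(mulr_natr pi) natrD natrM; ring.
by rewrite (alternatingn (@cosDpi R)) exprD exprM sqrrN !expr1n mulr1.
Qed.

Lemma tooth_digit (a : bool) (n : nat) (r : R) : 0 <= r <= 3^-1 ->
  tooth ((2 * n)%:R + a%:R + r) = a%:R.
Proof.
move=> r01; rewrite /tooth cos_digit.
have rk : kappa <= cos (pi * r).
  have p0 := @pi_gt0 R.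
  have h : pi * r <= pi / 3 by rewrite ler_pM2l//; lra.
  have h0 : 0 <= pi * r by rewrite mulr_ge0//; lra.
  by rewrite /kappa leNgt ltr_cos ?in_itv/= -?leNgt//; apply/andP; split; lra.
have rk2 : 2^-1 <= cos (pi * r) / (2 * kappa).
  by rewrite ler_pdivlMr ?mulr_gt0//; lra.
case: a => /=.
  rewrite expr1 mulN1r mulNr opprK min_l; last lra.
  by rewrite max_r.
rewrite expr0 mul1r min_r; last by lra.
by rewrite max_l//; lra.
Qed.

Variable d : nat.

(** Coordinate i reads the base-4 digits of t whose index is congruent to i modulo d. *)
Definition peano_term (i : nat) (t : R) (n : nat) : R :=
  2^-1 ^+ n.+1 * tooth (4 ^+ (d * n + i).+1 * t).

(* Schoenberg's space-filling curve *)
Definition peano (t : R) : 'rV[R]_d := \row_i gsum (peano_term i t).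

Lemma half_dominated (c : R) n : `|c| <= 1 -> `|2^-1 ^+ n.+1 * c| <= 2^-1 ^+ n :> R.
Proof.
move=> c1; rewrite normrM ger0_norm ?half_ge0//.
have := @half_ge0 R n; have := normr_ge0 c; rewrite exprS; nra.
Qed.

Lemma peano_dominated i t : dominated (peano_term i t).
Proof.
by move=> n; apply: half_dominated; rewrite ger0_norm ?tooth_le1// tooth_ge0.
Qed.

Lemma continuous_row (T : topologicalType) (f : 'I_d -> T -> R) :
  (forall i, continuous (f i)) -> continuous (fun t => \row_i f i t).
Proof.
move=> cf t; apply/cvg_ballP => e e0.
have H : forall i, \forall s \near t, ball (f i t) e (f i s).
  by move=> i; exact: (cvg_ball (cf i t)).
have {}H : \forall s \near t, forall i, ball (f i t) e (f i s).
  exact: filter_forall.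
apply: filterS H => s H; split=> // i j.
by rewrite [X in ball X]mxE [X in ball _ _ X]mxE.
Qed.

Lemma peano_continuous : continuous peano.
Proof.
apply: continuous_row => i t; apply: gsum_cvg.
- by move=> s; exact: peano_dominated.
- exact: peano_dominated.
- move=> n; apply: cvgMr; set c := 4 ^+ _.
  have cc : {for t, continuous (fun s : R => c * s)}.
    by apply: continuousM; [exact: cst_continuous|].
  exact: (continuous_comp cc (@continuous_tooth _)).
Qed.

(** With N n the integer part of 2^n y, the digits are the parities of the N n.+1 and the partial
    sums are 2^-n N n; y < 1 gives N 0 = 0. *)
Lemma binary_expansion (y : R) : 0 <= y < 1 ->
  exists a : nat -> bool, y = gsum (fun n => 2^-1 ^+ n.+1 * (a n)%:R).
Proof.
move=> /andP[y0 y1].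
pose N n := Num.truncn (2 ^+ n * y).
have NP n : (N n)%:R <= 2 ^+ n * y < (N n).+1%:R.
  by apply: truncn_itv; rewrite mulr_ge0// exprn_ge0.
have N0 : N 0%N = 0%N by apply: truncn_def; rewrite expr0 mul1r; lra.
exists (fun n => odd (N n.+1)).
have NS n : N n.+1 = (2 * N n + odd (N n.+1))%N.
  have /andP[h1 h2] := NP n; have /andP[h3 h4] := NP n.+1.
  suff -> : N n = (N n.+1)./2 by rewrite mul2n addnC odd_double_half.
  apply/eqP; rewrite eqn_leq; apply/andP; split.
    rewrite geq_half_double -ltnS -(ltr_nat R) -mul2n natrM.
    by apply: le_lt_trans h4; rewrite exprS -mulrA; lra.
  rewrite -ltnS ltn_half_double -(ltr_nat R) -mul2n natrM.
  by apply: le_lt_trans h3 _; rewrite exprS -mulrA; lra.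
have S n : series (fun n => 2^-1 ^+ n.+1 * (odd (N n.+1))%:R) n
    = 2^-1 ^+ n * (N n)%:R :> R.
  elim: n => [|n IH]; first by rewrite /series /= big_geq// N0 mulr0.
  by rewrite seriesSr IH [in RHS]NS natrD natrM exprS; lra.
apply/esym/cvg_lim => //; rewrite (funext S).
apply: (@squeeze_cvgr _ _ _ _ (fun n => y - 2^-1 ^+ n) (fun=> y)).
- apply: nearW => n; have /andP[h1 h2] := NP n.
  have e : 2^-1 ^+ n * (2 ^+ n * y) = y by rewrite mulrA -exprMn mulVf// expr1n mul1r.
  have h := @half_ge0 R n.
  have p : 0 < 2^-1 ^+ n :> R by apply: exprn_gt0; lra.
  apply/andP; split; last by rewrite -[leRHS]e ler_pM2l.
  have : 2^-1 ^+ n * (2 ^+ n * y) <= 2^-1 ^+ n * (N n).+1%:R by rewrite ler_pM2l// ltW.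
  have E : (N n).+1%:R = (N n)%:R + 1 :> R by rewrite natr1.
  by rewrite e E mulrDr mulr1; lra.
- rewrite -[X in _ --> X]subr0; apply: cvgB; first exact: cvg_cst.
  exact: cvg_half.
- exact: cvg_cst.
Qed.

(** t has the digits b in base 4. As they are 0 or 1, what follows a digit adds at most 1/4 + 1/16 +
    ... = 1/3, the length of a plateau of [tooth]; what precedes it is a multiple of 2, which the
    period of [tooth] removes. *)
Lemma base4_digits (b : nat -> bool) : exists2 t : R, 0 <= t <= 1 &
  forall n, exists N r, 4 ^+ n.+1 * t = (2 * N)%:R + (b n)%:R + r /\ 0 <= r <= 3^-1.
Proof.
pose f m n : R := 4^-1 ^+ n.+1 * (b (m + n)%N)%:R.
have q0 n : 0 <= 4^-1 ^+ n :> R by apply: exprn_ge0; lra.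
have f0 m n : 0 <= f m n by rewrite mulr_ge0.
have f4 m n : f m n <= 4^-1 ^+ n.+1.
  by rewrite ler_piMr//; case: (b _).
have fd m : dominated (f m).
  move=> n; rewrite ger0_norm//; apply: le_trans (f4 m n) _.
  apply: (@le_trans _ _ (2^-1 ^+ n.+1)).
    have h : 4^-1 <= 2^-1 :> R by lra.
    by rewrite lerXn2r ?nnegrE ?invr_ge0.
  by rewrite exprS; have := @half_ge0 R n; lra.
have S4 n : series (fun n => 4^-1 ^+ n.+1) n = 3^-1 - 3^-1 * 4^-1 ^+ n :> R.
  elim: n => [|n IH]; first by rewrite /series /= big_geq// expr0; lra.
  by rewrite seriesSr IH exprS; lra.
have g0 m : 0 <= gsum (f m) by apply: gsum_ge0.
have g3 m : gsum (f m) <= 3^-1.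
  apply: limr_le; first exact: dominated_cvg.
  apply: nearW => n; apply: (@le_trans _ _ (series (fun n => 4^-1 ^+ n.+1) n)).
    by apply: ler_sum => i _; exact: f4.
  by rewrite S4; have := q0 n; lra.
have step m : 4 * gsum (f m) = (b m)%:R + gsum (f m.+1).
  have -> : gsum (f m) = f m 0%N + gsum (fun n => f m n.+1).
    apply/cvg_lim => //; rewrite -(cvg_shiftn 1).
    rewrite (_ : (fun n => _) = (fun n => f m 0%N + series (fun n => f m n.+1) n)); last first.
      by apply/funext => n; rewrite /series /= addn1 big_nat_recl.
    apply: cvgD; first exact: cvg_cst.
    apply: dominated_cvg => n; rewrite ger0_norm//.
    have := fd m n.+1; rewrite ger0_norm// exprS; have := @half_ge0 R n; lra.
  rewrite mulrDr -gsumZ; last first.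
    move=> n; rewrite ger0_norm//.
    by have := fd m n.+1; rewrite ger0_norm// exprS; have := @half_ge0 R n; lra.
  congr (_ + _); first by rewrite /f addn0 expr1; lra.
  by congr gsum; apply/funext => n; rewrite /f addnS addSn exprS; lra.
exists (gsum (f 0%N)); first by have := g0 0%N; have := g3 0%N; lra.
suff H n : exists N, 4 ^+ n.+1 * gsum (f 0%N) = (2 * N)%:R + (b n)%:R + gsum (f n.+1).
  move=> n; have [N HN] := H n; exists N, (gsum (f n.+1)); split=> //.
  by rewrite g0 g3.
elim: n => [|n [N HN]]; first by exists 0%N; rewrite expr1 muln0 add0r step.
exists (4 * N + 2 * b n)%N; rewrite exprS -mulrA HN mulrDr step.
by rewrite !natrM natrD !natrM; lra.
Qed.

Lemma peano_surj (y : 'rV[R]_d) : (forall i, 0 <= y 0 i < 1) ->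
  exists2 t, 0 <= t <= 1 & peano t = y.
Proof.
move=> y01.
have /choice[a aP] : forall i, exists a : nat -> bool,
    y 0 i = gsum (fun n => 2^-1 ^+ n.+1 * (a n)%:R).
  by move=> i; exact: binary_expansion.
have [d0|d0] := posnP d.
  by exists 0; [rewrite lexx ler01|apply/rowP => i; have := ltn_ord i; rewrite {2}d0].
(* Interleaves the d binary expansions in the order in which [peano_term] reads them. *)
pose b k := a (Ordinal (ltn_pmod k d0)) (k %/ d)%N.
have [t t01 tP] := base4_digits b.
exists t => //; apply/rowP => i; rewrite mxE aP; congr gsum; apply/funext => n.
rewrite /peano_term; have [N [r [-> r3]]] := tP (d * n + i)%N.
rewrite tooth_digit// /b mulnC; congr (_ * (a _ _)%:R).
  by apply: val_inj => /=; rewrite modnMDl modn_small.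
by rewrite divnMDl// divn_small// addn0.
Qed.

End peano.

(** * Expectations, subsequences and quantiles *)

Section bounded_measurable.
Context (R : realType) (dT : measure_display) (T : measurableType dT).
Implicit Types f g : T -> R.

Definition bounded_measurable f :=
  measurable_fun setT f /\ exists B, forall x, `|f x| <= B.

Lemma bounded_measurable_cst c : bounded_measurable (fun=> c).
Proof. by split; [exact: measurable_cst|exists `|c|]. Qed.

Lemma bounded_measurableD f g : bounded_measurable f -> bounded_measurable g ->
  bounded_measurable (fun x => f x + g x).
Proof.
move=> [mf [B fB]] [mg [C gC]]; split; first exact: measurable_funD.
by exists (B + C) => x; apply: le_trans (ler_normD _ _) _; exact: lerD.
Qed.

Lemma bounded_measurableM f g : bounded_measurable f -> bounded_measurable g ->
  bounded_measurable (fun x => f x * g x).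
Proof.
move=> [mf [B fB]] [mg [C gC]]; split; first exact: measurable_funM.
by exists (B * C) => x; rewrite normrM; exact: ler_pM.
Qed.

Lemma bounded_measurableZ c f : bounded_measurable f ->
  bounded_measurable (fun x => c * f x).
Proof. by apply: bounded_measurableM; exact: bounded_measurable_cst. Qed.

Lemma bounded_measurableB f g : bounded_measurable f -> bounded_measurable g ->
  bounded_measurable (fun x => f x - g x).
Proof.
move=> [mf [B fB]] [mg [C gC]]; split; first exact: measurable_funB.
by exists (B + C) => x; apply: le_trans (ler_normB _ _) _; exact: lerD.
Qed.

Variable P : probability T R.

Lemma bounded_measurable_integrable f : bounded_measurable f ->
  P.-integrable setT (EFin \o f).
Proof.
move=> [mf [B fB]]; apply: measurable_bounded_integrable => //.
  by rewrite (le_lt_trans (probability_le1 _ _)) ?ltry.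
exists B; split; first exact: num_real.
by move=> x Bx y _ /=; apply: le_trans (fB y) (ltW _).
Qed.

Lemma expectD f g : bounded_measurable f -> bounded_measurable g ->
  \int[P]_x (f x + g x) = \int[P]_x f x + \int[P]_x g x.
Proof. by move=> bf bg; rewrite RintegralD//; exact: bounded_measurable_integrable. Qed.

Lemma expectB f g : bounded_measurable f -> bounded_measurable g ->
  \int[P]_x (f x - g x) = \int[P]_x f x - \int[P]_x g x.
Proof. by move=> bf bg; rewrite RintegralB//; exact: bounded_measurable_integrable. Qed.

Lemma expectZ c f : bounded_measurable f ->
  \int[P]_x (c * f x) = c * \int[P]_x f x.
Proof. by move=> bf; rewrite RintegralZl//; exact: bounded_measurable_integrable. Qed.

Lemma expect_cst c : \int[P]_x c = c.
Proof. by rewrite Rintegral_cst// [X in fine X](@probability_setT _ _ _ P) mulr1. Qed.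

Lemma le_expect f g : bounded_measurable f -> bounded_measurable g ->
  (forall x, f x <= g x) -> \int[P]_x f x <= \int[P]_x g x.
Proof.
by move=> bf bg fg; apply: le_Rintegral => //; exact: bounded_measurable_integrable.
Qed.

Lemma norm_expect_le f B : measurable_fun setT f -> (forall x, `|f x| <= B) ->
  `|\int[P]_x f x| <= B.
Proof.
move=> mf fB; have bf : bounded_measurable f by split=> //; exists B.
have bB := bounded_measurable_cst B; rewrite ler_norml; apply/andP; split.
  rewrite -[leLHS]expect_cst; apply: le_expect => //; first exact: bounded_measurable_cst.
  by move=> x; have := fB x; rewrite ler_norml => /andP[].
rewrite -[leRHS]expect_cst; apply: le_expect => // x.
by have := fB x; rewrite ler_norml => /andP[].
Qed.

Lemma ae_imply (A B : T -> Prop) : (forall x, A x -> B x) ->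
  {ae P, forall x, A x} -> {ae P, forall x, B x}.
Proof. by move=> AB; exact: filterS. Qed.

Lemma cvg_expect (f_ : nat -> T -> R) (f : T -> R) B :
  (forall n, measurable_fun setT (f_ n)) -> measurable_fun setT f ->
  (forall n x, `|f_ n x| <= B) ->
  {ae P, forall x, f_ n x @[n --> \oo] --> f x} ->
  \int[P]_x f_ n x @[n --> \oo] --> \int[P]_x f x.
Proof.
move=> mf_ mf fB fcvg.
have iB : P.-integrable setT (EFin \o (fun=> B)).
  by apply: bounded_measurable_integrable; exact: bounded_measurable_cst.
have [fi _ H] := @dominated_convergence _ T R P setT measurableT
  (fun n => EFin \o f_ n) (EFin \o f) (EFin \o (fun=> B))
  (fun n => iffRL (measurable_EFinP _ _) (mf_ n)) (iffRL (measurable_EFinP _ _) mf)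
  ltac:(by apply: filterS fcvg => x fx _; apply/cvg_EFin; [exact: nearW|exact: fx])
  iB ltac:(by apply: aeW => x n _; rewrite /= lee_fin).
have : fine (\int[P]_x (f_ n x)%:E)%E @[n --> \oo] --> fine (\int[P]_x (f x)%:E)%E.
  by apply: fine_cvg; rewrite fineK ?integrable_fin_num.
by [].
Qed.

End bounded_measurable.

Section pushforward_expectation.
Context (R : realType) (d1 d2 : measure_display) (T1 : measurableType d1)
  (T2 : measurableType d2).

Lemma expect_distribution (P : probability T1 R) (X : {mfun T1 >-> T2}) (f : T2 -> R) :
  bounded_measurable f -> \int[distribution P X]_y f y = \int[P]_x f (X x).
Proof.
move=> bf; rewrite /Rintegral; congr fine.
apply: (@integral_distribution _ _ _ _ _ P X (EFin \o f)).
  by apply/measurable_EFinP; case: bf.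
apply: (@bounded_measurable_integrable _ _ _ P (f \o X)); case: bf => mf [B fB].
by split; [exact: measurableT_comp|exists B => x; exact: fB].
Qed.

Lemma bounded_measurable_comp (X : T1 -> T2) (f : T2 -> R) :
  measurable_fun setT X -> bounded_measurable f -> bounded_measurable (f \o X).
Proof.
move=> mX [mf [B fB]]; split; last by exists B => x; exact: fB.
exact: measurableT_comp.
Qed.

End pushforward_expectation.

Section diagonal_extraction.
Context {R : realType}.

(* Limits along a free ultrafilter exist for every index at once and preserve
   inequalities; a subsequence realises them on countably many indices. *)
Lemma diagonal_extraction (J : Type) (e : nat -> J) (a : nat -> J -> R) (B : R) :
  (forall k j, `|a k j| <= B) ->
  exists (l : J -> R) (kappa : nat -> nat),
    [/\ forall n, (n <= kappa n)%N,
        forall i j c, (forall k, a k i <= a k j + c) -> l i <= l j + c,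
        forall j c, (forall k, a k j <= c) -> l j <= c,
        forall j c, (forall k, c <= a k j) -> c <= l j &
        forall m, a (kappa n) (e m) @[n --> \oo] --> l (e m)].
Proof.
(* Every bounded sequence has a cluster point along the ultrafilter; since a set or its complement
   belongs to it, the cluster point is a limit. *)
move=> aB; have [G [UG HG]] := ultraFilterLemma (eventually_filter : ProperFilter (\oo : set_system nat)).
have /boolp.choice[l lP] : forall j, exists x : R, a k j @[k --> G] --> x.
  move=> j; have := @segment_compact R (- B) B.
  move=> /(_ (a k j @[k --> G]) _) [].
    by rewrite /=; apply: filterE => k; rewrite /= in_itv/= -ler_norml.
  move=> x [_ clx]; exists x => N Nx.
  have [//|GN] := in_ultra_setVsetC ((a^~ j) @^-1` N) UG.
  have [y [/= NyC Ny]] := clx (~` N) N GN Nx.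
  by [].
have GP : ProperFilter G by exact: ultra_proper.
(* The set of k for which the first n indices are close to their limits belongs to the ultrafilter,
   as does every tail, so the two meet. *)
have /boolp.choice[kappa kP] : forall n, exists k, (n <= k)%N /\
    forall m, (m < n)%N -> `|l (e m) - a k (e m)| < n.+1%:R^-1.
  move=> n; have : G [set k | (n <= k)%N /\
      forall m : 'I_n, `|l (e m) - a k (e m)| < n.+1%:R^-1].
    apply: filterI; first by apply: HG; exists n.
    apply: filter_forall => m; have := lP (e m) => /cvgrPdist_lt; apply.
    by rewrite invr_gt0.
  move=> /filter_ex [k [nk H]]; exists k; split=> // m mn.
  exact: (H (Ordinal mn)).
exists l, kappa; split.
- by move=> n; case: (kP n).
- move=> i j c aij; apply: (ler_cvg_to (lP i) _ _).
  + by apply: cvgD; [exact: lP|exact: cvg_cst].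
  + by apply: filterE.
- move=> j c h; apply: (ler_cvg_to (lP j) (cvg_cst c)); exact: filterE.
- move=> j c h; apply: (ler_cvg_to (cvg_cst c) (lP j)); exact: filterE.
- move=> m; apply/cvgrPdist_lt => eps eps0.
  near=> n; apply: (lt_trans ((kP n).2 m _)).
    by near: n; exists m.+1.
  by near: n; exact: near_infty_natSinv_lt (PosNum eps0).
Unshelve. all: end_near. Qed.

End diagonal_extraction.

Section monotone_limits.
Context {R : realType}.

Let L : probability (measurableTypeR R) R := uniform_prob (@ltr01 R).

Lemma uniform01E (A : set R) : measurable A ->
  L A = lebesgue_measure (A `&` `[0, 1]).
Proof.
move=> mA; rewrite /L /= /uniform_prob integral_uniform_pdf.
rewrite (eq_integral (cst 1%E)).
  by rewrite integral_cst ?mul1e//; exact: measurableI.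
by move=> x; rewrite inE/= in_itv/= /uniform_pdf => -[_ ->]; rewrite subr0 invr1.
Qed.

(** Discards the null point 0, since [quantile_le] is about positive w. *)
Lemma uniform01_ocE (A : set R) : measurable A ->
  L A = lebesgue_measure (A `&` `]0, 1]).
Proof.
move=> mA; rewrite uniform01E//; apply/eqP; rewrite eq_le; apply/andP; split.
  rewrite -[leRHS]add0e -(@lebesgue_measure_set1 R 0).
  apply: le_trans (measureU2 _ _ _) => //; last exact: measurableI.
  apply: le_measure; rewrite ?inE; [exact: measurableI| |].
    by apply: measurableU => //; exact: measurableI.
  move=> x [Ax]; rewrite /= !in_itv/= => /andP[x0 x1].
  have [->|xn0] := eqVneq x 0; first by left.
  by right; split=> //; rewrite lt_neqAle eq_sym xn0 x0.
apply: le_measure; rewrite ?inE; [exact: measurableI|exact: measurableI|].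
by apply: setIS => x /=; rewrite !in_itv/= => /andP[/ltW -> ->].
Qed.

(** The one-sided limits of a monotone function exist and enclose X w, so they equal X w as soon as
    they coincide. *)
Lemma nondecreasing_bracket (X : R -> R) (w eps : R) : nondecreasing_fun X ->
  ~ discontinuity X w -> 0 < eps ->
  exists q1 q2 : rat, [/\ ratr q1 < w, X w - eps / 2 < X (ratr q1),
    w < ratr q2 & X (ratr q2) < X w + eps / 2].
Proof.
move=> ndX ndisc eps0.
have ndl : cvg (X x @[x --> w^'-]).
  apply: nondecreasing_at_left_is_cvgr; near=> x; first by move=> y z _ _; exact: ndX.
  by exists (X w) => _ [y /= + <-]; rewrite in_itv/= => /andP[_ /ltW]; exact: ndX.
have ndr : cvg (X x @[x --> w^'+]).
  apply: nondecreasing_at_right_is_cvgr; near=> x; first by move=> y z _ _; exact: ndX.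
  by exists (X w) => _ [y /= + <-]; rewrite in_itv/= => /andP[/ltW + _]; exact: ndX.
have lr : lim (X x @[x --> w^'-]) = lim (X x @[x --> w^'+]).
  by apply/eqP/negPn/negP => ne; apply: ndisc.
have lX : lim (X x @[x --> w^'-]) <= X w.
  apply: limr_le => //; near=> x; apply: ndX; near: x.
  exact: nbhs_left_le.
have rX : X w <= lim (X x @[x --> w^'+]).
  apply: limr_ge => //; near=> x; apply: ndX; near: x.
  exact: nbhs_right_ge.
have lE : lim (X x @[x --> w^'-]) = X w.
  by apply/eqP; rewrite eq_le lX lr rX.
have [q1 q1w Xq1] : exists2 q : rat, ratr q < w & X w - eps / 2 < X (ratr q).
  move: ndl => /(cvgr_gt _) /(_ (X w - eps / 2)); rewrite lE => /(_ ltac:(lra)).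
  move=> H; have : \forall y \near w^'-, X w - eps / 2 < X y /\ y < w.
    by apply: filterI H _; exact: nbhs_left_lt.
  move=> /(@filter_ex _ _ (at_left_proper_filter w))[y [Xy yw]].
  have [q /andP[yq qw]] := rat_in_itvoo yw.
  by exists q => //; apply: lt_le_trans Xy _; apply: ndX; exact: ltW.
have [q2 q2w Xq2] : exists2 q : rat, w < ratr q & X (ratr q) < X w + eps / 2.
  move: ndr => /(cvgr_lt _) /(_ (X w + eps / 2)); rewrite -lr lE => /(_ ltac:(lra)).
  move=> H; have : \forall y \near w^'+, X y < X w + eps / 2 /\ w < y.
    by apply: filterI H _; exact: nbhs_right_gt.
  move=> /(@filter_ex _ _ (at_right_proper_filter w))[y [Xy yw]].
  have [q /andP[yq qw]] := rat_in_itvoo yw.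
  by exists q => //; apply: le_lt_trans Xy; apply: ndX; exact: ltW.
by exists q1, q2.
Unshelve. all: end_near. Qed.

(** The convergence part of Helly's theorem: at a continuity point w of X, the value X_n w is
    squeezed between values at two nearby rationals. The other points of [0, 1] are countably many,
    hence null. *)
Lemma nondecreasing_cvg_ae (X_ : nat -> R -> R) (X : R -> R) :
  (forall n, nondecreasing_fun (X_ n)) -> nondecreasing_fun X ->
  (forall q : rat, X_ n (ratr q) @[n --> \oo] --> X (ratr q)) ->
  {ae L, forall w, X_ n w @[n --> \oo] --> X w}.
Proof.
move=> ndX_ ndX Xq.
pose D := [set w | (w \in `]0, 1[) /\ discontinuity X w] `|` ([set (0 : R)] `|` [set (1 : R)]).
have cN (A : set R) : countable A -> L.-negligible A.
  move=> cA; exists A; split=> //; first exact: countable_measurable.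
  apply: (null_content_dominatesP _ _).1 (dominates_uniform_prob (@ltr01 R)) _ _ _.
  - exact: countable_measurable.
  - exact: countable_lebesgue_measure0.
have LD : L.-negligible D.
  apply: negligibleU; first apply: cN.
    by apply: discontinuity_countable => x y _ _; exact: ndX.
  by apply: negligibleU; apply: cN; exact: countable1.
have LI : L.-negligible (~` `[0, 1]%classic).
  exists (~` `[0, 1]%classic); split=> //; first exact: measurableC.
  rewrite uniform01E; last exact: measurableC.
  by rewrite setICl measure0.
rewrite /almost_everywhere; apply: negligibleS (negligibleU LD LI) => w /= nw.
apply: contrapT => /not_orP[nD /contrapT w01]; apply: nw.
have {}w01 : 0 < w < 1.
  move: w01; rewrite /= in_itv/= => /andP[w0 w1]; rewrite !lt_neqAle w0 w1 !andbT.
  by apply/andP; split; apply/eqP => E; apply: nD; right; [left|right].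
have ndisc : ~ discontinuity X w.
  by move=> dw; apply: nD; left; split=> //; rewrite in_itv.
apply/cvgrPdist_le => eps eps0.
have [q1 [q2 [q1w Xq1 q2w Xq2]]] := nondecreasing_bracket ndX ndisc eps0.
have /cvgrPdist_le/(_ (eps / 2)) h1 := Xq q1; have {}h1 := h1 ltac:(lra).
have /cvgrPdist_le/(_ (eps / 2)) h2 := Xq q2; have {}h2 := h2 ltac:(lra).
near=> n.
have : `|X (ratr q1) - X_ n (ratr q1)| <= eps / 2 by near: n.
have : `|X (ratr q2) - X_ n (ratr q2)| <= eps / 2 by near: n.
have := ndX_ n _ _ (ltW q1w); have := ndX_ n _ _ (ltW q2w).
by rewrite !ler_norml; lra.
Unshelve. all: end_near. Qed.

End monotone_limits.

(** * Quantile functions of probability measures on [0, 1] *)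

Section quantile.
Context {R : realType} (P : probability (measurableTypeR R) R).
Hypothesis P01 : P `[0, 1]%classic = 1%E.

Let F (a : R) : R := fine (P `]-oo, a]%classic).

(** For 0 < w <= 1 this is the usual generalised inverse of the distribution function F. Adjoining 0
    and restricting to [0, 1] make it bounded and nondecreasing on the whole line. *)
Definition quantile (w : R) : R := sup ([set 0] `|` [set a | 0 <= a <= 1 /\ F a < w]).

Let S w := [set 0] `|` [set a | 0 <= a <= 1 /\ F a < w].

Let hasS w : has_sup (S w).
Proof.
split; first by exists 0; left.
by exists 1 => a [->|[/andP[_ ->]]].
Qed.

Lemma quantile_itv w : 0 <= quantile w <= 1.
Proof.
apply/andP; split; first by apply: ub_le_sup; [exact: (hasS w).2|left].
by apply: ge_sup; [exact: (hasS w).1|move=> a [->|[/andP[_ ->]]]].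
Qed.

Lemma quantile_nondecreasing : nondecreasing_fun quantile.
Proof.
move=> w1 w2 w12; apply: ge_sup; first exact: (hasS w1).1.
move=> a [->|[a01 Fa]]; first by case/andP: (quantile_itv w2).
apply: ub_le_sup; first exact: (hasS w2).2.
by right; split=> //; exact: lt_le_trans w12.
Qed.

Let F_nd : nondecreasing_fun F.
Proof.
move=> a b ab; apply: fine_le; rewrite ?fin_num_measure//.
apply: le_measure; rewrite ?inE//; apply: subset_itvl.
by rewrite bnd_simp.
Qed.

Let F_rc a w : (forall b, a < b -> w <= F b) -> w <= F a.
Proof.
move=> H.
pose idTR : measurableTypeR R -> R := idfun.
have mid : isMeasurableFun _ _ _ _ idTR.
  by apply: (@isMeasurableFun.Build _ _ _ _ idTR (@measurable_id _ _ setT)).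
pose X : {RV P >-> R} := HB.pack idTR mid.
have FE b : cdf X b = P `]-oo, b]%classic by [].
have Fcvg : F b @[b --> a^'+] --> F a.
  by apply: fine_cvg; rewrite fineK ?fin_num_measure//; exact: (@cdf_right_continuous _ _ _ P X a).
rewrite -(cvg_lim _ Fcvg)//; apply: limr_ge; first by apply/cvg_ex; exists (F a).
by near=> b; apply: H; near: b; exact: nbhs_right_gt.
Unshelve. all: end_near. Qed.

Let F_ge0 a : 0 <= F a.
Proof. by rewrite fine_ge0. Qed.

Let F_le1 a : F a <= 1.
Proof. by rewrite -[leRHS]/(fine 1%E) fine_le ?fin_num_measure// probability_le1. Qed.

Let F_1 a : 1 <= a -> F a = 1.
Proof.
move=> a1; apply/eqP; rewrite eq_le F_le1 /=.
rewrite -[leLHS]/(fine 1%E) -P01; apply: fine_le; rewrite ?fin_num_measure//.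
apply: le_measure; rewrite ?inE// => x /=; rewrite !in_itv/= => /andP[_ x1].
exact: le_trans a1.
Qed.

Let F_0 a : a < 0 -> F a = 0.
Proof.
move=> a0; rewrite /F (_ : P _ = 0%E)//; apply/eqP; rewrite -measure_le0.
have -> : 0%E = P (~` (`[0, 1]%classic : set R)).
  by rewrite probability_setC// P01 subee.
apply: le_measure; rewrite ?inE//; first exact: measurableC.
by move=> x /=; rewrite !in_itv/=; move=> xa /andP[]; lra.
Qed.

(** Galois connection between the quantile and the distribution function. The implication from left
    to right is where right-continuity of F enters. *)
Lemma quantile_le w a : 0 < w <= 1 -> (quantile w <= a) = (w <= F a).
Proof.
move=> /andP[w0 w1]; have [a1|a1] := leP 1 a.
  rewrite F_1// w1; have /andP[_ q1] := quantile_itv w.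
  exact: le_trans a1.
have [a0|a0] := ltP a 0.
  have /andP[q0 _] := quantile_itv w.
  rewrite F_0// [RHS]leNgt w0; apply/negbTE; rewrite -ltNge.
  exact: lt_le_trans q0.
apply/idP/idP => [qa|wF].
  apply: F_rc => b ab; rewrite leNgt; apply/negP => Fb.
  have [b1|b1] := leP b 1; last by move: Fb; rewrite F_1 ?ltW//; lra.
  have : b <= quantile w.
    apply: ub_le_sup; first exact: (hasS w).2.
    by right; split=> //; rewrite b1 andbT; lra.
  by lra.
apply: ge_sup; first exact: (hasS w).1.
move=> b [->//|[_ Fb]]; rewrite leNgt; apply/negP => ab.
by have := F_nd (ltW ab); lra.
Qed.

Lemma measurable_quantile : measurable_fun setT (quantile : measurableTypeR R -> measurableTypeR R).
Proof. by apply: nondecreasing_measurable => //; exact: quantile_nondecreasing. Qed.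

(** Open half-lines form a generating pi-system, and by [quantile_le] the preimage of ]a,
    +oo[ in ]0, 1] is ]F a, 1], of length 1 - F a. *)
Lemma quantile_law (A : set (measurableTypeR R)) : measurable A ->
  uniform_prob (@ltr01 R) (quantile @^-1` A) = P A.
Proof.
pose mq := isMeasurableFun.Build _ _ _ _ (quantile : measurableTypeR R -> measurableTypeR R) measurable_quantile.
pose X : {mfun measurableTypeR R >-> measurableTypeR R} := HB.pack (quantile : measurableTypeR R -> measurableTypeR R) mq.
move=> mA.
have PE a : P `]a, +oo[%classic = (1 - F a)%:E.
  rewrite -setCitvl probability_setC ?EFinB ?fineK ?fin_num_measure//; exact: measurable_itv.
change (distribution (uniform_prob (@ltr01 R)) X A = P A).
have HH := @measure_unique _ R (measurableTypeR R) (@RGenOInfty.G R) (fun n => `]-n%:R, +oo[%classic).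
refine (HH _ _ _ _ (distribution (uniform_prob (@ltr01 R)) X) P _ _ A mA).
- exact: RGenOInfty.measurableE.
- move=> _ _ [a ->] [b ->]; exists (Num.max a b).
  by apply/seteqP; split=> x /=; rewrite !in_itv/= !andbT gt_max => /andP.
- by move=> n; exists (- n%:R).
- apply/seteqP; split=> // x _; exists (Num.truncn (- x)).+1 => //=.
  by rewrite in_itv/= andbT ltrNl truncnS_gt.
- move=> _ [a ->]; transitivity (1 - F a)%:E; last exact/esym/PE.
  rewrite /distribution/= /pushforward uniform01_ocE; last first.
    by rewrite -[X in measurable X]setTI; exact: measurable_quantile.
  have -> : (quantile @^-1` `]a, +oo[) `&` `]0, 1] = `]F a, 1]%classic.
    apply/seteqP; split=> w /=; rewrite !in_itv/= andbT.
      by move=> [aw w01]; rewrite ltNge -(quantile_le a w01) -ltNge aw; case/andP: w01.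
    move=> /andP[Fw w1]; have w01 : 0 < w <= 1 by rewrite w1 andbT (le_lt_trans (F_ge0 a)).
    by split=> //; rewrite ltNge quantile_le// -ltNge.
  rewrite lebesgue_measure_itv/= lte_fin; case: ifPn => // F1.
  by congr EFin; have := F_le1 a; lra.
- by move=> n; rewrite (le_lt_trans (probability_le1 _ _)) ?ltry.
Qed.

End quantile.

(** * Differential calculus on the torus *)

Section torus_topology.
Context {R : realType} {d : nat}.
Local Notation T := (torus R d).
Implicit Types g : T -> R.

Lemma to_torus_continuous : continuous (@to_torus R d).
Proof. exact: pi_continuous. Qed.

Lemma to_torus_repr (x : T) : to_torus (repr x) = x.
Proof. by rewrite /to_torus reprK. Qed.

Lemma continuous_lift (Z : topologicalType) (g : T -> Z) :
  continuous g <-> continuous (fun x => g (to_torus x)).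
Proof. exact: quotient_continuous. Qed.

Lemma torus_surj (x : T) :
  exists2 y : 'rV[R]_d, (forall i, 0 <= y 0 i < 1) & to_torus y = x.
Proof.
exists (\row_i (repr x 0 i - (Num.floor (repr x 0 i))%:~R)).
  move=> i; rewrite mxE; have := floor_itv (repr x 0 i).
  by rewrite intrD; lra.
rewrite -[RHS]to_torus_repr; apply/to_torusP/forallP => i; rewrite mxE.
by rewrite addrAC subrr add0r rpredN; exact: intr_int.
Qed.

Lemma torus_compact : compact [set: T].
Proof.
have cc : compact [set y : 'rV[R]_d | forall i, `[0, 1]%classic (y 0 i)].
  by apply: (@rV_compact R d (fun=> `[0, 1]%classic)) => i; exact: segment_compact.
rewrite (_ : setT = @to_torus R d @` [set y : 'rV[R]_d | forall i, `[0, 1]%classic (y 0 i)]).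
  apply: continuous_compact => //.
  by apply: continuous_subspaceT; exact: to_torus_continuous.
apply/seteqP; split=> // x _; have [y y01 <-] := torus_surj x.
by exists y => //= i; rewrite in_itv/=; have := y01 i; lra.
Qed.

Lemma open_measurable_torus (A : set T) : open A -> measurable A.
Proof. by move=> oA; exact: sub_sigma_algebra. Qed.

Lemma closed_measurable_torus (A : set T) : closed A -> measurable A.
Proof.
by move=> cA; rewrite -[A]setCK; apply: measurableC; apply: open_measurable_torus;
  exact: closed_openC.
Qed.

Lemma continuous_measurable_torus g : continuous g -> measurable_fun setT g.
Proof.
move=> /continuousP cg; apply: (measurability _ (RGenOpens.measurableE R)).
move=> _ [_ [a [b ->] <-]]; rewrite setTI; apply: open_measurable_torus.
by apply: cg; exact: interval_open.
Qed.

Lemma continuous_bounded_torus g : continuous g ->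
  exists2 B, 0 <= B & forall x, `|g x| <= B.
Proof.
move=> cg; have : compact (g @` setT).
  by apply: continuous_compact torus_compact; exact: continuous_subspaceT.
move=> /compact_bounded [M [_ /(_ (Num.max 0 (M + 1)))]] H.
exists (Num.max 0 (M + 1)); first by rewrite le_max lexx.
move=> x; apply: H; last by exists x.
by rewrite lt_max ltrDl ltr01 orbT.
Qed.

End torus_topology.

Section class_C_theory.
Context {R : realType} {n : nat}.
Implicit Types (F G : 'rV[R]_n -> R) (k : nat).

Lemma class_C_continuous k F : class_C k F -> continuous F.
Proof. by case: k => [|k] []. Qed.

Lemma class_CW k F : class_C k.+1 F -> class_C k F.
Proof.
elim: k F => [|k IH] F [cF /= DF]; split => // i.
by have [dF CF] := DF i; split=> //; exact: IH.
Qed.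

Lemma class_C_cst k c : class_C k (fun _ : 'rV[R]_n => c).
Proof.
elim: k c => [|k IH] c; (split; first exact: cst_continuous) => // i.
split=> [x|]; first exact: derivable_cst.
rewrite [X in class_C k X](_ : _ = fun=> 0); first exact: IH.
by apply/funext => x; rewrite derive_cst.
Qed.

Lemma class_C_D k F G : class_C k F -> class_C k G -> class_C k (fun x => F x + G x).
Proof.
elim: k F G => [|k IH] F G [cF DF] [cG DG].
  by split => // x; apply: continuousD; [exact: cF|exact: cG].
split=> [|i]; first by move=> x; apply: continuousD; [exact: cF|exact: cG].
have [dF CF] := DF i; have [dG CG] := DG i; split=> [x|].
  exact: derivableD.
rewrite [X in class_C k X](_ : _ =
  fun x => 'D_(delta_mx 0 i) F x + 'D_(delta_mx 0 i) G x); first exact: IH.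
by apply/funext => x; rewrite -deriveD.
Qed.

Lemma class_C_M k F G : class_C k F -> class_C k G -> class_C k (fun x => F x * G x).
Proof.
elim: k F G => [|k IH] F G CkF CkG; have cF := class_C_continuous CkF;
  have cG := class_C_continuous CkG.
  by split => // x; apply: continuousM; [exact: cF|exact: cG].
split=> [|i]; first by move=> x; apply: continuousM; [exact: cF|exact: cG].
have [dF CF] := CkF.2 i; have [dG CG] := CkG.2 i; split=> [x|].
  exact: derivableM.
rewrite [X in class_C k X](_ : _ =
  fun x => F x * 'D_(delta_mx 0 i) G x + G x * 'D_(delta_mx 0 i) F x).
  by apply: class_C_D; apply: IH => //; exact: class_CW.
by apply/funext => x; rewrite deriveM.
Qed.

Lemma class_C_Z k c F : class_C k F -> class_C k (fun x => c * F x).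
Proof. by move=> CF; apply: class_C_M => //; exact: class_C_cst. Qed.

Lemma class_C_B k F G : class_C k F -> class_C k G -> class_C k (fun x => F x - G x).
Proof.
move=> CF CG; rewrite (_ : (fun x => _) = fun x => F x + -1 * G x).
  by apply: class_C_D => //; exact: class_C_Z.
by apply/funext => x; rewrite mulN1r.
Qed.

Lemma class_C_sum k (J : Type) (s : seq J) (F : J -> 'rV[R]_n -> R) :
  (forall j, class_C k (F j)) -> class_C k (fun x => \sum_(j <- s) F j x).
Proof.
move=> CF; elim: s => [|j s IH].
  under eq_fun do rewrite big_nil; exact: class_C_cst.
by under eq_fun do rewrite big_cons; exact: class_C_D.
Qed.

Lemma class_C_prod k (J : Type) (s : seq J) (F : J -> 'rV[R]_n -> R) :
  (forall j, class_C k (F j)) -> class_C k (fun x => \prod_(j <- s) F j x).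
Proof.
move=> CF; elim: s => [|j s IH].
  under eq_fun do rewrite big_nil; exact: class_C_cst.
by under eq_fun do rewrite big_cons; exact: class_C_M.
Qed.

Lemma is_derive_cvgP {V : normedModType R} (F : V -> R) (x v : V) (l : R) :
  is_derive x v F l <->
  h^-1 * (F (h *: v + x) - F x) @[h --> (0 : R)^'] --> l.
Proof.
split=> [[d <-] //|H]; apply: DeriveDef; first by apply/cvg_ex; exists l.
exact: cvg_lim H.
Qed.

(** Reduction to one variable, so that the chain rule and the mean value theorem on the line apply
    to directional derivatives. *)
Lemma is_derive_line {V : normedModType R} (F : V -> R) (x v : V) (l : R) :
  is_derive x v F l <-> is_derive (0 : R) 1 (fun s : R => F (s *: v + x)) l.
Proof.
rewrite !is_derive_cvgP; set f := (X in X @ _); set g := (X in _ <-> X @ _ --> _).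
suff -> : f = g by [].
by apply/funext => h; rewrite /f /g addr0 scale0r add0r /GRing.scale /= mulr1.
Qed.

Lemma is_derive_comp {V : normedModType R} (F : V -> R) (phi : R -> R) (x v : V)
    (l m : R) :
  is_derive x v F l -> is_derive (F x) 1 phi m ->
  is_derive x v (fun y => phi (F y)) (m * l).
Proof.
move=> /is_derive_line dF dphi; apply/is_derive_line.
have F0 : F (0 *: v + x) = F x by rewrite scale0r add0r.
have [df dfE] := dF; have [dp dpE] := dphi; rewrite -F0 in dp.
apply: DeriveDef.
  apply/derivable1_diffP; apply: differentiable_comp; exact/derivable1_diffP.
have := derive1_comp df dp; rewrite !derive1E F0.
by rewrite dfE dpE.
Qed.

(** The successive derivatives of the outer function are given as a family [phi], so that the
    induction shifts it by one and functions of finite smoothness, such as the cube of the positive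
    part, are covered. *)
Lemma class_C_comp k (phi : nat -> R -> R) F :
  (forall j s, (j < k)%N -> is_derive s (1 : R) (phi j) (phi j.+1 s)) ->
  (forall j, (j <= k)%N -> continuous (phi j)) ->
  class_C k F -> class_C k (fun x => phi 0%N (F x)).
Proof.
elim: k phi F => [|k IH] phi F dphi cphi CF; have cF := class_C_continuous CF.
  split=> // x; apply: continuous_comp; [exact: cF|exact: cphi].
split=> [x|i]; first by apply: continuous_comp; [exact: cF|exact: cphi].
have [dF CDF] := CF.2 i.
have D x : is_derive x (delta_mx 0 i : 'rV[R]_n) (fun y => phi 0%N (F y))
    (phi 1%N (F x) * 'D_(delta_mx 0 i) F x).
  by apply: (is_derive_comp (DeriveDef (dF x) erefl)); exact: dphi.
split=> [x|]; first by have [] := D x.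
rewrite [X in class_C k X](_ : _ =
  fun x => phi 1%N (F x) * 'D_(delta_mx 0 i) F x); last first.
  by apply/funext => x; have [] := D x.
apply: class_C_M => //; apply: (IH (fun j => phi j.+1)) => // [j s jk|j jk|].
- exact: dphi.
- exact: cphi.
- exact: class_CW.
Qed.

Lemma class_C_coord k i : class_C k (fun x : 'rV[R]_n => x 0 i).
Proof.
have D v (x : 'rV[R]_n) : is_derive x v (fun x : 'rV[R]_n => x 0 i) (v 0 i).
  apply/is_derive_cvgP; apply: cvg_near_cst.
  apply: filterS (nbhs_dnbhs_neq (0 : R)) => h h0.
  by rewrite !mxE addrK mulKf.
case: k => [|k]; (split; first exact: coord_continuous) => // j; split=> [x|].
  by have [] := D (delta_mx 0 j) x.
rewrite [X in class_C k X](_ : _ = fun=> (delta_mx 0 j : 'rV[R]_n) 0 i).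
  exact: class_C_cst.
by apply/funext => x; have [] := D (delta_mx 0 j) x.
Qed.

End class_C_theory.

Section cutoff.
Context {R : realType}.

Definition pos (s : R) : R := Num.max 0 s.

Lemma is_derive_pos2 (s : R) : is_derive s 1 (fun s => pos s ^+ 2) (2 * pos s).
Proof.
apply/is_derive_cvgP; apply/cvgrPdist_le => e e0.
near=> h; have h0 : h != 0 by near: h; exact: nbhs_dnbhs_neq.
have he : `|h| <= e.
  near: h; apply: nbhs_dnbhs; apply/nbhs_ballP; exists e => // h; rewrite /ball /=.
  by rewrite sub0r normrN => /ltW.
apply: le_trans he; rewrite /GRing.scale/= mulr1.
have -> : 2 * pos s - h^-1 * (pos (h + s) ^+ 2 - pos s ^+ 2)
   = h^-1 * (2 * pos s * h - (pos (h + s) ^+ 2 - pos s ^+ 2)).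
  by field.
rewrite normrM normfV ler_pdivrMl ?normr_gt0// -normrM -expr2 [`|h ^+ 2|]ger0_norm ?sqr_ge0//.
(* It remains to see that [2 * pos s * h] differs from the increment of the square by at most h^2,
   by cases on the signs. *)
rewrite /pos /Num.max; case: ifPn => ?; case: ifPn => ?; rewrite ler_norml; apply/andP; split; nra.
Unshelve. all: end_near. Qed.

Lemma continuous_pos : continuous pos.
Proof.
move=> s; apply: (@continuous_max R R (cst 0) id); first exact: cst_continuous.
by [].
Qed.

Lemma continuous_pos2 : continuous (fun s => pos s ^+ 2).
Proof. by move=> s; exact: (continuousM (@continuous_pos s) (@continuous_pos s)). Qed.

Lemma is_derive_pos3 (s : R) : is_derive s 1 (fun s => pos s ^+ 3) (3 * pos s ^+ 2).
Proof.
(* Where s and [pos s] differ, [pos s] is 0; the product rule then reduces the cube to the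
   square. *)
have -> : (fun s => pos s ^+ 3) = (fun s : R => s * pos s ^+ 2).
  apply/funext => t; rewrite exprS /pos /Num.max; case: ifPn => // _.
  by rewrite expr0n /= !mulr0.
have H := is_deriveM (is_derive_id s (1 : R)) (is_derive_pos2 s).
apply: is_derive_eq H _; rewrite /GRing.scale /=.
by rewrite /pos /Num.max; case: ifPn => ?; rewrite ?expr0n/=; ring.
Qed.

(** The exponent 3 is the least natural one for which the power of the positive part is C^2. *)
Lemma class_C_pos3 n (F : 'rV[R]_n -> R) : class_C 2 F -> class_C 2 (fun x => pos (F x) ^+ 3).
Proof.
pose phi (j : nat) : R -> R := match j with 0 => fun s => pos s ^+ 3
  | 1 => fun s => 3 * pos s ^+ 2 | 2 => fun s => 6 * pos s | _ => fun=> 0 end.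
move=> CF; apply: (class_C_comp (phi := phi)) => // [[|[|j]] s _ //=|[|[|[|j]]] _ //=].
- exact: is_derive_pos3.
- rewrite (_ : 6 * pos s = 3 * (2 * pos s)); last by ring.
  exact: (is_deriveZ 3 (is_derive_pos2 s)).
- move=> s; apply: (continuousM (@continuous_pos s)); exact: continuous_pos2.
- by move=> s; apply: cvgMr; exact: continuous_pos2.
- by move=> s; apply: cvgMr; exact: continuous_pos.
Qed.

Lemma class_C_sin n (F : 'rV[R]_n -> R) : class_C 2 F -> class_C 2 (fun x => sin (F x)).
Proof.
pose phi (j : nat) : R -> R := match j with 0 => @sin R
  | 1 => @cos R | 2 => fun s => - sin s | _ => fun=> 0 end.
move=> CF; apply: (class_C_comp (phi := phi)) => // [[|[|j]] s _ //=|[|[|[|j]]] _ //=].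
- exact: is_derive_sin.
- exact: is_derive_cos.
- exact: continuous_sin.
- exact: continuous_cos.
- by move=> s; apply: continuousN; exact: continuous_sin.
Qed.

End cutoff.

Section partial_derivatives.
Context {R : realType} {d : nat}.
Local Notation T := (torus R d).
Implicit Types g : T -> R.

Lemma to_torusD (x y z : 'rV[R]_d) : to_torus x = to_torus y ->
  to_torus (z + x) = to_torus (z + y).
Proof.
move=> /to_torusP/forallP xy; apply/to_torusP/forallP => i; have := xy i.
by rewrite !mxE opprD addrACA subrr add0r.
Qed.

Lemma derive_lift g (v x y : 'rV[R]_d) : to_torus x = to_torus y ->
  'D_v (torus_lift g) x = 'D_v (torus_lift g) y.
Proof.
move=> xy; rewrite /derive; apply: (congr1 (fun f : R -> R => lim (f @ 0^'))).
apply/funext => h /=.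
by rewrite /torus_lift (to_torusD _ xy) xy.
Qed.

(** By periodicity the derivative of a lift is again a lift, which lets [partial] be iterated. *)
Lemma lift_partial i g :
  torus_lift (partial i g) = (fun x => 'D_(delta_mx 0 i) (torus_lift g) x).
Proof.
by apply/funext => x; apply: derive_lift; rewrite to_torus_repr.
Qed.

Lemma torus_C_continuous k g : torus_C k g -> continuous g.
Proof. by move=> /class_C_continuous cg; exact/continuous_lift. Qed.

Lemma torus_CW k g : torus_C k.+1 g -> torus_C k g.
Proof. exact: class_CW. Qed.

Lemma torus_C_partial k i g : torus_C k.+1 g -> torus_C k (partial i g).
Proof. by move=> [_ /(_ i)[_ H]]; rewrite /torus_C lift_partial. Qed.

Lemma torus_C_derivable k i g x : torus_C k.+1 g ->
  derivable (torus_lift g) x (delta_mx 0 i).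
Proof. by move=> [_ /(_ i)[H _]]. Qed.

Lemma partialZ k i c g x : torus_C k.+1 g ->
  partial i (fun y => c * g y) x = c * partial i g x.
Proof. by move=> C1; apply: deriveZ; exact: torus_C_derivable C1. Qed.

Lemma partialB k i g1 g2 x : torus_C k.+1 g1 -> torus_C k.+1 g2 ->
  partial i (fun y => g1 y - g2 y) x = partial i g1 x - partial i g2 x.
Proof. by move=> C1 C2; apply: deriveB; [exact: torus_C_derivable C1|exact: torus_C_derivable C2]. Qed.

Lemma laplacianB g1 g2 x : torus_C 2 g1 -> torus_C 2 g2 ->
  laplacian (fun y => g1 y - g2 y) x = laplacian g1 x - laplacian g2 x.
Proof.
move=> C1 C2; rewrite /laplacian -sumrB; apply: eq_bigr => i _.
rewrite -(partialB _ _ (torus_C_partial i C1) (torus_C_partial i C2)).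
by congr partial; apply/funext => y; exact: partialB C1 C2.
Qed.

Lemma laplacianZ c g x : torus_C 2 g ->
  laplacian (fun y => c * g y) x = c * laplacian g x.
Proof.
move=> C1; rewrite /laplacian mulr_sumr; apply: eq_bigr => i _.
rewrite -(partialZ _ _ _ (torus_C_partial i C1)).
by congr partial; apply/funext => y; exact: partialZ C1.
Qed.

Lemma gradB k g1 g2 x : torus_C k.+1 g1 -> torus_C k.+1 g2 ->
  grad (fun y => g1 y - g2 y) x = grad g1 x - grad g2 x.
Proof. by move=> C1 C2; apply/rowP => i; rewrite !mxE; exact: partialB C1 C2. Qed.

Lemma gradZ k c g x : torus_C k.+1 g -> grad (fun y => c * g y) x = c *: grad g x.
Proof. by move=> C1; apply/rowP => i; rewrite !mxE; exact: partialZ C1. Qed.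

Lemma continuous_sumr (Z : topologicalType) (J : Type) (s : seq J) (f : J -> Z -> R) :
  (forall j, continuous (f j)) -> continuous (fun x => \sum_(j <- s) f j x).
Proof. by move=> cf x; apply: cvg_sumr => j; exact: cf. Qed.

Lemma continuous_laplacian g : torus_C 2 g -> continuous (laplacian g).
Proof.
move=> Cg; apply: continuous_sumr => i.
exact: torus_C_continuous (torus_C_partial i (torus_C_partial i Cg)).
Qed.

Lemma continuous_grad k g : torus_C k.+1 g -> continuous (grad g).
Proof.
move=> Cg; apply: continuous_row => i.
exact: torus_C_continuous (torus_C_partial i Cg).
Qed.

Lemma continuous_dot (Z : topologicalType) (p q : Z -> 'rV[R]_d) :
  continuous p -> continuous q -> continuous (fun x => dot (p x) (q x)).
Proof.
move=> cp cq; apply: continuous_sumr => i x; apply: continuousM.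
  by apply: (@continuous_comp _ _ _ p (fun M : 'rV[R]_d => M 0 i));
    [exact: cp|exact: coord_continuous].
by apply: (@continuous_comp _ _ _ q (fun M : 'rV[R]_d => M 0 i));
    [exact: cq|exact: coord_continuous].
Qed.

End partial_derivatives.

(** * Chordal distance and bump functions on the torus *)

Section separation.
Context {R : realType} {d : nat}.
Local Notation T := (torus R d).

(* A quarter of the squared Euclidean distance between the images of x and q
   under the embedding of the torus in R^(2 d). *)
Definition chordal (q x : 'rV[R]_d) : R := \sum_(i < d) sin (pi * (x 0 i - q 0 i)) ^+ 2.

Lemma chordal_ge0 q x : 0 <= chordal q x.
Proof. by apply: sumr_ge0 => i _; exact: sqr_ge0. Qed.

Lemma sin_piDint (s z : R) : z \is a Num.int -> sin (pi * (s + z)) ^+ 2 = sin (pi * s) ^+ 2.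
Proof.
have H (n : nat) (t : R) : sin (pi * (t + n%:R)) ^+ 2 = sin (pi * t) ^+ 2.
  rewrite mulrDr mulr_natr (alternatingn (@sinDpi R)).
  by rewrite exprMn -exprM mulnC exprM sqrrN !expr1n mul1r.
move=> /intrP[[n|n] ->]; first exact: H.
by rewrite -[in RHS](subrK n.+1%:R s) NegzE mulrNz H.
Qed.

Lemma sin_pi_eq0 (s : R) : sin (pi * s) = 0 -> s \is a Num.int.
Proof.
move=> s0; pose f := s - (Num.floor s)%:~R.
have f01 : 0 <= f < 1.
  by have := floor_itv s; rewrite intrD /f; lra.
have sf : sin (pi * f) ^+ 2 = 0 by rewrite sin_piDint ?rpredN ?intr_int// s0 expr0n.
suff f0 : f = 0 by rewrite -(subrK (Num.floor s)%:~R s) -/f f0 add0r intr_int.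
apply/eqP/negPn/negP => fn0; have : 0 < sin (pi * f).
  have p0 := @pi_gt0 R.
  have fp : 0 < f by rewrite lt_neqAle eq_sym fn0; case/andP: f01.
  by apply: sin_gt0_pi; rewrite mulr_gt0//= gtr_pMr//; case/andP: f01.
by move/eqP: sf; rewrite sqrf_eq0 => /eqP ->; rewrite ltxx.
Qed.

Lemma chordal_torus q x y : to_torus x = to_torus y -> chordal q x = chordal q y.
Proof.
move=> /to_torusP/forallP xy; apply: eq_bigr => i _.
by rewrite -(sin_piDint (y 0 i - q 0 i) (xy i)); congr (sin (pi * _) ^+ 2); ring.
Qed.

Lemma chordal_eq0 q x : chordal q x = 0 -> to_torus x = to_torus q.
Proof.
move=> /eqP; rewrite psumr_eq0; last by move=> i _; exact: sqr_ge0.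
move=> /allP H; apply/to_torusP/forallP => i; apply: sin_pi_eq0; apply/eqP.
by rewrite -sqrf_eq0; apply: H; rewrite mem_index_enum.
Qed.

Lemma chordalC x y : chordal x y = chordal y x.
Proof. by apply: eq_bigr => i _; rewrite -opprB mulrN sinN sqrrN. Qed.

(** [chordal] behaves as a squared distance, hence the factor 2, as in (a + b)^2 <= 2 (a^2 + b^2);
    here it comes from the addition formula of the sine. *)
Lemma chordal_triangle x y z : chordal x z <= 2 * (chordal x y + chordal y z).
Proof.
rewrite /chordal -big_split mulr_sumr; apply: ler_sum => i _ /=.
have -> : pi * (z 0 i - x 0 i) = pi * (z 0 i - y 0 i) + pi * (y 0 i - x 0 i) by ring.
set a := pi * (z 0 i - y 0 i); set b := pi * (y 0 i - x 0 i); rewrite sinD.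
have := cos2Dsin2 a; have := cos2Dsin2 b.
set ca := cos a; set sa := sin a; set cb := cos b; set sb := sin b => hb ha.
have h1 : sa ^+ 2 * cb ^+ 2 <= sa ^+ 2.
  by rewrite ler_piMr ?sqr_ge0//; have := sqr_ge0 sb; lra.
have h2 : sb ^+ 2 * ca ^+ 2 <= sb ^+ 2.
  by rewrite ler_piMr ?sqr_ge0//; have := sqr_ge0 sa; lra.
by have := sqr_ge0 (sa * cb - ca * sb); nra.
Qed.

Lemma class_C_chordal q : class_C 2 (chordal q).
Proof.
apply: class_C_sum => i; apply: class_C_M; apply: class_C_sin;
  apply: class_C_Z; apply: class_C_B; [exact: class_C_coord|exact: class_C_cst
  |exact: class_C_coord|exact: class_C_cst].
Qed.

(** An inverted bump: for r > 0 it is 1 where [chordal] is at least 1 / r and below 1 nearer to q.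
    Being 1 off a small set, it can enter a product without changing the other factors there. *)
Definition bump (q : 'rV[R]_d) (r : R) (x : T) : R :=
  1 - pos (1 - r * chordal q (repr x)) ^+ 3.

Lemma bump_lift q r : torus_lift (bump q r) = fun x => 1 - pos (1 - r * chordal q x) ^+ 3.
Proof.
apply/funext => x; rewrite /torus_lift /bump; congr (1 - pos (1 - r * _) ^+ 3).
by apply: chordal_torus; rewrite to_torus_repr.
Qed.

Lemma torus_C_bump q r : torus_C 2 (bump q r).
Proof.
rewrite /torus_C bump_lift; apply: class_C_B; first exact: class_C_cst.
apply: class_C_pos3; apply: class_C_B; first exact: class_C_cst.
by apply: class_C_Z; exact: class_C_chordal.
Qed.

Lemma bump_itv q r x : 0 <= r -> 0 <= bump q r x <= 1.
Proof.
move=> r0; rewrite /bump; set c := 1 - r * _.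
have c1 : c <= 1 by have := chordal_ge0 q (repr x); rewrite /c; nra.
have p0 : 0 <= pos c by rewrite /pos le_max lexx.
have p1 : pos c <= 1 by rewrite /pos ge_max ler01.
have := exprn_ge0 3 p0; have := exprn_ile1 3 p0 p1; lra.
Qed.

Lemma torus_hausdorff : hausdorff_space T.
Proof.
move=> x y clxy; apply: contrapT => xy.
pose g (z : T) := chordal (repr x) (repr z).
have gE : (fun z => g (to_torus z)) = chordal (repr x).
  by apply/funext => z; apply: chordal_torus; rewrite to_torus_repr.
have cg : continuous g.
  by apply/continuous_lift; rewrite gE; exact: class_C_continuous (class_C_chordal _).
have gx : g x = 0 by rewrite /g /chordal big1// => i _; rewrite subrr mulr0 sin0 expr0n.
have gy : 0 < g y.
  rewrite lt_neqAle chordal_ge0 andbT eq_sym; apply/eqP => /chordal_eq0.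
  by rewrite !to_torus_repr => /esym.
have := clxy (g @^-1` [set r | r < g y / 2]) (g @^-1` [set r | g y / 2 < r]).
case.
- by apply: (cvgr_lt _ (cg x)); lra.
- by apply: (cvgr_gt _ (cg y)); lra.
- by move=> z [/=]; lra.
Qed.

Lemma compact_measurable_torus (A : set T) : compact A -> measurable A.
Proof. by move=> cA; apply: closed_measurable_torus; apply: compact_closed => //; exact: torus_hausdorff. Qed.

End separation.

(** * Functions separating measures *)

Section separating_family.
Context {R : realType} {d : nat}.
Local Notation T := (torus R d).
Local Notation P := (probability T R).

Lemma continuous_chordal_repr (x : T) : continuous (fun z : T => chordal (repr x) (repr z)).
Proof.
apply/continuous_lift.
rewrite (_ : (fun z => _) = chordal (repr x)).
  exact: class_C_continuous (class_C_chordal _).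
by apply/funext => z; apply: chordal_torus; rewrite to_torus_repr.
Qed.

(** The image of the complement of O under the chordal distance to x is compact and misses 0. *)
Lemma chordal_nbhs (O : set T) (x : T) : open O -> O x ->
  exists2 e, 0 < e & forall y : T, chordal (repr x) (repr y) < e -> O y.
Proof.
move=> oO Ox; pose g (z : T) := chordal (repr x) (repr z).
have cO : compact (g @` ~` O).
  apply: continuous_compact.
    by apply: continuous_subspaceT; exact: continuous_chordal_repr.
  by apply: (subclosed_compact _ torus_compact) => //; exact: open_closedC.
have clO := compact_closed (@Rhausdorff R) cO.
have nO : ~ (g @` ~` O) 0.
  move=> [y nOy /chordal_eq0]; rewrite !to_torus_repr => yx.
  by apply: nOy; rewrite yx.
have /nbhs_ballP[e /= e0 He] : nbhs (0 : R) (~` (g @` ~` O)).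
  by apply: open_nbhs_nbhs; split; [exact: closed_openC|exact: nO].
exists e => // y ye; apply: contrapT => nOy; apply: (He (g y)); last by exists y.
by rewrite /ball/= sub0r normrN ger0_norm// chordal_ge0.
Qed.

Lemma bump_base (O : set T) (x : T) : open O -> O x ->
  exists q (r : nat), bump (rat_vec R q) r%:R x < 1 /\
    forall y, ~ O y -> bump (rat_vec R q) r%:R y = 1.
Proof.
move=> oO Ox; have [e e0 He] := chordal_nbhs oO Ox.
(* If x and y are both within 1 / r of q, [chordal_triangle] puts them within 2 (1 / r + 1 / r) = 4
   / r < e of each other. *)
pose r := (Num.truncn (4 / e)).+1.
have rP : 4 / e < r%:R by exact: truncnS_gt.
have r0 : 0 < r%:R :> R by [].
have [q qr] : exists q, chordal (repr x) (rat_vec R q) < r%:R^-1.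
  have c0 : chordal (repr x) (repr x) = 0.
    by rewrite /chordal big1// => i _; rewrite subrr mulr0 sin0 expr0n.
  have cc : continuous (chordal (repr x)) := class_C_continuous (class_C_chordal (repr x)).
  have := cc (repr x).
  move=> /(cvgr_lt _) /(_ r%:R^-1); rewrite c0 invr_gt0 => /(_ r0).
  move=> /nbhs_ballP[dl /= dl0 H]; have [q qx] := rat_vec_dense (repr x) dl0.
  by exists q; apply: H; exact: ball_sym.
exists q, r; split.
  have : 0 < 1 - r%:R * chordal (rat_vec R q) (repr x).
    by rewrite chordalC subr_gt0 -ltr_pdivlMl// mulr1.
  rewrite /bump; set c := 1 - _ * _ => c0; rewrite /pos max_r ?ltW//.
  by have := exprn_gt0 3 c0; lra.
move=> y nOy; rewrite /bump /pos max_l ?expr0n ?subr0//.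
rewrite subr_le0 -ler_pdivrMl// mulr1 leNgt; apply/negP => qy; apply: nOy; apply: He.
apply: le_lt_trans (chordal_triangle _ (rat_vec R q) _) _.
have re : r%:R^-1 < e / 4.
  by rewrite -[e / 4]invrK ltf_pV2 ?posrE ?invr_gt0 ?divr_gt0// invf_div.
by lra.
Qed.

(** Rational centres and natural parameters give countably many words, and concatenation of words
    makes the family stable under products and powers. *)
Definition bump_word (w : seq ('rV[rat]_d * nat)) (x : T) : R :=
  \prod_(k <- w) bump (rat_vec R k.1) k.2%:R x.

Lemma bump_word_itv w x : 0 <= bump_word w x <= 1.
Proof.
rewrite /bump_word; elim: w => [|k w IH]; first by rewrite big_nil ler01 lexx.
rewrite big_cons; have b := @bump_itv R d (rat_vec R k.1) k.2%:R x ltac:(by []).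
case/andP: b => b0 b1; case/andP: IH => p0 p1.
by rewrite mulr_ge0//= mulr_ile1.
Qed.

Lemma torus_C_bump_word w : torus_C 2 (bump_word w).
Proof. by apply: class_C_prod => k; exact: torus_C_bump. Qed.

Lemma continuous_bounded_measurable (g : T -> R) : continuous g -> bounded_measurable g.
Proof.
move=> cg; split; first exact: continuous_measurable_torus.
by have [B _ gB] := continuous_bounded_torus cg; exists B.
Qed.

Lemma eq_open_measure (m n : P) : (forall O : set T, open O -> m O = n O) -> same_measure m n.
Proof.
move=> mn A mA.
apply: (@measure_unique _ R T (@open T) (fun=> setT) _ _ _ _ m n _ _ A mA) => //.
- by move=> ? ?; exact: openI.
- by move=> _; exact: openT.
- by apply/seteqP; split=> // x _; exists 0%N.
- by move=> _; rewrite (le_lt_trans (probability_le1 _ _)) ?ltry.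
Qed.

(* For open O, the N-th power of the product of the first N bumps equal to 1
   off O tends pointwise to the indicator of the complement of O. *)
Lemma bump_word_separates (m n : P) :
  (forall w, \int[m]_x bump_word w x = \int[n]_x bump_word w x) -> same_measure m n.
Proof.
move=> mn; apply: eq_open_measure => O oO.
pose good (k : 'rV[rat]_d * nat) := `[< forall y, ~ O y -> bump (rat_vec R k.1) k.2%:R y = 1 >].
pose v N := [seq k <- pmap unpickle (iota 0 N) | good k].
pose w N := flatten (nseq N (v N)).
have wE N x : bump_word (w N) x = bump_word (v N) x ^+ N.
  rewrite /bump_word /w; elim: {1 4}N => [|k IH]; first by rewrite big_nil.
  by rewrite /= big_cat/= IH exprS.
have wC x : bump_word (w N) x @[N --> \oo] --> (\1_(~` O) x : R).
  have [Ox|nOx] := pselect (O x).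
    rewrite indicE memNset//.
    have [q [r [q1 qO]]] := bump_base oO Ox.
    have gk : good (q, r) by apply/asboolP.
    set c := bump (rat_vec R q) r%:R x in q1.
    have c01 : 0 <= c <= 1 by exact: bump_itv.
    apply: (@squeeze_cvgr _ _ _ _ (fun=> 0) (fun N => c ^+ N)); last 2 first.
      exact: cvg_cst.
      by apply: cvg_expr; rewrite ger0_norm; case/andP: c01.
    (* From this N on, [v N] contains the bump whose value at x is c < 1, so the N-th power is at
       most c ^+ N. *)
    exists (pickle (q, r)).+1 => // N /= qN; have /andP[v0 v1] := bump_word_itv (v N) x.
    rewrite wE exprn_ge0//= lerXn2r ?nnegrE//; first by case/andP: c01.
    have inv : (q, r) \in v N.
      rewrite mem_filter gk mem_pmap; apply/mapP; exists (pickle (q, r)).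
        by rewrite mem_iota.
      by rewrite pickleK.
    rewrite /bump_word (big_rem _ inv)/= -/c ler_piMr//; first by case/andP: c01.
    by case/andP: (bump_word_itv (rem (q, r) (v N)) x).
  rewrite indicE mem_set//; apply: cvg_near_cst; apply: nearW => N.
  rewrite wE /bump_word big1_seq ?expr1n// => k /andP[_].
  by rewrite mem_filter => /andP[/asboolP + _]; apply.
have H (p : P) : \int[p]_x bump_word (w N) x @[N --> \oo] --> fine (p (~` O)).
  rewrite (_ : fine _ = \int[p]_x \1_(~` O) x).
    apply: (@cvg_expect _ _ _ p _ _ 1).
    - move=> N; apply: continuous_measurable_torus.
      exact: torus_C_continuous (torus_C_bump_word _).
    - apply: measurable_indic; apply: measurableC; exact: open_measurable_torus.
    - by move=> N x; have /andP[h0 h1] := bump_word_itv (w N) x; rewrite ger0_norm.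
    - by apply: aeW => x; exact: wC.
  rewrite /Rintegral integral_indic ?setIT//.
  by apply: measurableC; exact: open_measurable_torus.
have mO : measurable O by exact: open_measurable_torus.
have E : m (~` O) = n (~` O).
  have Hm := H m; have Hn := H n.
  rewrite (funext (fun N => mn (w N))) in Hm.
  rewrite -[LHS]fineK ?fin_num_measure//; last exact: measurableC.
  rewrite -[RHS]fineK ?fin_num_measure//; last exact: measurableC.
  congr EFin; exact: cvg_unique Hm Hn.
have mC : measurable (~` O) by exact: measurableC.
by rewrite -(setCK O) (probability_setC m mC) (probability_setC n mC) E.
Qed.

Lemma C2_bounded (g : T -> R) : torus_C 2 g -> exists2 B, 1 <= B &
  forall x, [/\ `|g x| <= B, forall i, `|partial i g x| <= B &
                forall i j, `|partial i (partial j g) x| <= B].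
Proof.
move=> Cg.
have [B0 B00 H0] := continuous_bounded_torus (torus_C_continuous Cg).
have /choice[B1 H1] : forall i, exists B, 0 <= B /\ forall x, `|partial i g x| <= B.
  move=> i; have [B B_ge0 HB] := continuous_bounded_torus (torus_C_continuous (torus_C_partial i Cg)).
  by exists B.
have /choice[B2 H2] : forall ij : 'I_d * 'I_d, exists B, 0 <= B /\
    forall x, `|partial ij.1 (partial ij.2 g) x| <= B.
  move=> ij; have [B B_ge0 HB] := continuous_bounded_torus (torus_C_continuous
    (torus_C_partial ij.1 (torus_C_partial ij.2 Cg))).
  by exists B.
have S1 : 0 <= \sum_i B1 i by apply: sumr_ge0 => i _; exact: (H1 i).1.
have S2 : 0 <= \sum_ij B2 ij by apply: sumr_ge0 => i _; exact: (H2 i).1.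
exists (1 + B0 + \sum_i B1 i + \sum_ij B2 ij); first by lra.
move=> x; split.
- by apply: le_trans (H0 x) _; lra.
- move=> i; apply: le_trans ((H1 i).2 x) _; rewrite (bigD1 i)//=.
  suff : 0 <= \sum_(j | j != i) B1 j by lra.
  by apply: sumr_ge0 => j _; exact: (H1 j).1.
- move=> i j; apply: le_trans ((H2 (i, j)).2 x) _; rewrite (bigD1 (i, j))//=.
  suff : 0 <= \sum_(k | k != (i, j)) B2 k by lra.
  by apply: sumr_ge0 => k _; exact: (H2 k).1.
Qed.

(** An enumeration of the bump words, each divided by a bound of its derivatives up to order 2 and
    by 2^n. The factors are positive, so separation of measures survives. *)
Lemma separating_sequence : exists e : nat -> T -> R,
  [/\ forall n, torus_C 2 (e n),
      forall x, dominated (fun n => e n x),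
      forall i x, dominated (fun n => partial i (e n) x),
      forall i j x, dominated (fun n => partial i (partial j (e n)) x) &
      forall m n : P, (forall k, \int[m]_x e k x = \int[n]_x e k x) -> same_measure m n].
Proof.
pose w n : seq ('rV[rat]_d * nat) := odflt [::] (unpickle n).
have /choice[B BP] : forall n, exists B, 1 <= B /\ forall x, [/\ `|bump_word (w n) x| <= B,
    forall i, `|partial i (bump_word (w n)) x| <= B &
    forall i j, `|partial i (partial j (bump_word (w n))) x| <= B].
  by move=> n; have [B B1 HB] := C2_bounded (torus_C_bump_word (w n)); exists B.
pose c n := 2^-1 ^+ n / B n.
have c0 n : 0 < c n.
  by apply: divr_gt0; [apply: exprn_gt0; lra|have := (BP n).1; lra].
have cB n y : `|y| <= B n -> `|c n * y| <= 2^-1 ^+ n.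
  move=> yB; have B0 : 0 < B n by have := (BP n).1; lra.
  rewrite normrM gtr0_norm// /c -mulrA ler_piMr ?half_ge0// mulrC.
  by rewrite ler_pdivrMr// mul1r.
have Cw n := torus_C_bump_word (w n).
exists (fun n x => c n * bump_word (w n) x); split.
- by move=> n; exact: (class_C_Z (c n) (Cw n)).
- by move=> x n; apply: cB; case: ((BP n).2 x).
- move=> i x n; rewrite (partialZ _ _ _ (Cw n)); apply: cB.
  by case: ((BP n).2 x) => _ + _; apply.
- move=> i j x n.
  rewrite (_ : partial j _ = fun y => c n * partial j (bump_word (w n)) y); last first.
    by apply/funext => y; exact: partialZ (Cw n).
  rewrite (partialZ _ _ _ (torus_C_partial j (Cw n))); apply: cB.
  by case: ((BP n).2 x) => _ _; apply.
- move=> m n mn; apply: bump_word_separates => s.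
  have := mn (pickle s).
  have bs (k : nat) : bounded_measurable (bump_word (w k)).
    exact: continuous_bounded_measurable (torus_C_continuous (Cw k)).
  rewrite !expectZ// => /(mulfI _); rewrite /w pickleK/=; apply.
  by rewrite gt_eqF.
Qed.

End separating_family.

(** * Termwise differentiation of dominated series *)

Section series_of_C2.
Context {R : realType} {d : nat}.
Local Notation T := (torus R d).

Lemma MVT_quotient (f df : R -> R) (M h : R) : (forall s : R, is_derive s (1 : R) f (df s)) ->
  (forall s, `|df s| <= M) -> `|h^-1 * (f h - f 0)| <= M.
Proof.
move=> fd dfM; have M0 : 0 <= M := le_trans (normr_ge0 _) (dfM 0).
have cf a b : {within `[a, b], continuous f}.
  apply: continuous_subspaceT => s.
  by apply: differentiable_continuous; apply/derivable1_diffP; have [] := fd s.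
have [h0|h0|<-] := ltgtP h 0; last by rewrite subrr mulr0 normr0.
  have [c _ E] := MVT h0 (fun s _ => fd s) (cf _ _).
  have -> : f h - f 0 = df c * h by rewrite -opprB E; ring.
  by rewrite mulrCA mulVf ?mulr1 ?dfM// lt_eqF.
have [c _ E] := MVT h0 (fun s _ => fd s) (cf _ _).
by rewrite E subr0 mulrCA mulVf ?mulr1 ?dfM// gt_eqF.
Qed.

(** By the mean value theorem the difference quotients of the terms inherit the domination of their
    derivatives, uniformly in h; [gsum_cvg] then applies as h tends to 0. *)
Lemma is_derive_gsum (g : nat -> T -> R) (i : 'I_d) (x : 'rV[R]_d) :
  (forall n, torus_C 1 (g n)) -> (forall x, dominated (fun n => g n x)) ->
  (forall x, dominated (fun n => partial i (g n) x)) ->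
  is_derive x (delta_mx 0 i : 'rV[R]_d) (torus_lift (fun y => gsum (fun n => g n y)))
    (gsum (fun n => partial i (g n) (to_torus x))).
Proof.
move=> Cg dg dpg; apply/is_derive_cvgP; set e := delta_mx 0 i.
rewrite (_ : (fun h => _) = fun h => gsum (fun n =>
    h^-1 * (torus_lift (g n) (h *: e + x) - torus_lift (g n) x))); last first.
  by apply/funext => h; rewrite /torus_lift gsumZB.
apply: gsum_cvg.
- move=> h n.
  have D (s : R) : is_derive s (1 : R) (fun s : R => torus_lift (g n) (s *: e + x))
      (partial i (g n) (to_torus (s *: e + x))).
    have := lift_partial i (g n) => /(congr1 (fun f => f (s *: e + x))).
    rewrite /torus_lift => ->; apply/is_derive_line.
    rewrite (_ : (fun r => _) = fun r : R => torus_lift (g n) (r *: e + (s *: e + x))).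
      have D := DeriveDef (@torus_C_derivable R d 0 i (g n) (s *: e + x) (Cg n)) erefl.
      exact: (iffLR (is_derive_line (torus_lift (g n)) (s *: e + x) e _) D).
    by apply/funext => r; rewrite addrA -scalerDl /GRing.scale/= mulr1.
  have := MVT_quotient h D (fun s => dpg _ n).
  by rewrite scale0r add0r.
- by move=> n; exact: dpg.
- move=> n; rewrite -[partial _ _ _]/(torus_lift (partial i (g n)) x) lift_partial.
  exact: (iffLR (is_derive_cvgP _ _ _ _) (DeriveDef (@torus_C_derivable R d 0 i (g n) x (Cg n)) erefl)).
Qed.

Lemma gsum_continuous (g : nat -> T -> R) : (forall n, continuous (g n)) ->
  (forall x, dominated (fun n => g n x)) -> continuous (fun x => gsum (fun n => g n x)).
Proof. by move=> cg dg x; apply: (@gsum_cvg _ _ _ (nbhs_filter x)) => // n; exact: cg. Qed.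

Lemma partial_gsum (g : nat -> T -> R) (i : 'I_d) (x : T) :
  (forall n, torus_C 1 (g n)) -> (forall x, dominated (fun n => g n x)) ->
  (forall x, dominated (fun n => partial i (g n) x)) ->
  partial i (fun y => gsum (fun n => g n y)) x = gsum (fun n => partial i (g n) x).
Proof.
move=> Cg dg dpg; have [_] := is_derive_gsum (repr x) Cg dg dpg.
by rewrite to_torus_repr.
Qed.

Lemma torus_C1_gsum (g : nat -> T -> R) : (forall n, torus_C 1 (g n)) ->
  (forall x, dominated (fun n => g n x)) ->
  (forall i x, dominated (fun n => partial i (g n) x)) ->
  torus_C 1 (fun y => gsum (fun n => g n y)).
Proof.
move=> Cg dg dpg; split.
  have : continuous (fun y => gsum (fun n => g n y)).
    by apply: gsum_continuous => // n; exact: torus_C_continuous (Cg n).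
  by move/continuous_lift.
move=> i; split=> [x|]; first by have [] := is_derive_gsum x Cg dg (dpg i).
rewrite -lift_partial; split=> //.
rewrite (_ : partial i _ = fun x => gsum (fun n => partial i (g n) x)); last first.
  by apply/funext => x; exact: partial_gsum.
apply/continuous_lift; apply: gsum_continuous => // n.
exact: torus_C_continuous (torus_C_partial i (Cg n)).
Qed.

Lemma torus_C2_gsum (g : nat -> T -> R) : (forall n, torus_C 2 (g n)) ->
  (forall x, dominated (fun n => g n x)) ->
  (forall i x, dominated (fun n => partial i (g n) x)) ->
  (forall i j x, dominated (fun n => partial i (partial j (g n)) x)) ->
  torus_C 2 (fun y => gsum (fun n => g n y)).
Proof.
move=> Cg dg dpg dppg; have Cg1 n : torus_C 1 (g n) by exact: torus_CW (Cg n).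
have [c1 H1] := torus_C1_gsum Cg1 dg dpg.
split; first exact: c1.
move=> i; split; first by have [] := H1 i.
rewrite -lift_partial.
rewrite (_ : partial i _ = fun x => gsum (fun n => partial i (g n) x)); last first.
  by apply/funext => x; exact: partial_gsum.
by apply: torus_C1_gsum => // n; exact: torus_C_partial (Cg n).
Qed.

End series_of_C2.

(** * Compactness of the space of probability measures *)

Section torus_distance.
Context {R : realType} {d : nat}.
Local Notation T := (torus R d).

Definition euclid (u : 'rV[R]_d) : R := Num.sqrt (dot u u).

Lemma continuous_euclid : continuous euclid.
Proof.
move=> u; apply: (@continuous_comp _ _ _ (fun u => dot u u) (@Num.sqrt R)).
  by apply: continuous_dot => x.
exact: sqrt_continuous.
Qed.

Let distS (x y : T) : set R := [set r | exists a b : 'rV[R]_d,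
  [/\ to_torus a = x, to_torus b = y & r = euclid (a - b)]].

Let distS_lb x y : has_inf (distS x y).
Proof.
split; first by exists (euclid (repr x - repr y)), (repr x), (repr y); rewrite !to_torus_repr.
by exists 0 => _ [a [b [_ _ ->]]]; exact: sqrtr_ge0.
Qed.

Lemma torus_dist_ge0 (x y : T) : 0 <= torus_dist x y.
Proof.
apply: lb_le_inf; first exact: (distS_lb x y).1.
by move=> _ [a [b [_ _ ->]]]; exact: sqrtr_ge0.
Qed.

Lemma torus_dist_le (a b : 'rV[R]_d) :
  torus_dist (to_torus a) (to_torus b) <= euclid (a - b).
Proof. by apply: ge_inf; [exact: (distS_lb _ _).2|exists a, b]. Qed.

Lemma torus_dist_refl (x : T) : torus_dist x x = 0.
Proof.
apply/eqP; rewrite eq_le torus_dist_ge0 andbT -(to_torus_repr x).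
apply: le_trans (torus_dist_le _ _) _.
by rewrite subrr /euclid /dot big1 ?sqrtr0// => i _; rewrite mxE mul0r.
Qed.

Lemma torus_dist_bounded (x y : T) : torus_dist x y <= Num.sqrt d%:R.
Proof.
have [a a01 <-] := torus_surj x; have [b b01 <-] := torus_surj y.
apply: le_trans (torus_dist_le _ _) _; apply: ler_wsqrtr.
apply: (@le_trans _ _ (\sum_(i < d) 1)); last by rewrite sumr_const card_ord.
apply: ler_sum => i _; rewrite !mxE.
by have := a01 i; have := b01 i; nra.
Qed.

(** The sets where the distance is below r are open: representatives a and b with |a - b| < r can be
    translated along with the two points. *)
Lemma measurable_torus_dist : measurable_fun setT (fun z : T * T => torus_dist z.1 z.2).
Proof.
apply: (measurability _ (RGenInftyO.measurableE R)) => _ [_ [r ->] <-].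
rewrite setTI; apply: torus2_measurable => x y /=; rewrite in_itv/= => xyr.
have [_ [a [b [ax byy ->]]] abr] := inf_lt (distS_lb _ _).1 xyr.
have /nbhs_ballP[e /= e0 He] : \forall u \near (a - b), euclid u < r.
  exact: (cvgr_lt _ (@continuous_euclid (a - b))).
exists (e / 2); first by rewrite divr_gt0.
move=> x' y' xx' yy'; rewrite in_itv/=.
have <- : to_torus (a + (x' - x)) = to_torus x'.
  by rewrite addrC (to_torusD _ ax) subrK.
have <- : to_torus (b + (y' - y)) = to_torus y'.
  by rewrite addrC (to_torusD _ byy) subrK.
apply: le_lt_trans (torus_dist_le _ _) _; apply: He.
have -> : a + (x' - x) - (b + (y' - y)) = (a - b) + ((x' - x) - (y' - y)).
  by rewrite opprD addrACA.
rewrite -ball_normE /= in xx'; rewrite -ball_normE /= in yy'.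
rewrite -ball_normE /= opprD addrA subrr sub0r normrN.
apply: le_lt_trans (ler_normB _ _) _; rewrite (splitr e).
by apply: ltrD; rewrite distrC.
Qed.

Lemma bounded_measurable_torus_dist :
  bounded_measurable (fun z : T * T => torus_dist z.1 z.2).
Proof.
split; first exact: measurable_torus_dist.
exists (Num.sqrt d%:R) => z; rewrite ger0_norm ?torus_dist_ge0//.
exact: torus_dist_bounded.
Qed.

End torus_distance.

Section wasserstein.
Context {R : realType} {d : nat}.
Local Notation T := (torus R d).
Local Notation P := (probability T R).

Lemma integral_dist_coupling (g : probability (T * T)%type R) :
  (\int[g]_z (torus_dist z.1 z.2)%:E)%E = (\int[g]_z torus_dist z.1 z.2)%:E.
Proof.
rewrite /Rintegral fineK//; apply: integrable_fin_num => //.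
exact: bounded_measurable_integrable bounded_measurable_torus_dist.
Qed.

Lemma wasserstein1_lt (m n : P) (g : probability (T * T)%type R) (r : R) :
  coupling m n g -> \int[g]_z torus_dist z.1 z.2 < r -> (wasserstein1 m n < r%:E)%E.
Proof.
move=> cg gr; apply: (@le_lt_trans _ _ (\int[g]_z (torus_dist z.1 z.2)%:E)%E).
  by apply: ereal_inf_lbound; exists g.
by rewrite integral_dist_coupling lte_fin.
Qed.

Lemma coupled_wasserstein1 dO (O : measurableType dO) (Q : probability O R)
    (X Y : O -> T) (m n : P) (r : R) :
  measurable_fun setT X -> measurable_fun setT Y ->
  (forall A, measurable A -> Q (X @^-1` A) = m A) ->
  (forall A, measurable A -> Q (Y @^-1` A) = n A) ->
  \int[Q]_w torus_dist (X w) (Y w) < r -> (wasserstein1 m n < r%:E)%E.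
Proof.
move=> mX mY XE YE XYr.
have mXY : measurable_fun setT (fun w => (X w, Y w)) by exact/measurable_fun_pair.
pose mZ := isMeasurableFun.Build _ _ _ _ (fun w => (X w, Y w)) mXY.
pose Z : {mfun O >-> (T * T)%type} := HB.pack (fun w => (X w, Y w)) mZ.
apply: (@wasserstein1_lt _ _ (distribution Q Z)).
  move=> A mA; rewrite /distribution /= /pushforward -XE// -YE//.
  split; congr (Q _); apply/seteqP; split=> w //=; tauto.
by rewrite (expect_distribution _ _ bounded_measurable_torus_dist).
Qed.

Lemma wasserstein1_same (m n : P) (r : R) : 0 < r -> same_measure m n ->
  (wasserstein1 m n < r%:E)%E.
Proof.
move=> r0 mn.
apply: (@coupled_wasserstein1 _ _ m id id) => //.
by under eq_Rintegral do rewrite torus_dist_refl; rewrite expect_cst.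
Qed.

Lemma expect_same (m n : P) (g : T -> R) : same_measure m n ->
  \int[m]_x g x = \int[n]_x g x.
Proof. by move=> mn; rewrite /Rintegral; congr fine; apply: eq_measure_integral => A mA _; exact: mn. Qed.

End wasserstein.

(** * Skorokhod representations and sequential compactness *)

Section skorokhod.
Context {R : realType} {d : nat}.
Local Notation T := (torus R d).
Local Notation P := (probability T R).

Let L : probability (measurableTypeR R) R := uniform_prob (@ltr01 R).

Let h (r : R) : T := to_torus (peano d r).

Let continuous_h : continuous h.
Proof. by move=> r; apply: continuous_comp; [exact: peano_continuous|exact: to_torus_continuous]. Qed.

Let h_surj (x : T) : exists2 r, 0 <= r <= 1 & h r = x.
Proof.
have [y y01 <-] := torus_surj x; have [r r01 ry] := peano_surj y01.
by exists r => //; rewrite /h ry.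
Qed.

Let fiber_compact (x : T) : compact [set r : R | 0 <= r <= 1 /\ h r = x].
Proof.
rewrite (_ : [set r | _] = `[0, 1]%classic `&` h @^-1` [set x]).
  apply: subclosed_compact (@segment_compact R 0 1) _; last exact: subIsetl.
  apply: closedI; first exact: interval_closed.
  apply: closed_comp; first by move=> r _; exact: continuous_h.
  by apply: compact_closed; [exact: torus_hausdorff|exact: compact_set1].
by apply/seteqP; split=> r /=; rewrite in_itv.
Qed.

(* [g x] is the first time at which the curve visits x: its sublevel sets are
   images of compact intervals. *)
Lemma peano_section : exists g : T -> R, [/\ measurable_fun setT (g : T -> measurableTypeR R),
  forall x, 0 <= g x <= 1 & forall x, to_torus (peano d (g x)) = x].
Proof.
have /choice[g gP] : forall x, exists r : R, [/\ 0 <= r <= 1, h r = x &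
    forall s, 0 <= s <= 1 -> h s = x -> r <= s].
  move=> x; have [r0 r01 hr0] := h_surj x.
  have S0 : [set r : R | 0 <= r <= 1 /\ h r = x] !=set0 by exists r0.
  have [|r rS rmin] := @compact_EVT_min _ _ (fun r : R => r) _ S0 (@fiber_compact x).
    by apply: continuous_subspaceT => r.
  move: rS; rewrite inE => -[r01' hr]; exists r; split=> // s s01 hs.
  by apply: rmin; rewrite inE.
exists g; split.
- apply: (measurability _ (RGenOInfty.measurableE R)) => _ [_ [a ->] <-].
  rewrite setTI (_ : _ @^-1` _ = ~` (h @` (`[0, 1]%classic `&` `]-oo, a]%classic))).
    apply: measurableC; apply: compact_measurable_torus; apply: continuous_compact.
      by apply: continuous_subspaceT; exact: continuous_h.
    apply: subclosed_compact (@segment_compact R 0 1) _; last exact: subIsetl.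
    by apply: closedI; exact: interval_closed.
  apply/seteqP; split=> x /=; have [g01 hg gmin] := gP x; rewrite in_itv/= andbT.
    move=> ag [r [/= r01 ra] hr]; rewrite !in_itv/= in r01 ra.
    by have := gmin r r01 hr; lra.
  move=> H; rewrite ltNge; apply/negP => ga; by apply: H; exists (g x).
- by move=> x; case: (gP x).
- by move=> x; case: (gP x).
Qed.

Let measurable_h_comp (X : R -> R) : nondecreasing_fun X ->
  measurable_fun setT ((fun w => h (X w)) : measurableTypeR R -> T).
Proof.
move=> ndX; apply: (measurability (@open T) erefl) => _ [A oA <-].
rewrite setTI (_ : _ @^-1` _ = X @^-1` (h @^-1` A)); last by [].
rewrite -[X in measurable X]setTI; apply: nondecreasing_measurable => //.
by apply: open_measurable; move/continuousP: continuous_h; exact.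
Qed.

(** Transport m to [0, 1] by the section of the curve and take the quantile function of the image:
    composed with the curve it has law m, since the curve undoes its section. *)
Lemma skorokhod_representation (m : P) : exists X : R -> R,
  [/\ nondecreasing_fun X, forall w, 0 <= X w <= 1 &
  forall A : set T, measurable A -> L ((fun w => to_torus (peano d (X w))) @^-1` A) = m A].
Proof.
have [g [mg g01 hg]] := peano_section.
pose mG := isMeasurableFun.Build _ _ _ _ (g : T -> measurableTypeR R) mg.
pose G : {mfun T >-> measurableTypeR R} := HB.pack (g : T -> measurableTypeR R) mG.
pose Q : probability (measurableTypeR R) R := distribution m G.
have Q01 : Q `[0, 1]%classic = 1%E.
  change (m (g @^-1` `[0, 1]%classic) = 1%E).
  rewrite (_ : g @^-1` _ = setT); first exact: probability_setT.
  by apply/seteqP; split=> x //= _; rewrite in_itv/=; exact: g01.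
exists (quantile Q); split.
- exact: quantile_nondecreasing.
- exact: quantile_itv.
- move=> A mA.
  have mhA : measurable ((h : measurableTypeR R -> T) @^-1` A).
    have := @measurable_h_comp (fun r => r) (fun r s rs => rs).
    by move=> /(_ measurableT A mA); rewrite setTI.
  rewrite [LHS](quantile_law Q01 mhA) /Q /distribution /= /pushforward.
  by congr (m _); apply/seteqP; split=> x; rewrite /= /h hg.
Qed.

(** The representing variables are vectors whose classes have the given laws, so that continuity of
    lifts applies directly to their almost sure convergence. *)
Definition skorokhod_cvg (m_ : nat -> P) (m : P) := exists (a : nat -> R -> 'rV[R]_d) (b : R -> 'rV[R]_d),
  [/\ forall n, measurable_fun setT ((fun w => to_torus (a n w)) : measurableTypeR R -> T),
      measurable_fun setT ((fun w => to_torus (b w)) : measurableTypeR R -> T),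
      forall n (A : set T), measurable A -> L ((fun w => to_torus (a n w)) @^-1` A) = m_ n A,
      forall (A : set T), measurable A -> L ((fun w => to_torus (b w)) @^-1` A) = m A &
      {ae L, forall w, a n w @[n --> \oo] --> b w}].

(** m is by construction the law of the limit, and continuity of the curve carries the almost sure
    convergence from [0, 1] to the vectors. *)
Lemma nondecreasing_skorokhod_cvg (X_ : nat -> R -> R) (X : R -> R) (m_ : nat -> P) :
  (forall n, nondecreasing_fun (X_ n)) -> nondecreasing_fun X ->
  (forall n (A : set T), measurable A -> L ((fun w => to_torus (peano d (X_ n w))) @^-1` A) = m_ n A) ->
  (forall q : rat, X_ n (ratr q) @[n --> \oo] --> X (ratr q)) ->
  exists m : P, skorokhod_cvg m_ m.
Proof.
move=> ndX_ ndX XE Xq.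
pose mY := isMeasurableFun.Build _ _ _ _ _ (measurable_h_comp ndX).
pose Y : {mfun measurableTypeR R >-> T} := HB.pack ((fun w => h (X w)) : measurableTypeR R -> T) mY.
exists (distribution L Y), (fun n w => peano d (X_ n w)), (fun w => peano d (X w)); split => //.
- by move=> n; exact: measurable_h_comp.
- exact: measurable_h_comp.
- apply: ae_imply (nondecreasing_cvg_ae ndX_ ndX Xq) => w Xw.
  exact: (continuous_cvg _ (@peano_continuous R d (X w)) Xw).
Qed.

Lemma skorokhod_compactness (t s : nat -> R) (mu nu : nat -> P) (S : R) :
  (forall k, 0 <= t k <= S) -> (forall k, 0 <= s k <= S) ->
  exists (kappa : nat -> nat) (t0 s0 : R) (m0 n0 : P),
    [/\ forall n, (n <= kappa n)%N, 0 <= t0 <= S, 0 <= s0 <= S &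
     [/\ t (kappa n) @[n --> \oo] --> t0, s (kappa n) @[n --> \oo] --> s0,
      skorokhod_cvg (mu \o kappa) m0 & skorokhod_cvg (nu \o kappa) n0]].
Proof.
move=> tS sS.
have /choice[X XP] : forall k, exists X, _ := fun k => skorokhod_representation (mu k).
have /choice[Y YP] : forall k, exists Y, _ := fun k => skorokhod_representation (nu k).
(* One index set for both sequences of times and for all values of both families of quantile
   functions, so that one extraction serves them all. Convergence is asked at rational arguments,
   which [e] enumerates, while the limit stays monotone at all real ones. *)
pose J : Type := ((bool * R) + bool)%type.
pose a (k : nat) (j : J) : R := match j with
  | inl (true, w) => X k w | inl (false, w) => Y k w
  | inr true => t k | inr false => s k end.
pose e (n : nat) : J := match (unpickle n : option ((bool * rat) + bool)%type) with
  | Some (inl (b, q)) => inl (b, ratr q) | Some (inr b) => inr b | None => inr true end.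
have aB k j : `|a k j| <= 1 + S.
  have S0 : 0 <= S by have := tS 0%N; lra.
  rewrite ger0_norm; case: j => [[[] w]|[]] /=.
  - by case: (XP k) => _ /(_ w) + _; lra.
  - by case: (YP k) => _ /(_ w) + _; lra.
  - by have := tS k; lra.
  - by have := sS k; lra.
  - by case: (XP k) => _ /(_ w) + _; lra.
  - by case: (YP k) => _ /(_ w) + _; lra.
  - by have := tS k; lra.
  - by have := sS k; lra.
have [l [kappa [kn lle leub lelb lcv]]] := diagonal_extraction e aB.
have lcvJ (j : (bool * rat) + bool) :
    a (kappa n) (match j with inl (b, q) => inl (b, ratr q) | inr b => inr b end)
      @[n --> \oo] --> l (match j with inl (b, q) => inl (b, ratr q) | inr b => inr b end).
  by have := lcv (pickle j); rewrite /e pickleK.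
have [m0 Hm] := @nondecreasing_skorokhod_cvg (X \o kappa) (fun w => l (inl (true, w))) (mu \o kappa)
  (fun n => let: And3 h1 _ _ := XP (kappa n) in h1)
  ltac:(by move=> u v uv; have := lle (inl (true, u)) (inl (true, v)) 0;
    rewrite addr0; apply => k; rewrite addr0; case: (XP k) => ndX _ _; exact: ndX)
  (fun n => let: And3 _ _ h3 := XP (kappa n) in h3)
  (fun q => lcvJ (inl (true, q))).
have [n0 Hn] := @nondecreasing_skorokhod_cvg (Y \o kappa) (fun w => l (inl (false, w))) (nu \o kappa)
  (fun n => let: And3 h1 _ _ := YP (kappa n) in h1)
  ltac:(by move=> u v uv; have := lle (inl (false, u)) (inl (false, v)) 0;
    rewrite addr0; apply => k; rewrite addr0; case: (YP k) => ndX _ _; exact: ndX)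
  (fun n => let: And3 _ _ h3 := YP (kappa n) in h3)
  (fun q => lcvJ (inl (false, q))).
exists kappa, (l (inr true)), (l (inr false)), m0, n0; split=> //.
- apply/andP; split; [apply: lelb|apply: leub] => k; by case/andP: (tS k).
- apply/andP; split; [apply: lelb|apply: leub] => k; by case/andP: (sS k).
- by split=> //; [exact: (lcvJ (inr true))|exact: (lcvJ (inr false))].
Qed.

(** The representations of m and of m_n live on the same interval, hence give a coupling; its cost
    tends to 0 by bounded convergence. *)
Lemma skorokhod_wasserstein1 (m_ : nat -> P) (m : P) (r : R) : skorokhod_cvg m_ m -> 0 < r ->
  \forall n \near \oo, (wasserstein1 m (m_ n) < r%:E)%E.
Proof.
move=> [a [b [ma mb aE bE ab]]] r0.
have mab n : measurable_fun setT (fun w : measurableTypeR R => torus_dist (to_torus (b w)) (to_torus (a n w))).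
  exact: (measurableT_comp measurable_torus_dist (measurable_fun_pair mb (ma n))).
have : \int[L]_w torus_dist (to_torus (b w)) (to_torus (a n w)) @[n --> \oo]
    --> \int[L]_w (0 : R).
  apply: (@cvg_expect _ _ _ L _ _ (Num.sqrt d%:R)) => //.
  - by move=> n w; rewrite ger0_norm ?torus_dist_ge0// torus_dist_bounded.
  - apply: ae_imply ab => w aw.
    apply: (@squeeze_cvgr _ _ _ _ (fun=> 0) (fun n => euclid (b w - a n w))).
    + by apply: nearW => n; rewrite torus_dist_ge0 torus_dist_le.
    + exact: cvg_cst.
    + have -> : 0 = euclid (b w - b w).
        by rewrite subrr /euclid /dot big1 ?sqrtr0// => i _; rewrite mxE mul0r.
      apply: (continuous_cvg _ (@continuous_euclid R d (b w - b w))).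
      by apply: cvgB => //; exact: cvg_cst.
rewrite expect_cst => /(cvgr_lt _) /(_ _ r0).
apply: filterS => n; apply: coupled_wasserstein1 => //.
exact: aE.
Qed.

(** The integrands vary with n because they will be values of U at varying times and measures, where
    joint continuity gives convergence along convergent points. *)
Lemma skorokhod_expect (m_ : nat -> P) (m : P) (F : nat -> T -> R) (G : T -> R) (B : R) :
  skorokhod_cvg m_ m -> (forall n, measurable_fun setT (F n)) -> measurable_fun setT G ->
  (forall n x, `|F n x| <= B) ->
  (forall (x : nat -> 'rV[R]_d) y, x n @[n --> \oo] --> y ->
     F n (to_torus (x n)) @[n --> \oo] --> G (to_torus y)) ->
  \int[m_ n]_x F n x @[n --> \oo] --> \int[m]_x G x.
Proof.
move=> [a [b [ma mb aE bE ab]]] mF mG FB FG.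
have E (p : P) (X : measurableTypeR R -> T) (f : T -> R) C : measurable_fun setT X ->
    measurable_fun setT f -> (forall x, `|f x| <= C) ->
    (forall A : set T, measurable A -> L (X @^-1` A) = p A) -> \int[p]_x f x = \int[L]_w f (X w).
  move=> mX mf fC XE.
  pose mX' := isMeasurableFun.Build _ _ _ _ X mX.
  pose X' : {mfun measurableTypeR R >-> T} := HB.pack X mX'.
  rewrite -(@expect_distribution _ _ _ _ _ L X'); last by split=> //; exists C.
  by apply: expect_same => A mA; rewrite -XE.
have GB y : `|G y| <= B.
  rewrite -(to_torus_repr y).
  have c : `|F n (to_torus (repr y))| @[n --> \oo] --> `|G (to_torus (repr y))|.
    by apply: cvg_norm; apply: FG; exact: cvg_cst.
  rewrite -(cvg_lim _ c)//; apply: limr_le; first by apply/cvg_ex; eexists; exact: c.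
  by apply: nearW.
rewrite (E m _ G B mb mG GB bE).
rewrite (_ : (fun n => _) = fun n => \int[L]_w F n (to_torus (a n w))); last first.
  by apply/funext => n; apply: (E (m_ n) _ (F n) B (ma n)) => //; exact: aE.
apply: (@cvg_expect _ _ _ L _ _ B).
- by move=> n; exact: measurableT_comp.
- exact: measurableT_comp.
- by move=> n w; exact: FB.
- by apply: ae_imply ab => w aw; exact: FG.
Qed.

End skorokhod.

(** * Mixtures, jumps and convexity *)

Section expectation_functional.
Context (R : realType) (dT : measure_display) (T : measurableType dT).
Variables (P : probability T R) (Lambda : (T -> R) -> R).
Hypothesis LambdaD : forall f g, bounded_measurable f -> bounded_measurable g ->
  Lambda (fun x => f x + g x) = Lambda f + Lambda g.
Hypothesis LambdaZ : forall c f, bounded_measurable f ->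
  Lambda (fun x => c * f x) = c * Lambda f.
Hypothesis Lambda_norm : forall f B, bounded_measurable f -> (forall x, `|f x| <= B) ->
  `|Lambda f| <= B.
Hypothesis Lambda_indic : forall A, measurable A -> Lambda (\1_A) = fine (P A).

Let D f := Lambda f - \int[P]_x f x.

Let bm_indic (A : set T) : measurable A -> bounded_measurable (\1_A : T -> R).
Proof.
move=> mA; split; first exact: measurable_indic.
by exists 1 => x; rewrite indicE; case: (_ \in _); rewrite ?normr1 ?normr0.
Qed.

Let DD f g : bounded_measurable f -> bounded_measurable g ->
  D (fun x => f x + g x) = D f + D g.
Proof. by move=> bf bg; rewrite /D LambdaD// expectD//; ring. Qed.

Let DZ c f : bounded_measurable f -> D (fun x => c * f x) = c * D f.
Proof. by move=> bf; rewrite /D LambdaZ// expectZ//; ring. Qed.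

Let D_indic A : measurable A -> D (\1_A) = 0.
Proof.
by move=> mA; rewrite /D Lambda_indic// /Rintegral integral_indic// setIT subrr.
Qed.

Let D_norm f B : bounded_measurable f -> (forall x, `|f x| <= B) -> `|D f| <= 2 * B.
Proof.
move=> bf fB; apply: le_trans (ler_normB _ _) _.
by have := Lambda_norm bf fB; have := norm_expect_le P bf.1 fB; lra.
Qed.

(** f lies within 1 / (N + 1) of a staircase, a combination of indicators of its superlevel sets, on
    which D vanishes. *)
Let D_unit (f : T -> R) : measurable_fun setT f -> (forall x, 0 <= f x <= 1) -> D f = 0.
Proof.
move=> mf f01.
have bf : bounded_measurable f.
  by split=> //; exists 1 => x; rewrite ger0_norm; case/andP: (f01 x).
suff H N : `|D f| <= 2 * N.+1%:R^-1.
  apply/eqP; rewrite -normr_eq0; apply/negPn/negP => Df0.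
  have Df : 0 < `|D f| / 2 by rewrite divr_gt0// lt_neqAle eq_sym Df0 normr_ge0.
  have h1 := H (Num.truncn (`|D f| / 2)^-1).
  have h2 : (Num.truncn (`|D f| / 2)^-1).+1%:R^-1 < `|D f| / 2.
    by rewrite invf_plt ?posrE//; exact: truncnS_gt.
  by move: h1 h2; move: (_.+1%:R^-1) => v; lra.
pose E j := f @^-1` `[j.+1%:R / N.+1%:R, +oo[%classic.
have mE j : measurable (E j).
  by rewrite -[E j]setTI; apply: mf => //; exact: measurable_itv.
pose g k x := \sum_(j < k) N.+1%:R^-1 * (\1_(E j) x : R).
have gD k : bounded_measurable (g k) /\ D (g k) = 0.
  elim: k => [|k [bg Dg]].
    rewrite /g (_ : (fun x => _) = fun=> 0); last by apply/funext => x; rewrite big_ord0.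
    split; first exact: bounded_measurable_cst.
    rewrite (_ : (fun=> 0) = (fun x => 0 * (fun=> 0) x)); last by apply/funext => x; rewrite mul0r.
    by rewrite DZ ?mul0r//; exact: bounded_measurable_cst.
  have -> : g k.+1 = fun x => g k x + N.+1%:R^-1 * \1_(E k) x.
    by apply/funext => x; rewrite /g big_ord_recr.
  have bE := bounded_measurableZ N.+1%:R^-1 (bm_indic (mE k)).
  split; first exact: bounded_measurableD.
  by rewrite DD// Dg DZ ?D_indic ?mulr0 ?addr0//; exact: bm_indic.
have [bg Dg] := gD N.+1.
have gE x : g N.+1 x = (Num.truncn (N.+1%:R * f x))%:R / N.+1%:R.
  rewrite /g -mulr_sumr mulrC; congr (_ * _).
  have k1 : (Num.truncn (N.+1%:R * f x) <= N.+1)%N.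
    rewrite truncn_le_nat; have /andP[_ fx1] := f01 x.
    apply: (@le_lt_trans _ _ N.+1%:R); last by rewrite ltr_nat.
    by rewrite ger_pMr.
  rewrite (eq_bigr (fun j : 'I_N.+1 => ((j < Num.truncn (N.+1%:R * f x))%N)%:R)); last first.
    move=> j _; rewrite indicE /E truncn_gt_nat; congr (nat_of_bool _)%:R.
    by apply/idP/idP; rewrite inE/= in_itv/= andbT ler_pdivrMr// mulrC.
  move: k1; move: (Num.truncn _) => k k1.
  rewrite -natr_sum; congr (_%:R).
  by rewrite -big_mkcond/= -(big_ord_widen _ (fun=> 1%N) k1) sum_nat_const card_ord muln1.
have bN := bounded_measurableZ (-1) bg.
have -> : D f = D (fun x => f x + -1 * g N.+1 x).
  by rewrite DD// DZ// Dg mulr0 addr0.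
apply: D_norm; first exact: bounded_measurableD.
move=> x; rewrite gE; have /andP[fx0 _] := f01 x.
have /truncn_itv/andP[] : 0 <= N.+1%:R * f x by rewrite mulr_ge0.
move: (Num.truncn _) => k k1 k2.
have N0 : 0 < N.+1%:R :> R by [].
rewrite mulN1r ger0_norm ?subr_ge0 ?ler_pdivrMr ?(mulrC (f x))//.
rewrite lerBlDr -[X in X + _]mul1r -mulrDl ler_pdivlMr// mulrC.
by rewrite (_ : 1 + k%:R = k.+1%:R) ?ltW// -natr1 addrC.
Qed.

(** Identities between expectations are thereby checked on indicators only; this serves for mixtures
    and for [jump]. An affine change reduces f to values in [0, 1]. *)
Lemma expect_functional f : bounded_measurable f -> Lambda f = \int[P]_x f x.
Proof.
move=> bf; suff : D f = 0 by rewrite /D => /eqP; rewrite subr_eq0 => /eqP.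
(* The added 1 keeps B positive even if the bound B0 is 0. *)
have [mf [B0 fB0]] := bf; pose B := B0 + 1.
have B00 : 0 <= B0 := le_trans (normr_ge0 _) (fB0 point).
have B_gt0 : 0 < B by rewrite /B; lra.
have fB x : - B <= f x <= B.
  by have := fB0 x; rewrite ler_norml /B; lra.
pose g x := (2 * B)^-1 * (f x + B).
have bg : bounded_measurable g.
  apply: bounded_measurableZ; apply: bounded_measurableD => //.
  exact: bounded_measurable_cst.
have fE : f = fun x => 2 * B * g x + - B * \1_setT x.
  apply/funext => x; rewrite /g indicE mem_set//.
  by rewrite mulr1n mulr1; field; rewrite gt_eqF.
rewrite {1}fE (DD (bounded_measurableZ _ bg) (bounded_measurableZ _ (bm_indic measurableT))).
rewrite (DZ _ bg) (DZ _ (bm_indic measurableT)) D_indic// mulr0 addr0.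
rewrite D_unit ?mulr0//; first exact: bg.1.
move=> x; have := fB x => /andP[h1 h2]; rewrite /g.
by rewrite mulrC ler_pdivrMr ?mulr_gt0// mul1r divr_ge0 ?mulr_ge0//=; lra.
Qed.

End expectation_functional.

Section mixture.
Context (R : realType) (dT : measure_display) (T : measurableType dT).

Lemma mixture_exists (p q : probability T R) (t : R) : 0 <= t <= 1 ->
  exists m : probability T R, forall A : set T, measurable A ->
    m A = ((1 - t)%:E * p A + t%:E * q A)%E.
Proof.
move=> /andP[t0 t1]; have t1' : 0 <= 1 - t by lra.
pose a : {measure set T -> \bar R} := measure_add (mscale (NngNum t1') p) (mscale (NngNum t0) q).
pose n : set T -> \bar R := a.
have nE A : n A = ((1 - t)%:E * p A + t%:E * q A)%E.
  by rewrite -[n A]/(measure_add (mscale (NngNum t1') p) (mscale (NngNum t0) q) A) measure_addE.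
have nT : n setT = 1%E.
  rewrite nE [X in (_ * X + _)%E](@probability_setT _ _ _ p).
  by rewrite [X in (_ + _ * X)%E](@probability_setT _ _ _ q) !mule1 -EFinD subrK.
pose nm := isMeasure.Build _ _ _ n (measure0 a) (measure_ge0 a) (@measure_semi_sigma_additive _ _ _ a).
pose nM : {measure set T -> \bar R} := HB.pack n nm.
pose np := Measure_isProbability.Build _ _ _ nM nT.
pose m : probability T R := HB.pack n nm np.
by exists m => A mA; exact: nE.
Qed.

Lemma expect_mixture (p q m : probability T R) (t : R) (f : T -> R) : 0 <= t <= 1 ->
  (forall A : set T, measurable A -> m A = ((1 - t)%:E * p A + t%:E * q A)%E) ->
  bounded_measurable f ->
  \int[m]_x f x = (1 - t) * \int[p]_x f x + t * \int[q]_x f x.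
Proof.
move=> t01 mE bf.
rewrite -(@expect_functional _ _ _ m (fun f => (1 - t) * \int[p]_x f x + t * \int[q]_x f x))//.
- by move=> g h bg bh; rewrite !expectD//; ring.
- by move=> c g bg; rewrite !expectZ//; ring.
- move=> g B [mg _] gB; have := norm_expect_le p mg gB; have := norm_expect_le q mg gB.
  by rewrite !ler_norml; move=> /andP[h1 h2] /andP[h3 h4]; apply/andP; split; nra.
- move=> A mA; rewrite mE// /Rintegral !integral_indic// !setIT.
  by rewrite fineD ?fineM ?fin_numM ?fin_num_measure.
Qed.

End mixture.

Section torus_measures.
Context {R : realType} {d : nat}.
Local Notation T := (torus R d).
Local Notation P := (probability T R).
Local Notation M := ({charge set T -> \bar R})%type.

(** Whichever Hahn decomposition is chosen, its negative set is null for a non-negative measure, so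
    the negative variation is 0 and the positive one is n. *)
Lemma charge_integral_probability (n : P) (g : T -> R) :
  charge_integral (charge_of_finite_measure n) g = \int[n]_x g x.
Proof.
rewrite /charge_integral; set h := svalP _.
have [[mA posA] [mB negB] ABT AB0] := h.
have nB0 (A : set T) : measurable A -> n (A `&` (sval (cid (hahn_exists (charge_of_finite_measure n)))).2) = 0%E.
  move=> mA'; apply/eqP; rewrite -measure_le0.
  by apply: (negB (A `&` _)); [exact: measurableI|exact: subIsetr].
have -> : \int[jordan_neg h]_x g x = 0.
  rewrite /Rintegral (eq_measure_integral mzero) ?integral_measure_zero// => A mA' _.
  rewrite [LHS](etrans (jordan_negE h A) (cjordan_negE h A)) /crestr0/= mem_set// /crestr/=.
  by rewrite /charge_of_finite_measure nB0// oppe0.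
rewrite subr0 /Rintegral; congr fine; apply: eq_measure_integral => A mA' _.
rewrite [LHS](etrans (jordan_posE h A) (cjordan_posE h A)) /crestr0/= mem_set// /crestr/= /charge_of_finite_measure.
have -> : n A = (n (A `&` (sval (cid (hahn_exists (charge_of_finite_measure n)))).1)
    + n (A `&` (sval (cid (hahn_exists (charge_of_finite_measure n)))).2))%E.
  rewrite -measureU; [|exact: measurableI|exact: measurableI|].
    by rewrite -setIUr ABT setIT.
  by rewrite setIACA AB0 setI0.
by rewrite nB0// adde0.
Qed.

Lemma pairing_sub_probability (g : T -> R) (m n : P) :
  pairing_sub g m (charge_of_finite_measure n) = \int[m]_x g x - \int[n]_x g x.
Proof. by rewrite /pairing_sub charge_integral_probability. Qed.

(** Coupling: with weight 1 - t the point stays in place, with weight t it goes to an independent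
    point of law q. The cost is at most t times sqrt d, a bound of the diameter. *)
Lemma mixture_wasserstein1 (p q : P) (r : R) : 0 < r -> exists2 e, 0 < e &
  forall t (m : P), 0 < t <= 1 -> t < e ->
  (forall A : set T, measurable A -> m A = ((1 - t)%:E * p A + t%:E * q A)%E) ->
  (wasserstein1 p m < r%:E)%E.
Proof.
move=> r0; have s0 : 0 <= Num.sqrt d%:R :> R by exact: sqrtr_ge0.
exists (r / (1 + Num.sqrt d%:R)); first by rewrite divr_gt0//; lra.
move=> t m t01 te mE.
have mdg : measurable_fun setT (fun x : T => (x, x)) by exact/measurable_fun_pair.
pose mD := isMeasurableFun.Build _ _ _ _ (fun x : T => (x, x)) mdg.
pose D : {mfun T >-> (T * T)%type} := HB.pack (fun x : T => (x, x)) mD.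
pose p1 : probability (T * T)%type R := distribution p D.
pose p2 : probability (T * T)%type R := (p \x q)%E.
have t01' : 0 <= t <= 1 by lra.
have [g gE] := mixture_exists p1 p2 t01'.
apply: (@wasserstein1_lt _ _ _ _ g).
  move=> A mA; rewrite !gE ?mE//; try exact: measurableX.
  have -> : p1 (A `*` setT) = p A.
    by rewrite /p1 /distribution/= /pushforward; congr (p _); apply/seteqP; split=> x //= [].
  have -> : p1 (setT `*` A) = p A.
    by rewrite /p1 /distribution/= /pushforward; congr (p _); apply/seteqP; split=> x //= [].
  have -> : p2 (A `*` setT) = p A.
    rewrite /p2 [LHS]product_measure1E// [X in (_ * X)%E](@probability_setT _ _ _ q).
    by rewrite mule1.
  have -> : p2 (setT `*` A) = q A.
    rewrite /p2 [LHS]product_measure1E// [X in (X * _)%E](@probability_setT _ _ _ p).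
    by rewrite mul1e.
  split=> //; rewrite -(fineK (fin_num_measure p A mA)) -!EFinM -EFinD.
  by congr EFin; ring.
have bd := @bounded_measurable_torus_dist R d.
rewrite (expect_mixture t01' gE bd) [X in _ * X + _](_ : _ = 0); last first.
  rewrite /p1 (expect_distribution _ _ bd) /=.
  by under eq_Rintegral do rewrite torus_dist_refl; rewrite expect_cst.
rewrite mulr0 add0r.
have : \int[p2]_z torus_dist z.1 z.2 <= Num.sqrt d%:R.
  rewrite -[leRHS](@expect_cst _ _ _ p2); apply: le_expect => //.
    exact: bounded_measurable_cst.
  by move=> z; exact: torus_dist_bounded.
move=> h; apply: (@le_lt_trans _ _ (t * Num.sqrt d%:R)).
  by rewrite ler_pM2l//; case/andP: t01.
move: te; rewrite ltr_pdivlMr; last lra.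
by have [t0 _] := andP t01; nra.
Qed.

Lemma jump_adjoint_bounded_measurable (K : T -> T -> R) (phi : T -> R) :
  bounded_measurable (fun z : T * T => K z.1 z.2) -> bounded_measurable phi ->
  bounded_measurable (jump_adjoint K phi).
Proof.
move=> bK bphi; pose l := torus_lebesgue R d.
have bphi1 : bounded_measurable (fun z : T * T => phi z.1).
  exact: (bounded_measurable_comp (X := fst)).
have bF := bounded_measurableM bK bphi1; have [mF [B FB]] := bF.
split; last first.
  exists B => y; apply: (norm_expect_le l); last by move=> x; exact: (FB (x, y)).
  exact: (measurable_fun_pair1 y mF).
have iF := @bounded_measurable_integrable _ _ _ (l \x l)%E _ bF.
exact: (measurableT_comp (fine_measurable measurableT) (measurable_fubini_G iF)).
Qed.

(** Duality of the two jump operators. By [expect_functional] only indicators matter, and there it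
    is Tonelli's theorem for the density of [jump]. *)
Lemma expect_jump (K : T -> T -> R) (phi : T -> R) (m : P) :
  smooth2 K -> (forall x y, 0 <= K x y) ->
  (forall y, \int[torus_lebesgue R d]_x K x y = 1) ->
  bounded_measurable (fun z : T * T => K z.1 z.2) -> bounded_measurable phi ->
  \int[m]_y jump_adjoint K phi y = \int[jump K m]_x phi x.
Proof.
move=> sK K0 K1 bK bphi; pose l := torus_lebesgue R d.
have bKy y : bounded_measurable (fun x => K x y).
  by have [mK [B KB]] := bK; split; [exact: (measurable_fun_pair1 y mK)|exists B => x; exact: (KB (x, y))].
apply: (@expect_functional _ _ _ (jump K m) (fun phi => \int[m]_y jump_adjoint K phi y)) => //.
- move=> f g bf bg; rewrite -expectD; [|exact: jump_adjoint_bounded_measurable..].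
  apply: eq_Rintegral => y _; rewrite /jump_adjoint -expectD.
  + by apply: eq_Rintegral => x _; rewrite mulrDr.
  + exact: bounded_measurableM.
  + exact: bounded_measurableM.
- move=> c f bf; rewrite -expectZ; last exact: jump_adjoint_bounded_measurable.
  apply: eq_Rintegral => y _; rewrite /jump_adjoint -expectZ; last exact: bounded_measurableM.
  by apply: eq_Rintegral => x _; rewrite mulrCA.
- move=> f B bf fB; apply: norm_expect_le.
    by case: (jump_adjoint_bounded_measurable bK bf).
  (* As the kernel is non-negative and integrates to 1 in x, the adjoint does not increase the
     supremum norm. *)
  move=> y; rewrite ler_norml /jump_adjoint -[B]mulr1 -(K1 y) -mulNr -!expectZ//.
  have bKf := bounded_measurableM (bKy y) bf.
  have bcK c := bounded_measurableZ c (bKy y).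
  have hx x : - B * K x y <= K x y * f x <= B * K x y.
    by have := fB x; rewrite ler_norml => /andP[h1 h2]; have := K0 x y; nra.
  apply/andP; split.
    by apply: (le_expect _ (bcK _) bKf) => x; case/andP: (hx x).
  by apply: (le_expect _ bKf (bcK _)) => x; case/andP: (hx x).
- move=> A mA; rewrite jumpE// /Rintegral; congr fine.
  have mKA : measurable_fun setT (fun z : T * T => (K z.1 z.2 * \1_A z.1)%:E).
    apply/measurable_EFinP; apply: measurable_funM; first by case: bK.
    exact: (measurableT_comp (measurable_indic _) measurable_fst).
  rewrite (eq_integral (fun y => \int[l]_x (K x y * \1_A x)%:E))%E; last first.
    move=> y _; rewrite /jump_adjoint /Rintegral fineK//.
    apply: integrable_fin_num => //.
    apply: (@bounded_measurable_integrable _ _ _ l (fun x => K x y * \1_A x)).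
    apply: bounded_measurableM => //; split; first exact: measurable_indic.
    by exists 1 => x; rewrite indicE; case: (_ \in _); rewrite ?normr1 ?normr0.
  rewrite -(fubini_tonelli (m1 := l) (m2 := m) (fun z : T * T => (K z.1 z.2 * \1_A z.1)%:E))//; last first.
    by move=> z; rewrite lee_fin mulr_ge0.
  rewrite [RHS]integral_mkcond/=; apply: eq_integral => x _.
  rewrite patchE; case: ifPn => xA.
    by apply: eq_integral => y _; rewrite /= indicE xA mulr1.
  by rewrite integral0_eq// => y _ /=; rewrite indicE (negbTE xA) mulr0.
Qed.

(** Every pair of points has representatives in the unit cube, which is compact. *)
Lemma smooth2_bounded (K : T -> T -> R) : smooth2 K ->
  bounded_measurable (fun z : T * T => K z.1 z.2).
Proof.
move=> sK; split; first exact: smooth2_measurable.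
have [cK _] := sK 0%N; set F := (X in continuous X) in cK.
have cc : compact [set z : 'rV[R]_(d + d) | forall i, `[0, 1]%classic (z 0 i)].
  by apply: (@rV_compact R (d + d) (fun=> `[0, 1]%classic)) => i; exact: segment_compact.
have /compact_bounded [M [_ HM]] : compact (F @` [set z : 'rV[R]_(d + d) | forall i, `[0, 1]%classic (z 0 i)]).
  by apply: continuous_compact cc; exact: continuous_subspaceT.
exists (M + 1) => -[x y] /=; apply: (HM (M + 1)); first by rewrite ltrDl.
have [a a01 ax] := torus_surj x; have [b b01 by_] := torus_surj y.
exists (row_mx a b); last by rewrite /F row_mxKl row_mxKr ax by_.
move=> i; rewrite /= in_itv/= mxE; case: (fintype.split i) => j.
  by have := a01 j; lra.
by have := b01 j; lra.
Qed.

End torus_measures.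

Section convexity.
Context {R : realType} {n : nat}.

Lemma derive_dot (f : 'rV[R]_n -> R) (p v : 'rV[R]_n) : differentiable f p ->
  'D_v f p = \sum_(i < n) 'D_(delta_mx 0 i) f p * v 0 i.
Proof.
move=> df; rewrite deriveE// {1}(row_sum_delta v) linear_sum; apply: eq_bigr => i _.
by rewrite linearZ deriveE//= mulrC.
Qed.

(** In the direction q - p, convexity bounds the difference quotients with 0 < h <= 1 by f q - f
    p. *)
Lemma convex_tangent (f : 'rV[R]_n -> R) (p q : 'rV[R]_n) :
  convex_function (E := 'rV[R]_n) setT f -> differentiable f p ->
  f p + \sum_(i < n) 'D_(delta_mx 0 i) f p * (q - p) 0 i <= f q.
Proof.
move=> cf df; rewrite -derive_dot//.
have dv : derivable f p (q - p) by exact: diff_derivable.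
have c : h^-1 * (f (h *: (q - p) + p) - f p) @[h --> (0 : R)^'+] --> 'D_(q - p) f p.
  apply: cvg_trans dv; apply: cvg_app => A [e e0 H]; exists e => // h he h0.
  by apply: H => //; rewrite gt_eqF.
suff : 'D_(q - p) f p <= f q - f p by lra.
rewrite -(cvg_lim _ c)//; apply: limr_le; first by apply/cvg_ex; eexists; exact: c.
near=> h.
have h0 : 0 < h by near: h; exact: nbhs_right_gt.
have h1 : h <= 1 by near: h; exact: nbhs_right_le.
have := cf (Itv01 (ltW h0) h1) q p; rewrite !inE => /(_ I I) H.
have {}H : f (h *: q + (1 - h) *: p) <= h * f q + (1 - h) * f p by exact: H.
move: H; have -> : h *: q + (1 - h) *: p = h *: (q - p) + p.
  by rewrite scalerBl scale1r scalerBr addrCA addrC.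
move=> H; rewrite ler_pdivrMl//; lra.
Unshelve. all: end_near. Qed.

End convexity.

(** * Penalisation and existence of minima *)

Section penalty.
Context {R : realType} {d : nat}.
Local Notation T := (torus R d).
Local Notation P := (probability T R).

Lemma expect_gsum (m : P) (g : nat -> T -> R) : (forall n, bounded_measurable (g n)) ->
  (forall x, dominated (fun n => g n x)) -> measurable_fun setT (fun x => gsum (fun n => g n x)) ->
  \int[m]_x gsum (fun n => g n x) = gsum (fun n => \int[m]_x g n x).
Proof.
move=> bg dg mg.
have dI : dominated (fun n => \int[m]_x g n x).
  by move=> n; apply: norm_expect_le; [exact: (bg n).1|move=> x; exact: dg].
have bS N : bounded_measurable (fun x => series (fun n => g n x) N).
  elim: N => [|N IH].
    rewrite (_ : (fun x => _) = fun=> 0); first exact: bounded_measurable_cst.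
    by apply/funext => x; rewrite /series /= big_geq.
  rewrite (_ : (fun x => _) = fun x => series (fun n => g n x) N + g N x).
    exact: bounded_measurableD.
  by apply/funext => x; rewrite seriesSr.
have SE N : \int[m]_x series (fun n => g n x) N = series (fun n => \int[m]_x g n x) N.
  elim: N => [|N IH].
    rewrite [RHS]/series /= big_geq// -[RHS](expect_cst m); apply: eq_Rintegral => x _.
    by rewrite /series /= big_geq.
  rewrite seriesSr -IH -expectD//; apply: eq_Rintegral => x _.
  by rewrite seriesSr.
have c1 : \int[m]_x series (fun n => g n x) N @[N --> \oo] --> \int[m]_x gsum (fun n => g n x).
  apply: (@cvg_expect _ _ _ m _ _ 2) => //.
  - by move=> N; exact: (bS N).1.
  - move=> N x; rewrite /series /=; apply: le_trans (ler_norm_sum _ _ _) _.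
    apply: (@le_trans _ _ (series (fun n => 2^-1 ^+ n) N)).
      by apply: ler_sum => i _; exact: dg.
    by rewrite series_half; have := @half_ge0 R N; lra.
  - by apply: aeW => x; exact: dominated_cvg.
by rewrite (funext SE) in c1; exact/esym/cvg_lim.
Qed.

(* [Q] is a convex quadratic functional, [2 * k m0] its derivative at [m0]. *)
Definition penalty (Q : P -> R) (k : P -> T -> R) : Prop := [/\
  forall m, 0 <= Q m <= 2,
  forall m, torus_C 2 (k m),
  forall m x, (forall i, `|partial i (k m) x| <= 2) /\ `|laplacian (k m) x| <= 2 * d%:R,
  forall m m0 : P, let L := Q m0 + 2 * (\int[m]_x k m0 x - \int[m0]_x k m0 x) in
    L <= Q m /\ (~ same_measure m m0 -> L < Q m) &
  forall m_ m, skorokhod_cvg m_ m -> Q (m_ n) @[n --> \oo] --> Q m].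

(** Q m is the squared norm of the sequence of integrals of the e_n against m. The gap between Q and
    its linearisation is thus the squared distance of two such sequences, zero only if they agree.
    All bounds 2 are the sum of the 2^-n. *)
Lemma penalty_exists : exists Q k, penalty Q k.
Proof.
have [e [Ce de dpe dppe sep]] := @separating_sequence R d.
pose a (m : P) n := \int[m]_x e n x.
have be n : bounded_measurable (e n).
  exact: continuous_bounded_measurable (torus_C_continuous (Ce n)).
have da m : dominated (a m).
  by move=> n; apply: norm_expect_le; [exact: (be n).1|move=> x; exact: de].
have half1 n : 2^-1 ^+ n <= 1 :> R by apply: exprn_ile1; lra.
have daM m (y : nat -> R) : dominated y -> dominated (fun n => a m n * y n).
  move=> dy n; rewrite normrM; apply: le_trans (dy n).
  by rewrite ler_piMl// (le_trans (da m n)).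
have Cae m n : torus_C 2 (fun x => a m n * e n x) by exact: (class_C_Z (a m n) (Ce n)).
pose Q m := gsum (fun n => a m n * a m n).
pose k m x := gsum (fun n => a m n * e n x).
have pE m i n x : partial i (fun y => a m n * e n y) x = a m n * partial i (e n) x.
  exact: partialZ (Ce n).
have ppE m i j n x : partial i (partial j (fun y => a m n * e n y)) x = a m n * partial i (partial j (e n)) x.
  rewrite (_ : partial j _ = fun y => a m n * partial j (e n) y); last exact/funext.
  exact: partialZ (torus_C_partial j (Ce n)).
have dk m x : dominated (fun n => a m n * e n x) by exact: daM.
have dpk m i x : dominated (fun n => partial i (fun y => a m n * e n y) x).
  by move=> n; rewrite pE; exact: (daM m _ (dpe i x) n).
have dppk m i j x : dominated (fun n => partial i (partial j (fun y => a m n * e n y)) x).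
  by move=> n; rewrite ppE; exact: (daM m _ (dppe i j x) n).
have Ck m : torus_C 2 (k m) by exact: (torus_C2_gsum (Cae m) (dk m) (dpk m) (dppk m)).
have kE (m m0 : P) : \int[m]_x k m0 x = gsum (fun n => a m0 n * a m n).
  rewrite expect_gsum.
  - by congr gsum; apply/funext => n; rewrite expectZ.
  - by move=> n; exact: bounded_measurableZ.
  - exact: dk.
  - exact: continuous_measurable_torus (torus_C_continuous (Ck m0)).
exists Q, k; split=> //.
- move=> m; have dQ := daM m _ (da m); apply/andP; split.
    by apply: gsum_ge0 => // n; rewrite -expr2 sqr_ge0.
  by have := gsum_bound dQ; rewrite ler_norml => /andP[].
- move=> m x; have C1 n : torus_C 1 (fun x => a m n * e n x) by exact: torus_CW.
  have pk i : partial i (k m) = fun x => gsum (fun n => partial i (fun y => a m n * e n y) x).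
    by apply/funext => y; exact: (partial_gsum y C1 (dk m) (dpk m i)).
  split=> [i|]; first by rewrite pk; exact: gsum_bound.
  apply: le_trans (ler_norm_sum _ _ _) _.
  apply: (@le_trans _ _ (\sum_(i < d) 2)); last by rewrite sumr_const card_ord mulr_natr.
  apply: ler_sum => i _; rewrite pk.
  rewrite (partial_gsum x (fun n => torus_C_partial i (Cae m n)) (dpk m i) (dppk m i i)).
  by apply: gsum_bound; exact: dppk.
- move=> m m0; rewrite !kE /Q.
  have c : series (fun n => (a m n - a m0 n) ^+ 2) N @[N --> \oo] -->
      Q m - 2 * gsum (fun n => a m0 n * a m n) + Q m0.
    rewrite (_ : (fun N => _) = fun N => series (fun n => a m n * a m n) N
        - 2 * series (fun n => a m0 n * a m n) N + series (fun n => a m0 n * a m0 n) N).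
      apply: cvgD; [apply: cvgB; [|apply: cvgMr]|]; apply: dominated_cvg; exact: daM.
    apply/funext => N; rewrite /series /= mulr_sumr -sumrB -big_split.
    by apply: eq_bigr => i _ /=; ring.
  have ge_term n : (a m n - a m0 n) ^+ 2 <= Q m - 2 * gsum (fun n => a m0 n * a m n) + Q m0.
    rewrite -(cvg_lim _ c)//; apply: limr_ge; first by apply/cvg_ex; eexists; exact: c.
    exists n.+1 => // N /= nN; rewrite /series /= big_mkord (bigD1 (Ordinal nN))//=.
    by rewrite lerDl sumr_ge0// => i _; exact: sqr_ge0.
  rewrite /Q in ge_term.
  split=> [|nmm0]; first by have := ge_term 0%N; have := sqr_ge0 (a m 0%N - a m0 0%N); lra.
  have [n an] : exists n, a m n != a m0 n.
    apply: contrapT => H; apply: nmm0; apply: sep => n.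
    by apply: contrapT => an; apply: H; exists n; apply/eqP.
  have : 0 < (a m n - a m0 n) ^+ 2 by rewrite exprn_even_gt0//= subr_eq0.
  by have := ge_term n; lra.
- move=> m_ m mm; apply: gsum_cvg.
  + by move=> n; exact: daM.
  + exact: daM.
  + move=> n; have : a (m_ i) n @[i --> \oo] --> a m n.
      apply: (@skorokhod_expect _ _ _ _ (fun=> e n) _ (2^-1 ^+ n) mm) => //.
      * by move=> _; exact: (be n).1.
      * exact: (be n).1.
      * by move=> _ x; exact: de.
      * move=> x y xy.
        have ce : continuous (fun z => e n (to_torus z)).
          exact: class_C_continuous (Ce n).
        exact: (continuous_cvg _ (ce y) xy).
    by move=> h; exact: cvgM.
Qed.

End penalty.

Section value_functions.
Context {R : realType} {d : nat}.
Local Notation T := (torus R d).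
Local Notation P := (probability T R).
Implicit Types U V : R -> T -> P -> R.

Lemma sup_norm_ge (g : T -> R) x : (`|g x|%:E <= sup_norm g)%E.
Proof. by apply: ereal_sup_ubound; exists x. Qed.

Lemma sup_norm_ge0 (g : T -> R) : (0 <= sup_norm g)%E.
Proof. by apply: le_trans (sup_norm_ge g point); rewrite lee_fin. Qed.

(** The bound on first derivatives confines the momenta to a compact set, where [momentum_bounded]
    controls the drift. *)
Lemma Bt_bounded U (S : R) : space_Bt U -> 0 < S -> exists2 B, 0 <= B &
  forall (t : R) (m : P) (x : T), 0 <= t <= S -> `|U t x m| <= B /\ forall i, `|partial i (fun y => U t y m) x| <= B.
Proof.
move=> [_ _ /(_ S) H] S0; have {}H := H S0; set s := ereal_sup _ in H.
have sE (t : R) (m : P) : 0 <= t <= S -> (C2_norm (fun y => U t y m) <= s)%E.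
  by move=> tS; apply: ereal_sup_ubound; exists (t, m).
have P1 (g : T -> R) : (0 <= \sum_(i < d) sup_norm (partial i g))%E.
  by apply: sume_ge0 => i _; exact: sup_norm_ge0.
have P2 (g : T -> R) : (0 <= \sum_(i < d) \sum_(j < d) sup_norm (partial i (partial j g)))%E.
  by apply: sume_ge0 => i _; apply: sume_ge0 => j _; exact: sup_norm_ge0.
have n0 (g : T -> R) : (sup_norm g <= C2_norm g)%E.
  by rewrite /C2_norm -addeA leeDl// adde_ge0.
have n1 (g : T -> R) i : (sup_norm (partial i g) <= C2_norm g)%E.
  rewrite /C2_norm; apply: (@le_trans _ _ (\sum_(i < d) sup_norm (partial i g))%E).
    rewrite (bigD1 i)//= leeDl//; apply: sume_ge0 => j _; exact: sup_norm_ge0.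
  apply: (@le_trans _ _ (sup_norm g + \sum_(i0 < d) sup_norm (partial i0 g))%E).
    by rewrite leeDr// sup_norm_ge0.
  by rewrite leeDl.
have s0 : (0 <= s)%E.
  by apply: le_trans (sE 0 (torus_lebesgue R d) _); [apply: le_trans (sup_norm_ge0 _) (n0 _)|rewrite lexx ltW].
have sF : s = (fine s)%:E by rewrite fineK// ge0_fin_numE.
exists (fine s); first exact: fine_ge0.
move=> t m x tS; split=> [|i]; rewrite -lee_fin -sF; apply: le_trans (sE t m tS).
  by apply: le_trans (n0 _); exact: (sup_norm_ge (fun y => U t y m)).
by apply: le_trans (n1 _ i); exact: sup_norm_ge.
Qed.

Lemma Bt_continuous U (t : R) (m : P) : space_Bt U -> 0 <= t -> continuous (fun x => U t x m).
Proof. by move=> [_ C _] t0; exact: torus_C_continuous (C t m t0). Qed.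

Lemma continuous_txm_seq U (t_ : nat -> R) (t : R) (m_ : nat -> P) (m : P)
    (x_ : nat -> 'rV[R]_d) (y : 'rV[R]_d) :
  continuous_txm U -> (forall n, 0 <= t_ n) -> 0 <= t -> t_ n @[n --> \oo] --> t ->
  skorokhod_cvg m_ m -> x_ n @[n --> \oo] --> y ->
  U (t_ n) (to_torus (x_ n)) (m_ n) @[n --> \oo] --> U t (to_torus y) m.
Proof.
move=> cU tn0 t0 tt mm xy; apply/cvgrPdist_lt => e e0.
have [r r0 H] := cU t (to_torus y) m e t0 e0.
have h1 := skorokhod_wasserstein1 mm r0.
have /cvgrPdist_lt /(_ r r0) h2 := tt.
have h3 : \forall n \near \oo, euclid (y - x_ n) < r.
  have : euclid (y - x_ n) @[n --> \oo] --> euclid (y - y).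
    apply: (continuous_cvg _ (@continuous_euclid R d (y - y))).
    by apply: cvgB => //; exact: cvg_cst.
  move=> /(cvgr_lt _); apply.
  by rewrite subrr /euclid /dot big1 ?sqrtr0// => i _; rewrite mxE mul0r.
near=> n; apply: H => //.
- by near: n.
- apply: le_lt_trans (torus_dist_le _ _) _; by near: n.
- by near: n.
Unshelve. all: end_near. Qed.

(** U is taken at its own time and measure (t, m), V at (s, n). With V = U and s = t, non-negativity
    is the monotonicity of U(t). *)
Definition pairing (U V : R -> T -> P -> R) (t s : R) (m n : P) : R :=
  \int[m]_x (U t x m - V s x n) - \int[n]_x (U t x m - V s x n).

Lemma pairing_cvg U V (t_ s_ : nat -> R) (t s : R) (m_ n_ : nat -> P) (m n : P) (S : R) :
  space_Bt U -> space_Bt V -> 0 < S ->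
  (forall k, 0 <= t_ k <= S) -> (forall k, 0 <= s_ k <= S) -> 0 <= t <= S -> 0 <= s <= S ->
  t_ k @[k --> \oo] --> t -> s_ k @[k --> \oo] --> s ->
  skorokhod_cvg m_ m -> skorokhod_cvg n_ n ->
  pairing U V (t_ k) (s_ k) (m_ k) (n_ k) @[k --> \oo] --> pairing U V t s m n.
Proof.
move=> BU BV S0 t_S s_S tS sS tt ss mm nn.
have [B B0 HB] := Bt_bounded BU S0; have [C C0 HC] := Bt_bounded BV S0.
have cD (t' s' : R) (m' n' : P) : 0 <= t' -> 0 <= s' -> continuous (fun x => U t' x m' - V s' x n').
  by move=> t'0 s'0 x; apply: continuousB; exact: Bt_continuous.
have H (p_ : nat -> P) p : skorokhod_cvg p_ p ->
    \int[p_ k]_x (U (t_ k) x (m_ k) - V (s_ k) x (n_ k)) @[k --> \oo]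
    --> \int[p]_x (U t x m - V s x n).
  move=> pp; apply: (@skorokhod_expect _ _ _ _ (fun k x => U (t_ k) x (m_ k) - V (s_ k) x (n_ k)) _ (B + C) pp).
  - move=> k; apply: continuous_measurable_torus; apply: cD.
      by case/andP: (t_S k).
    by case/andP: (s_S k).
  - by apply: continuous_measurable_torus; apply: cD; [case/andP: tS|case/andP: sS].
  - move=> k x; apply: le_trans (ler_normB _ _) _; apply: lerD.
      exact: (HB _ _ _ (t_S k)).1.
    exact: (HC _ _ _ (s_S k)).1.
  - move=> x y xy; case: BU => cU _ _; case: BV => cV _ _.
    apply: cvgB; apply: continuous_txm_seq => //; try by case/andP: tS.
    + by move=> k; case/andP: (t_S k).
    + by move=> k; case/andP: (s_S k).
    + by case/andP: sS.
by apply: cvgB; exact: H.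
Qed.

Lemma pairing_bounded U V (S : R) : space_Bt U -> space_Bt V -> 0 < S ->
  exists2 B, 0 <= B & forall (t s : R) (m n : P), 0 <= t <= S -> 0 <= s <= S -> `|pairing U V t s m n| <= B.
Proof.
move=> BU BV S0.
have [B B0 HB] := Bt_bounded BU S0; have [C C0 HC] := Bt_bounded BV S0.
exists (2 * (B + C)); first by lra.
move=> t s m n tS sS.
have H (p : P) : `|\int[p]_x (U t x m - V s x n)| <= B + C.
  apply: norm_expect_le.
    apply: continuous_measurable_torus => x; apply: continuousB; apply: Bt_continuous => //.
      by case/andP: tS.
    by case/andP: sS.
  move=> x; apply: le_trans (ler_normB _ _) _; apply: lerD.
    exact: (HB _ _ _ tS).1.
  exact: (HC _ _ _ sS).1.
apply: le_trans (ler_normB _ _) _.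
by have := H m; have := H n; lra.
Qed.

Lemma pairing_sym U V (t s : R) (m n : P) : space_Bt U -> space_Bt V -> 0 <= t -> 0 <= s ->
  pairing U V t s m n = pairing V U s t n m.
Proof.
move=> BU BV t0 s0; rewrite /pairing.
have bU (p : P) : bounded_measurable (fun x => U t x p) by apply: continuous_bounded_measurable; exact: Bt_continuous.
have bV (p : P) : bounded_measurable (fun x => V s x p) by apply: continuous_bounded_measurable; exact: Bt_continuous.
by rewrite !expectB//; ring.
Qed.

(* Sequential compactness of the set of probability measures replaces the
   compactness of the minimisation domain. *)
Lemma attained_minimum (S : R) (G : R -> R -> P -> P -> R) (B : R) : 0 <= S ->
  (forall (t s : R) (m n : P), 0 <= t <= S -> 0 <= s <= S -> B <= G t s m n) ->
  (forall (t_ s_ : nat -> R) (t s : R) (m_ n_ : nat -> P) (m n : P),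
    (forall k, 0 <= t_ k <= S) -> (forall k, 0 <= s_ k <= S) -> 0 <= t <= S -> 0 <= s <= S ->
    t_ k @[k --> \oo] --> t -> s_ k @[k --> \oo] --> s ->
    skorokhod_cvg m_ m -> skorokhod_cvg n_ n ->
    G (t_ k) (s_ k) (m_ k) (n_ k) @[k --> \oo] --> G t s m n) ->
  exists (t0 s0 : R) (m0 n0 : P), [/\ 0 <= t0 <= S, 0 <= s0 <= S &
    forall (t s : R) (m n : P), 0 <= t <= S -> 0 <= s <= S -> G t0 s0 m0 n0 <= G t s m n].
Proof.
move=> S0 GB Gc.
pose A : set R := [set r | exists (t s : R) (m n : P), [/\ 0 <= t <= S, 0 <= s <= S & r = G t s m n]].
have Alb : has_inf A.
  split; last by exists B => _ [t [s [m [n [tS sS ->]]]]]; exact: GB.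
  exists (G 0 0 (torus_lebesgue R d) (torus_lebesgue R d)).
  by exists 0, 0, (torus_lebesgue R d), (torus_lebesgue R d); rewrite lexx S0.
have /boolp.choice[z zP] : forall k : nat, exists z : (R * R) * (P * P),
    [/\ 0 <= z.1.1 <= S, 0 <= z.1.2 <= S & G z.1.1 z.1.2 z.2.1 z.2.2 < inf A + k.+1%:R^-1].
  move=> k; have [|_ [t [s [m [n [tS sS ->]]]]] H] := @inf_adherent _ A k.+1%:R^-1 _ Alb.
    by rewrite invr_gt0.
  by exists ((t, s), (m, n)).
have zt k : 0 <= (z k).1.1 <= S by case: (zP k).
have zs k : 0 <= (z k).1.2 <= S by case: (zP k).
have [kappa [t0 [s0 [m0 [n0 [kn t0S s0S [ct cs cm cn]]]]]]] :=
  skorokhod_compactness (fun k => (z k).2.1) (fun k => (z k).2.2) zt zs.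
exists t0, s0, m0, n0; split=> // t s m n tS sS.
apply: (@le_trans _ _ (inf A)); last by apply: ge_inf; [exact: Alb.2|exists t, s, m, n].
have c := Gc _ _ _ _ _ _ _ _ (fun k => zt (kappa k)) (fun k => zs (kappa k)) t0S s0S ct cs cm cn.
have c2 : inf A + n.+1%:R^-1 @[n --> \oo] --> inf A + 0.
  by apply: cvgD; [exact: cvg_cst|exact: cvg_harmonic].
rewrite -[leRHS]addr0; apply: (ler_cvg_to c c2); apply: nearW => k.
have [_ _ /ltW h] := zP (kappa k); apply: le_trans h _.
by rewrite lerD2l lef_pV2 ?posrE// ler_nat ltnS.
Qed.

End value_functions.

(** * The inequality at a minimum *)

Section continuity.
Context {R : realType} {d : nat}.
Local Notation T := (torus R d).
Local Notation P := (probability T R).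

Lemma momentum_bounded (H : T -> 'rV[R]_d -> R) (B : R) : C1_momentum H ->
  exists2 C : R, 0 <= C & forall (x : T) (p : 'rV[R]_d), (forall i, `|p 0 i| <= B) ->
    forall i, `|momentum_grad H x p 0 i| <= C.
Proof.
move=> [_ _ cG].
have cc : compact ([set: T] `*` [set p : 'rV[R]_d | forall i, `[- B, B]%classic (p 0 i)]).
  apply: compact_setX; first exact: torus_compact.
  by apply: (@rV_compact R d (fun=> `[- B, B]%classic)) => i; exact: segment_compact.
have /boolp.choice[c cP] : forall i : 'I_d, exists c : R, forall (x : T) (p : 'rV[R]_d), (forall j, `|p 0 j| <= B) ->
    `|momentum_grad H x p 0 i| <= c.
  move=> i; pose F z := momentum_grad H z.1 z.2 0 i.
  have cF : continuous F.
    move=> z; apply: (@continuous_comp _ _ _ (fun z => momentum_grad H z.1 z.2) (fun p : 'rV[R]_d => p 0 i)).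
    exact: cG.
  exact: coord_continuous.
  have /compact_bounded [M [_ HM]] := continuous_compact (continuous_subspaceT cF) cc.
  exists (M + 1) => x p pB; apply: (HM (M + 1)); first by rewrite ltrDl.
  by exists (x, p) => //; split=> // j; rewrite /= in_itv/= -ler_norml.
exists (\sum_i `|c i|) => [|x p pB i]; first exact: sumr_ge0.
apply: le_trans (cP i x p pB) _; apply: le_trans (ler_norm _) _.
by rewrite (bigD1 i)//= lerDl sumr_ge0.
Qed.

Lemma Bt_C2 (U : R -> T -> P -> R) (t : R) (m : P) : space_Bt U -> 0 <= t ->
  torus_C 2 (fun x => U t x m).
Proof. by move=> [_ + _] t0; apply. Qed.

Lemma continuous_hamiltonian (H : T -> 'rV[R]_d -> R) (g : T -> R) :
  C1_momentum H -> torus_C 2 g -> continuous (fun x => H x (grad g x)).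
Proof.
move=> [cH _ _] Cg x.
apply: (@continuous_comp _ _ _ (fun x => (x, grad g x)) (fun z => H z.1 z.2)); last exact: cH.
by apply: (cvg_pair (F := nbhs x) (G := nbhs x) (H := nbhs (grad g x))) => //; exact: (continuous_grad Cg).
Qed.

Lemma continuous_drift (H : T -> 'rV[R]_d -> R) (g : T -> R) :
  C1_momentum H -> torus_C 2 g -> continuous (fun x => momentum_grad H x (grad g x)).
Proof.
move=> [_ _ cH] Cg x.
apply: (@continuous_comp _ _ _ (fun x => (x, grad g x)) (fun z => momentum_grad H z.1 z.2)); last exact: cH.
by apply: (cvg_pair (F := nbhs x) (G := nbhs x) (H := nbhs (grad g x))) => //; exact: (continuous_grad Cg).
Qed.

Lemma continuous_xm_fst (f : T -> P -> R) (m : P) : continuous_xm f -> continuous (fun x => f x m).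
Proof.
move=> cf; apply/continuous_lift => a.
apply/(@cvgrPdist_lt _ _ _ (nbhs (a : 'rV[R]_d))) => e e0.
have [r r0 H] := cf (to_torus a) m e e0.
have h : \forall y \near a, euclid (a - y) < r.
  have ce : continuous (fun y : 'rV[R]_d => euclid (a - y)).
    move=> z; apply: (@continuous_comp _ _ _ (fun y : 'rV[R]_d => a - y) euclid).
      by apply: continuousB => //; exact: cst_continuous.
    exact: continuous_euclid.
  apply: (@cvgr_lt _ _ (nbhs (a : 'rV[R]_d)) _ _ _ (ce a)).
  by rewrite subrr /euclid /dot big1 ?sqrtr0// => i _; rewrite mxE mul0r.
near=> y; apply: H.
- apply: le_lt_trans (torus_dist_le _ _) _; by near: y.
- exact: wasserstein1_same.
Unshelve. all: end_near. Qed.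

(** The part 2 eps k of the test function costs at most 2 eps d (2 C) in the drift term X and 2 eps
    sigma (2 d) in the Laplacian term Y. *)
Lemma penalty_error (sigma eps C F D D' L L' X Y r : R) : 0 < sigma -> 0 < eps ->
  `|X| <= d%:R * (2 * C) -> `|Y| <= 2 * d%:R ->
  D' = D - 2 * eps * X -> L' = L - 2 * eps * Y -> F + D' - sigma * L' <= r ->
  F + D - sigma * L - eps * (4 * d%:R * (C + sigma)) <= r.
Proof.
move=> sigma0 eps0; rewrite !ler_norml => /andP[Y1 Y2] /andP[X1 X2] -> ->.
have : 2 * eps * X <= 2 * eps * (d%:R * (2 * C)) by rewrite ler_pM2l//; lra.
have : 2 * eps * sigma * - (2 * d%:R) <= 2 * eps * sigma * Y.
  by rewrite ler_pM2l ?mulr_gt0//; lra.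
lra.
Qed.

(** The times are the same on both sides, so their contributions cancel; each sum of two values of Q
    lies between 0 and 4. *)
Lemma penalty_gap (eps a a' b c q1 q2 q3 q4 p p' : R) : 0 < eps ->
  0 <= q1 <= 2 -> 0 <= q2 <= 2 -> 0 <= q3 <= 2 -> 0 <= q4 <= 2 ->
  p + a + a' - eps * (q1 + q2 + b + c) <= p' + a + a' - eps * (q3 + q4 + b + c) -> p <= p' + 4 * eps.
Proof.
move=> eps0 /andP[_ q12] /andP[_ q22] /andP[q30 _] /andP[q40 _] h.
have : eps * (q1 + q2 + b + c) <= eps * (4 + q3 + q4 + b + c) by rewrite ler_pM2l//; lra.
have : 0 <= eps * (q3 + q4) by rewrite mulr_ge0 ?addr_ge0// ltW.
move: h; lra.
Qed.

(** In [Lum], [Hum], [um] and [jum], u names the solution and the last letter the integrating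
    measure, which for j is the image under the jump; [fmn] is the integral of f(., m) against n. In
    the sum of the first two inequalities alpha and the L terms cancel, and dividing by 2 gives the
    bound. *)
Lemma doubling_algebra (sigma lambda eps alpha gamma S E t0 s0 Lum Lun Lvm Lvn Hum Hun Hvm Hvn
    um un vm vn jum jun jvm jvn fmm fmn fnm fnn D1 D2 : R) :
  0 < lambda -> 0 < eps -> t0 <= S -> s0 <= S ->
  fmm - fmn + D1 - sigma * (Lum - Lvm) - E <= - 2 * alpha * (t0 - s0) - gamma + 2 * eps * t0
    + ((- sigma * Lum + Hum + lambda * (um - jum)) - (- sigma * Lun + Hun + lambda * (un - jun))) ->
  fnn - fnm + D2 - sigma * (Lvn - Lun) - E <= - 2 * alpha * (s0 - t0) - gamma + 2 * eps * s0
    + ((- sigma * Lvn + Hvn + lambda * (vn - jvn)) - (- sigma * Lvm + Hvm + lambda * (vm - jvm))) ->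
  0 <= (fmm - fnm) - (fmn - fnn) -> Hum - Hvm <= D1 -> Hvn - Hun <= D2 ->
  (um - vm) - (un - vn) <= (jum - jvm) - (jun - jvn) + 4 * eps ->
  gamma <= eps * (2 * S + 2 * lambda) + E.
Proof.
move=> l0 e0 tS sS h1 h2 hf hH1 hH2 hj.
have : lambda * ((um - vm) - (un - vn)) <= lambda * ((jum - jvm) - (jun - jvn) + 4 * eps).
  by rewrite ler_pM2l.
have : eps * t0 <= eps * S by rewrite ler_pM2l.
have : eps * s0 <= eps * S by rewrite ler_pM2l.
clear tS sS l0 e0 hj; lra.
Qed.

Lemma smooth_on_line_horner (p : {poly R}) : smooth_on_line (horner p).
Proof.
move=> n; elim: n p => [|n IH] p t; first exact: derivable_horner.
by rewrite derive1Sn -derivE; exact: IH.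
Qed.

Lemma norm_dot_le (p q : 'rV[R]_d) (B C : R) : (forall i, `|p 0 i| <= B) ->
  (forall i, `|q 0 i| <= C) -> `|dot p q| <= d%:R * (B * C).
Proof.
move=> pB qC; apply: le_trans (ler_norm_sum _ _ _) _.
rewrite mulr_natl -[in leRHS](card_ord d) -sumr_const; apply: ler_sum => i _.
by rewrite normrM; apply: ler_pM.
Qed.

Lemma dotBl (p q r : 'rV[R]_d) : dot (p - q) r = dot p r - dot q r.
Proof. by rewrite /dot -sumrB; apply: eq_bigr => i _; rewrite !mxE mulrBl. Qed.

Lemma dotZl (c : R) (p q : 'rV[R]_d) : dot (c *: p) q = c * dot p q.
Proof. by rewrite /dot mulr_sumr; apply: eq_bigr => i _; rewrite !mxE mulrA. Qed.

End continuity.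

Section comparison.
Context {R : realType} {d : nat}.
Local Notation T := (torus R d).
Local Notation P := (probability T R).
Context (sigma lambda : R) (K : T -> T -> R) (H : T -> 'rV[R]_d -> R) (f U0 : T -> P -> R).
Context (sigma0 : 0 < sigma) (lambda0 : 0 < lambda) (sK : smooth2 K)
  (K0 : forall x y, 0 <= K x y)
  (K1 : forall y, \int[torus_lebesgue R d]_x K x y = 1)
  (C1H : C1_momentum H) (cvxH : convex_momentum H) (cf : continuous_xm f)
  (mf : monotone_xm f).
Local Notation solution := (monotone_solution sigma lambda K H f U0).
Context (Q : P -> R) (k : P -> T -> R) (Qk : penalty Q k).

Let residual (U : R -> T -> P -> R) (t : R) (m : P) (x : T) : R :=
  - sigma * laplacian (fun y => U t y m) x + H x (grad (fun y => U t y m) x)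
  + lambda * (U t x m - jump_adjoint K (fun y => U t y (jump K m)) x).

(* The test function is v + 2 e k_(m0): the penalty e (Q m + t^2) is replaced by
   its linearisation at (t0, m0), which turns the minimum into a strict one. *)
Lemma solution_at_minimum (U : R -> T -> P -> R) (v : T -> R) (n0 : P) (th : {poly R})
    (eps S t0 C : R) (m0 : P) :
  let u : T -> R := fun x => U t0 x m0 in
  let b : T -> 'rV[R]_d := fun x => momentum_grad H x (grad u x) in
  let J (t : R) (m : P) := \int[m]_x (U t x m - v x) - \int[n0]_x (U t x m - v x)
       - th.[t] - eps * (Q m + t ^+ 2) in
  solution U -> torus_C 2 v -> 0 < eps -> 0 < S -> 0 < t0 <= S ->
  (forall (t : R) (m : P), 0 <= t <= S -> J t0 m0 <= J t m) ->
  (forall x i, `|b x 0 i| <= C) ->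
  \int[m0]_x f x m0 - \int[n0]_x f x m0
    + \int[m0]_x dot (grad (fun y => u y - v y) x) (b x)
    - sigma * (\int[m0]_x laplacian u x - \int[m0]_x laplacian v x)
    - eps * (4 * d%:R * (C + sigma))
  <= (th^`()).[t0] + 2 * eps * t0
     + (\int[m0]_x residual U t0 m0 x - \int[n0]_x residual U t0 m0 x).
Proof.
move=> u b J solU Cv eps0 S0 t0S minJ bC.
have [BU _ /(_ (fun x => v x + 2 * eps * k m0 x) (charge_of_finite_measure n0)
  (horner (th + (2 * eps * t0) *: 'X)) S t0 m0)] := solU.
have [Q02 Ck kb Qmin _] := Qk.
have Cu : torus_C 2 u by apply: (Bt_C2 m0 BU); case/andP: t0S => /ltW.
have Cvk : torus_C 2 (fun x => v x + 2 * eps * k m0 x).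
  exact: (class_C_D Cv (class_C_Z (2 * eps) (Ck m0))).
have bcont (g : T -> R) : continuous g -> bounded_measurable g.
  exact: continuous_bounded_measurable.
have bk : bounded_measurable (k m0) by apply: bcont; exact: torus_C_continuous (Ck m0).
have bv : bounded_measurable v by apply: bcont; exact: torus_C_continuous Cv.
move=> /(_ Cvk (@smooth_on_line_horner _ _) S0 t0S).
have smin : strict_min (fun t m => pairing_sub (fun x => U t x m - (v x + 2 * eps * k m0 x)) m
    (charge_of_finite_measure n0) - (th + (2 * eps * t0) *: 'X).[t]) S t0 m0.
  (* Completing the square: up to a constant, the tested functional is J plus eps times the gap of Q
     above its linearisation at m0 and (t - t0)^2. This extra term vanishes only at (t0, m0), which
     gives strictness. *)
  have JE (t : R) (m : P) : 0 <= t -> pairing_sub (fun x => U t x m - (v x + 2 * eps * k m0 x)) m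
      (charge_of_finite_measure n0) - (th + (2 * eps * t0) *: 'X).[t] =
      J t m + eps * (Q m - 2 * \int[m]_x k m0 x + (t - t0) ^+ 2 - t0 ^+ 2
        + 2 * \int[n0]_x k m0 x).
    move=> tge0; rewrite pairing_sub_probability !hornerE.
    have bU : bounded_measurable (fun x => U t x m) by apply: bcont; exact: Bt_continuous.
    have bkk := bounded_measurableZ (2 * eps) bk.
    rewrite !(expectB _ bU (bounded_measurableD bv bkk)) !(expectD _ bv bkk) !(expectZ _ _ bk).
    by rewrite /J !expectB//; ring.
  have t00 : 0 <= t0 by case/andP: t0S => /ltW.
  move=> t m tS neq; have tge0 : 0 <= t by case/andP: tS.
  rewrite !JE// ler_ltD ?minJ// ltr_pM2l// subrr expr0n/= addr0.
  have [q1 q2] := Qmin m m0; have := sqr_ge0 (t - t0).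
  case: neq => [tt0|/q2]; last by lra.
  have : 0 < (t - t0) ^+ 2 by rewrite exprn_even_gt0//= subr_eq0; exact/eqP.
  by lra.
move=> /(_ smin) /=; rewrite -/u -/b.
rewrite -derivE derivD derivZ derivX hornerD hornerZ hornerC mulr1.
rewrite !pairing_sub_probability /pairing_div /pairing_laplacian opprK.
have bdot (g : T -> R) : torus_C 2 g -> bounded_measurable (fun x => dot (grad g x) (b x)).
  move=> Cg; apply: bcont; apply: continuous_dot; first exact: (continuous_grad Cg).
  exact: (continuous_drift C1H Cu).
have blap (g : T -> R) : torus_C 2 g -> bounded_measurable (laplacian g).
  by move=> Cg; apply: bcont; exact: continuous_laplacian.
have Cw : torus_C 2 (fun x => u x - v x) by exact: (class_C_B Cu Cv).
have wE : (fun x => u x - (v x + 2 * eps * k m0 x)) = (fun x => (u x - v x) - 2 * eps * k m0 x).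
  by apply/funext => x; rewrite opprD addrA.
rewrite wE.
have CZk : torus_C 2 (fun x => 2 * eps * k m0 x) by exact: (class_C_Z (2 * eps) (Ck m0)).
have e1 : \int[m0]_x dot (grad (fun y => (u y - v y) - 2 * eps * k m0 y) x) (b x) =
    \int[m0]_x dot (grad (fun y => u y - v y) x) (b x)
    - 2 * eps * \int[m0]_x dot (grad (k m0) x) (b x).
  rewrite -(expectZ _ _ (bdot _ (Ck m0))) -(expectB _ (bdot _ Cw) (bounded_measurableZ _ (bdot _ (Ck m0)))).
  apply: eq_Rintegral => x _.
  by rewrite (gradB _ Cw CZk) (gradZ _ _ (Ck m0)) dotBl dotZl.
have e2 : \int[m0]_x laplacian (fun y => (u y - v y) - 2 * eps * k m0 y) x =
    (\int[m0]_x laplacian u x - \int[m0]_x laplacian v x) - 2 * eps * \int[m0]_x laplacian (k m0) x.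
  have bl := blap _ Cu; have bl' := blap _ Cv; have blk := blap _ (Ck m0).
  rewrite -(expectZ _ _ blk) -(expectB _ bl bl').
  rewrite -(expectB _ (bounded_measurableB bl bl') (bounded_measurableZ _ blk)).
  apply: eq_Rintegral => x _.
  by rewrite (laplacianB _ Cw CZk) (laplacianB _ Cu Cv) (laplacianZ _ _ (Ck m0)).
have dotB : `|\int[m0]_x dot (grad (k m0) x) (b x)| <= d%:R * (2 * C).
  apply: norm_expect_le; first by case: (bdot _ (Ck m0)).
  by move=> x; apply: norm_dot_le => i; [rewrite mxE; exact: (kb m0 x).1|exact: bC].
have lapB : `|\int[m0]_x laplacian (k m0) x| <= 2 * d%:R.
  apply: norm_expect_le; first by case: (blap _ (Ck m0)).
  by move=> x; exact: (kb m0 x).2.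
exact: (penalty_error sigma0 eps0 dotB lapB e1 e2).
Qed.

(** Through [expect_jump] the non-local term becomes an integral at jumped measures, comparable with
    the value of the doubled functional there. *)
Lemma expect_residual (U : R -> T -> P -> R) (t : R) (m p : P) : space_Bt U -> 0 <= t ->
  \int[p]_x residual U t m x =
    - sigma * \int[p]_x laplacian (fun y => U t y m) x
    + \int[p]_x H x (grad (fun y => U t y m) x)
    + lambda * (\int[p]_x U t x m - \int[jump K p]_x U t x (jump K m)).
Proof.
move=> BU t0; have bcont (g : T -> R) : continuous g -> bounded_measurable g.
  exact: continuous_bounded_measurable.
have Cu := Bt_C2 m BU t0.
have bK := smooth2_bounded sK.
have bu (q : P) : bounded_measurable (fun x => U t x q) by apply: bcont; exact: Bt_continuous.
have bl := bcont _ (continuous_laplacian Cu).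
have bH := bcont _ (continuous_hamiltonian C1H Cu).
have bj := jump_adjoint_bounded_measurable bK (bu (jump K m)).
rewrite -(expect_jump p sK K0 K1 bK (bu _)) -(expectB _ (bu m) bj) -!expectZ//; last first.
  exact: bounded_measurableB.
have bl' := bounded_measurableZ (- sigma) bl.
have bj' := bounded_measurableZ lambda (bounded_measurableB (bu m) bj).
by rewrite -(expectD _ bl' bH) -(expectD _ (bounded_measurableD bl' bH) bj').
Qed.

(** Tangent inequality for H(x, .) at the momentum of u, evaluated at the momentum of v. *)
Lemma convex_drift (u v : T -> R) (p : P) : torus_C 2 u -> torus_C 2 v ->
  \int[p]_x H x (grad u x) - \int[p]_x H x (grad v x) <=
  \int[p]_x dot (grad (fun y => u y - v y) x) (momentum_grad H x (grad u x)).
Proof.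
move=> Cu Cv; have bcont (g : T -> R) : continuous g -> bounded_measurable g.
  exact: continuous_bounded_measurable.
have bHu := bcont _ (continuous_hamiltonian C1H Cu).
have bHv := bcont _ (continuous_hamiltonian C1H Cv).
have Cw : torus_C 2 (fun y => u y - v y) by exact: (class_C_B Cu Cv).
rewrite -(expectB _ bHu bHv); apply: le_expect; first exact: bounded_measurableB.
  apply: bcont; apply: continuous_dot; first exact: (continuous_grad Cw).
  exact: (continuous_drift C1H Cu).
move=> x; have [_ dH _] := C1H; have := convex_tangent (grad v x) (cvxH x) (dH x (grad u x)).
rewrite (_ : \sum_(i < d) _ = - dot (grad (fun y => u y - v y) x) (momentum_grad H x (grad u x))).
  by lra.
rewrite (gradB _ Cu Cv) /dot -sumrN; apply: eq_bigr => i _.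
by rewrite !mxE; ring.
Qed.

(** Freezing (s, n) leaves a minimum for U with v as test function, freezing (t, m) one for V with
    u. The bound does not involve alpha, which is then free to grow. *)
Lemma interior_minimum (U V : R -> T -> P -> R) (t0 s0 : R) (m0 n0 : P) (eps S C alpha gamma : R) :
  let G (t s : R) (m n : P) := pairing U V t s m n + alpha * (t - s) ^+ 2 + gamma * (t + s)
        - eps * (Q m + Q n + t ^+ 2 + s ^+ 2) in
  solution U -> solution V -> 0 < eps -> 0 < S -> 0 < t0 <= S -> 0 < s0 <= S ->
  (forall (t s : R) (m n : P), 0 <= t <= S -> 0 <= s <= S -> G t0 s0 m0 n0 <= G t s m n) ->
  (forall x i, `|momentum_grad H x (grad (fun y => U t0 y m0) x) 0 i| <= C) ->
  (forall x i, `|momentum_grad H x (grad (fun y => V s0 y n0) x) 0 i| <= C) ->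
  gamma <= eps * (2 * S + 2 * lambda) + eps * (4 * d%:R * (C + sigma)).
Proof.
move=> G solU solV eps0 S0 t0S s0S minG bU bV.
have [BU _ _] := solU; have [BV _ _] := solV.
have t00 : 0 <= t0 by case/andP: t0S => /ltW.
have s00 : 0 <= s0 by case/andP: s0S => /ltW.
have t0S' : 0 <= t0 <= S by rewrite t00; case/andP: t0S.
have s0S' : 0 <= s0 <= S by rewrite s00; case/andP: s0S.
pose u x := U t0 x m0; pose v x := V s0 x n0.
have Cu : torus_C 2 u := Bt_C2 m0 BU t00.
have Cv : torus_C 2 v := Bt_C2 n0 BV s00.
(* The opposite of the terms of G in the free time t, the other time being frozen at s. *)
pose th (s : R) : {poly R} := - (alpha *: 'X^2) + (2 * alpha * s - gamma) *: 'X - (alpha * s ^+ 2)%:P.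
have thE (s t : R) : (th s).[t] = - (alpha * (t - s) ^+ 2 + gamma * t).
  by rewrite /th !(hornerD, hornerN, hornerZ, hornerXn, hornerX, hornerC); ring.
have dthE (s t : R) : ((th s)^`()).[t] = - 2 * alpha * (t - s) - gamma.
  rewrite /th derivB derivD derivN derivZ derivXn derivZ derivX derivC.
  by rewrite !(hornerD, hornerN, hornerZ, hornerMn, hornerXn, hornerX, hornerC) /= expr1; ring.
have min1 (t : R) (m : P) : 0 <= t <= S ->
    \int[m0]_x (U t0 x m0 - v x) - \int[n0]_x (U t0 x m0 - v x) - (th s0).[t0] - eps * (Q m0 + t0 ^+ 2)
    <= \int[m]_x (U t x m - v x) - \int[n0]_x (U t x m - v x) - (th s0).[t] - eps * (Q m + t ^+ 2).
  have JE (t' : R) (m' : P) : \int[m']_x (U t' x m' - v x) - \int[n0]_x (U t' x m' - v x)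
      - (th s0).[t'] - eps * (Q m' + t' ^+ 2) = G t' s0 m' n0 + (eps * (Q n0 + s0 ^+ 2) - gamma * s0).
    by rewrite thE /G /pairing; ring.
  by move=> tS; rewrite !JE lerD2r; exact: minG.
have min2 (s : R) (n : P) : 0 <= s <= S ->
    \int[n0]_x (V s0 x n0 - u x) - \int[m0]_x (V s0 x n0 - u x) - (th t0).[s0] - eps * (Q n0 + s0 ^+ 2)
    <= \int[n]_x (V s x n - u x) - \int[m0]_x (V s x n - u x) - (th t0).[s] - eps * (Q n + s ^+ 2).
  have JE (s' : R) (n' : P) : 0 <= s' ->
      \int[n']_x (V s' x n' - u x) - \int[m0]_x (V s' x n' - u x)
      - (th t0).[s'] - eps * (Q n' + s' ^+ 2) = G t0 s' m0 n' + (eps * (Q m0 + t0 ^+ 2) - gamma * t0).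
    move=> s'0; rewrite -/(pairing V U s' t0 n' m0) -(pairing_sym _ _ BU BV t00 s'0).
    by rewrite thE /G; ring.
  move=> sS; have sge0 : 0 <= s by case/andP: sS.
  by rewrite !JE// lerD2r; exact: minG.
have h1 := solution_at_minimum solU Cv eps0 S0 t0S min1 bU.
have h2 := solution_at_minimum solV Cu eps0 S0 s0S min2 bV.
rewrite !dthE !expect_residual// in h1 h2.
have bcont (g : T -> R) : continuous g -> bounded_measurable g.
  exact: continuous_bounded_measurable.
have bf (m : P) : bounded_measurable (fun x => f x m) by apply: bcont; exact: continuous_xm_fst.
have hf := mf m0 n0; rewrite !(expectB _ (bf _) (bf _)) in hf.
have hH1 := convex_drift m0 Cu Cv; have hH2 := convex_drift n0 Cv Cu.
have bUx (m : P) : bounded_measurable (fun x => U t0 x m) by apply: bcont; exact: Bt_continuous.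
have bVx (m : P) : bounded_measurable (fun x => V s0 x m) by apply: bcont; exact: Bt_continuous.
have hj : pairing U V t0 s0 m0 n0 <= pairing U V t0 s0 (jump K m0) (jump K n0) + 4 * eps.
  have [Q02 _ _ _ _] := Qk; have := minG t0 s0 (jump K m0) (jump K n0) t0S' s0S'.
  exact: (penalty_gap eps0 (Q02 _) (Q02 _) (Q02 _) (Q02 _)).
rewrite /pairing !(expectB _ (bUx _) (bVx _)) in hj.
have tS : t0 <= S by case/andP: t0S.
have sS : s0 <= S by case/andP: s0S.
exact: (doubling_algebra lambda0 eps0 tS sS h1 h2 hf hH1 hH2 hj).
Qed.

End comparison.

(** * Comparison and uniqueness *)

Section comparison.
Context {R : realType} {d : nat}.
Local Notation T := (torus R d).
Local Notation P := (probability T R).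
Context (sigma lambda : R) (K : T -> T -> R) (H : T -> 'rV[R]_d -> R) (f U0 : T -> P -> R).
Context (sigma0 : 0 < sigma) (lambda0 : 0 < lambda) (sK : smooth2 K)
  (K0 : forall x y, 0 <= K x y)
  (K1 : forall y, \int[torus_lebesgue R d]_x K x y = 1)
  (C1H : C1_momentum H) (cvxH : convex_momentum H) (cf : continuous_xm f)
  (mf : monotone_xm f) (mU0 : monotone_xm U0).
Local Notation solution := (monotone_solution sigma lambda K H f U0).

Lemma pairing_initial (U V : R -> T -> P -> R) (m n : P) : solution U -> solution V ->
  0 <= pairing U V 0 0 m n.
Proof.
move=> [_ U00 _] [_ V00 _]; have := mU0 m n; rewrite /pairing.
by under [X in X - _]eq_Rintegral do rewrite -U00 -V00;
   under [X in _ - X]eq_Rintegral do rewrite -U00 -V00.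
Qed.

Lemma doubled_functional_cvg (U V : R -> T -> P -> R) (Q : P -> R) (k : P -> T -> R)
    (alpha gamma eps S t s : R) (t_ s_ : nat -> R) (m_ n_ : nat -> P) (m n : P) :
  space_Bt U -> space_Bt V -> penalty Q k -> 0 < S ->
  (forall k, 0 <= t_ k <= S) -> (forall k, 0 <= s_ k <= S) -> 0 <= t <= S -> 0 <= s <= S ->
  t_ k @[k --> \oo] --> t -> s_ k @[k --> \oo] --> s ->
  skorokhod_cvg m_ m -> skorokhod_cvg n_ n ->
  pairing U V (t_ j) (s_ j) (m_ j) (n_ j) + alpha * (t_ j - s_ j) ^+ 2 + gamma * (t_ j + s_ j)
    - eps * (Q (m_ j) + Q (n_ j) + t_ j ^+ 2 + s_ j ^+ 2) @[j --> \oo] -->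
  pairing U V t s m n + alpha * (t - s) ^+ 2 + gamma * (t + s)
    - eps * (Q m + Q n + t ^+ 2 + s ^+ 2).
Proof.
move=> BU BV [_ _ _ _ cQ] S0 tS sS tS' sS' tt ss mm nn.
have sq (a_ : nat -> R) (a : R) : a_ j @[j --> \oo] --> a -> a_ j ^+ 2 @[j --> \oo] --> a ^+ 2.
  by move=> aa; rewrite expr2; under eq_cvg do rewrite expr2; exact: cvgM.
apply: cvgB; first apply: cvgD; first apply: cvgD.
- exact: (pairing_cvg BU BV S0 tS sS tS' sS' tt ss mm nn).
- by apply: cvgMr; apply: sq; exact: cvgB.
- by apply: cvgMr; exact: cvgD.
- apply: cvgMr; apply: cvgD; last exact: sq.
  by apply: cvgD; [apply: cvgD; exact: cQ|exact: sq].
Qed.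

Lemma solution_pairing_ge0 (U V : R -> T -> P -> R) (t : R) (m n : P) :
  solution U -> solution V -> 0 <= t -> 0 <= pairing U V t t m n.
Proof.
move=> solU solV t0; rewrite leNgt; apply/negP => neg.
have [BU _ _] := solU; have [BV _ _] := solV.
have S0 : 0 < t.
  rewrite lt_neqAle t0 andbT; apply/eqP => t00.
  by move: neg; rewrite -t00 ltNge (pairing_initial _ _ solU solV).
have [Q [k Qk]] := @penalty_exists R d; have [Q02 _ _ _ _] := Qk.
have [B B0 pB] := pairing_bounded BU BV S0.
have [Bu Bu0 HBu] := Bt_bounded BU S0; have [Bv Bv0 HBv] := Bt_bounded BV S0.
have [Cu Cu0 HCu] := momentum_bounded Bu C1H; have [Cv Cv0 HCv] := momentum_bounded Bv C1H.
pose C := Cu + Cv.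
(* eps M is the bound of [interior_minimum] on the horizon t; N adds to it the bound 4 + 2 t^2 of
   the penalty, so that one choice of eps makes both small. *)
pose M := 2 * t + 2 * lambda + 4 * d%:R * (C + sigma).
have M0 : 0 <= M by rewrite /M !addr_ge0 ?mulr_ge0 ?addr_ge0 // ltW.
pose N := 1 + M + (4 + 2 * t ^+ 2).
have N0 : 0 < N by rewrite /N; have := sqr_ge0 t; lra.
pose delta := - pairing U V t t m n.
have delta0 : 0 < delta by rewrite /delta oppr_gt0.
(* The linear term at times (t, t) is then delta / 4. *)
pose gamma := delta / (8 * t).
have gamma0 : 0 < gamma by rewrite divr_gt0// mulr_gt0.
pose w := Num.min gamma (delta / 4).
have w0 : 0 < w by rewrite lt_min gamma0 divr_gt0.
pose eps := w / N.
have eps0 : 0 < eps by rewrite divr_gt0.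
have epsN : eps * N = w by rewrite /eps divfK// gt_eqF.
have epsM : eps * M < gamma.
  apply: (@lt_le_trans _ _ (eps * N)); last by rewrite epsN ge_min lexx.
  by rewrite ltr_pM2l// /N; have := sqr_ge0 t; lra.
have epsS : eps * (4 + 2 * t ^+ 2) <= delta / 4.
  apply: (@le_trans _ _ (eps * N)); last by rewrite epsN ge_min lexx orbT.
  by rewrite ler_pM2l// /N; lra.
pose G (j : nat) (t' s' : R) (m' n' : P) := pairing U V t' s' m' n' + j.+1%:R * (t' - s') ^+ 2
  + gamma * (t' + s') - eps * (Q m' + Q n' + t' ^+ 2 + s' ^+ 2).
have sqS (a : R) : 0 <= a <= t -> 0 <= a ^+ 2 <= t ^+ 2.
  by move=> /andP[a0 aS]; rewrite sqr_ge0 lerXn2r// nnegrE.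
have penB (t' s' : R) (m' n' : P) : 0 <= t' <= t -> 0 <= s' <= t ->
    0 <= eps * (Q m' + Q n' + t' ^+ 2 + s' ^+ 2) <= delta / 4.
  move=> /sqS/andP[a1 a2] /sqS/andP[b1 b2]; have /andP[c1 c2] := Q02 m'; have /andP[e1 e2] := Q02 n'.
  apply/andP; split; first by rewrite mulr_ge0 ?addr_ge0// ltW.
  by apply: le_trans epsS; rewrite ler_pM2l// (_ : 4 + _ = 2 + 2 + t ^+ 2 + t ^+ 2); [rewrite !lerD|ring].
have gamB (t' s' : R) : 0 <= t' <= t -> 0 <= s' <= t -> 0 <= gamma * (t' + s').
  by move=> /andP[a1 _] /andP[b1 _]; rewrite mulr_ge0 ?addr_ge0// ltW.
have alpB (j : nat) (t' s' : R) : 0 <= j.+1%:R * (t' - s') ^+ 2.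
  by rewrite mulr_ge0// sqr_ge0.
have /boolp.choice[z zP] : forall j, exists z : (R * R) * (P * P),
    [/\ 0 <= z.1.1 <= t, 0 <= z.1.2 <= t & forall (t' s' : R) (m' n' : P),
      0 <= t' <= t -> 0 <= s' <= t -> G j z.1.1 z.1.2 z.2.1 z.2.2 <= G j t' s' m' n'].
  move=> j; have [t' s' m' n' h1 h2|t_ s_ t' s' m_ n_ m' n' h1 h2 h3 h4 h5 h6 h7 h8|
      t' [s' [m' [n' [h1 h2 h3]]]]] := @attained_minimum _ _ t (G j) (- B - delta / 4) t0.
  - have := pB _ _ m' n' h1 h2; rewrite ler_norml => /andP[h _].
    have /andP[_] := penB _ _ m' n' h1 h2; have := gamB _ _ h1 h2; have := alpB j t' s'.
    by rewrite /G; move: h; lra.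
  - exact: (doubled_functional_cvg BU BV Qk S0 h1 h2 h3 h4 h5 h6 h7 h8).
  - by exists ((t', s'), (m', n')).
have zt j : 0 <= (z j).1.1 <= t by case: (zP j).
have zs j : 0 <= (z j).1.2 <= t by case: (zP j).
pose p j := pairing U V (z j).1.1 (z j).1.2 (z j).2.1 (z j).2.2.
(* G is at most - delta + delta / 4 at (t, t, m, n), and the penalty at the minimiser removes at
   most delta / 4. *)
have pz j : p j + j.+1%:R * ((z j).1.1 - (z j).1.2) ^+ 2 <= - (delta / 2).
  have [_ _ /(_ t t m n)] := zP j; rewrite t0 lexx => /(_ erefl erefl).
  rewrite /G subrr expr0n/= mulr0 addr0 -/(p j) -(opprK (pairing U V t t m n)) -/delta.
  have -> : gamma * (t + t) = delta / 4 by rewrite /gamma; field; rewrite gt_eqF.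
  have tS : 0 <= t <= t by rewrite t0 lexx.
  have /andP[a1 _] := penB t t m n tS tS.
  have /andP[_ a2] := penB _ _ (z j).2.1 (z j).2.2 (zt j) (zs j).
  have := gamB _ _ (zt j) (zs j); move: a1 a2; lra.
(* With both times positive, [interior_minimum] would give gamma <= eps M. *)
have zero j : (z j).1.1 * (z j).1.2 = 0.
  apply: contrapT => /eqP; rewrite mulf_eq0 negb_or => /andP[n1 n2].
  have [_ _ minG] := zP j.
  have t'S : 0 < (z j).1.1 <= t by have /andP[a b] := zt j; rewrite lt_neqAle eq_sym n1 a b.
  have s'S : 0 < (z j).1.2 <= t by have /andP[a b] := zs j; rewrite lt_neqAle eq_sym n2 a b.
  have cU x i : `|momentum_grad H x (grad (fun y => U (z j).1.1 y (z j).2.1) x) 0 i| <= C.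
    apply: (@le_trans _ _ Cu); last by rewrite lerDl.
    by apply: HCu => l; rewrite mxE; exact: (HBu _ _ _ (zt j)).2.
  have cV x i : `|momentum_grad H x (grad (fun y => V (z j).1.2 y (z j).2.2) x) 0 i| <= C.
    apply: (@le_trans _ _ Cv); last by rewrite lerDr.
    by apply: HCv => l; rewrite mxE; exact: (HBv _ _ _ (zs j)).2.
  have := interior_minimum sigma0 lambda0 sK K0 K1 C1H cvxH cf mf Qk solU solV eps0 S0 t'S s'S minG cU cV.
  by rewrite -mulrDr leNgt epsM.
have [kappa [t1 [s1 [m1 [n1 [kn t1S s1S [ct cs cm cn]]]]]]] :=
  skorokhod_compactness (fun j => (z j).2.1) (fun j => (z j).2.2) zt zs.
have ts0 : t1 * s1 = 0.
  have c : (z (kappa j)).1.1 * (z (kappa j)).1.2 @[j --> \oo] --> t1 * s1 by exact: cvgM.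
  rewrite -(cvg_lim _ c)// (_ : (fun j => _) = fun=> 0); first by rewrite lim_cst.
  by apply/funext => j; exact: zero.
(* As the pairing is at least - B, the squared time difference is at most B / (kappa j + 1), and
   kappa j >= j. *)
have t1s1 : (t1 - s1) ^+ 2 <= 0.
  have c1 : ((z (kappa j)).1.1 - (z (kappa j)).1.2) * ((z (kappa j)).1.1 - (z (kappa j)).1.2)
      @[j --> \oo] --> (t1 - s1) * (t1 - s1) by apply: cvgM; exact: cvgB.
  have c2 : B * j.+1%:R^-1 @[j --> \oo] --> B * 0 by apply: cvgMr; exact: cvg_harmonic.
  rewrite expr2 -(mulr0 B); apply: (ler_cvg_to c1 c2); apply: nearW => j.
  have := pB _ _ (z (kappa j)).2.1 (z (kappa j)).2.2 (zt (kappa j)) (zs (kappa j)).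
  rewrite ler_norml => /andP[h _].
  rewrite -expr2 ler_pdivlMr// mulrC.
  apply: (@le_trans _ _ ((kappa j).+1%:R * ((z (kappa j)).1.1 - (z (kappa j)).1.2) ^+ 2)).
    by rewrite ler_wpM2r ?sqr_ge0// ler_nat ltnS.
  by have := pz (kappa j); rewrite /p; move: h; lra.
have t1E : t1 = s1.
  by apply/eqP; rewrite -subr_eq0 -sqrf_eq0 eq_le t1s1 sqr_ge0.
have s10 : s1 = 0 by apply/eqP; rewrite -sqrf_eq0 expr2 -{1}t1E ts0.
have : pairing U V t1 s1 m1 n1 <= - (delta / 2).
  have c := pairing_cvg BU BV S0 (fun j => zt (kappa j)) (fun j => zs (kappa j)) t1S s1S ct cs cm cn.
  rewrite -(cvg_lim _ c)//; apply: limr_le; first by apply/cvg_ex; eexists; exact: c.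
  apply: nearW => j; have := pz (kappa j); have := alpB (kappa j) (z (kappa j)).1.1 (z (kappa j)).1.2.
  by rewrite /p; lra.
have := pairing_initial m1 n1 solU solV.
by rewrite t1E s10; move: delta0; lra.
Qed.

(* Non-negativity of the pairing for n = (1 - h) m + h dirac x is of order h:
   divide by h and let h tend to 0. *)
Lemma solution_diff_le_mean (U V : R -> T -> P -> R) (t : R) (m : P) (x : T) :
  solution U -> solution V -> 0 <= t ->
  U t x m - V t x m <= \int[m]_y (U t y m - V t y m).
Proof.
move=> solU solV t0; have [BU _ _] := solU; have [BV _ _] := solV.
have [cV _ _] := BV.
(* The horizon is t + 1 because t may be 0 and [Bt_bounded] asks for a positive one. *)
have t1 : 0 < t + 1 by rewrite ltr_wpDl.
have tt1 : 0 <= t <= t + 1 by rewrite t0 lerDl ler01.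
have th01 (n : nat) : 0 <= (n.+1%:R^-1 : R) <= 1.
  by rewrite invr_ge0 ler0n invf_le1// ler1n.
have /boolp.choice[q qE] : forall n : nat, exists q : P, forall A : set T, measurable A ->
    q A = ((1 - n.+1%:R^-1)%:E * m A + n.+1%:R^-1%:E * (dirac x : P) A)%E.
  by move=> n; exact: mixture_exists (th01 n).
have cq (y : T) : V t y (q n) @[n --> \oo] --> V t y m.
  apply/cvgrPdist_lt => e e0; have [r r0 Hr] := cV t y m e t0 e0.
  have [e' e'0 He'] := mixture_wasserstein1 m (dirac x) r0.
  have h : \forall n \near \oo, n.+1%:R^-1 < e'.
    by apply: (cvgr_lt _ (@cvg_harmonic R)).
  near=> n; apply: Hr => //; rewrite ?subrr ?normr0 ?torus_dist_refl//.
  apply: (He' n.+1%:R^-1); last exact: qE.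
    by rewrite invr_gt0 ltr0n; case/andP: (th01 n).
  by near: n.
have bU (p : P) : bounded_measurable (fun y => U t y p).
  by apply: continuous_bounded_measurable; exact: Bt_continuous.
have bV (p : P) : bounded_measurable (fun y => V t y p).
  by apply: continuous_bounded_measurable; exact: Bt_continuous.
have bW n := bounded_measurableB (bU m) (bV (q n)).
have ineq n : U t x m - V t x (q n) <= \int[m]_y (U t y m - V t y (q n)).
  have := solution_pairing_ge0 m (q n) solU solV t0.
  rewrite /pairing (expect_mixture (th01 n) (qE n) (bW n)).
  rewrite [X in _ + _ * X](_ : _ = U t x m - V t x (q n)); last first.
    rewrite /Rintegral integral_dirac ?diracT ?mul1e//.
    by apply/measurable_EFinP; case: (bW n).
  have : 0 < n.+1%:R^-1 :> R by rewrite invr_gt0.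
  (* The pairing of m with the mixture of weight v is v (I - w), with I the mean under m and w the
     value at x. *)
  move: (\int[m]_y _) (U t x m - _) (n.+1%:R^-1) => I w v v0 h.
  have : 0 <= v * (I - w) by move: h; lra.
  by rewrite pmulr_rge0// subr_ge0.
have [Bu Bu0 HBu] := Bt_bounded BU t1; have [Bv Bv0 HBv] := Bt_bounded BV t1.
have c1 : U t x m - V t x (q n) @[n --> \oo] --> U t x m - V t x m.
  by apply: cvgB; [exact: cvg_cst|exact: cq].
have c2 : \int[m]_y (U t y m - V t y (q n)) @[n --> \oo] --> \int[m]_y (U t y m - V t y m).
  apply: (@cvg_expect _ _ _ m _ _ (Bu + Bv)).
  - by move=> n; case: (bW n).
  - by case: (bounded_measurableB (bU m) (bV m)).
  - move=> n y; apply: le_trans (ler_normB _ _) _; apply: lerD.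
      exact: (HBu _ _ _ tt1).1.
    exact: (HBv _ _ _ tt1).1.
  - by apply: aeW => y; apply: cvgB; [exact: cvg_cst|exact: cq].
by apply: (ler_cvg_to c1 c2); apply: nearW.
Unshelve. all: end_near. Qed.

(** [solution_diff_le_mean] for (U, V) and for (V, U) bounds the difference at x by its mean from
    both sides. *)
Lemma solution_unique (U V : R -> T -> P -> R) (t : R) (m : P) (x : T) :
  solution U -> solution V -> 0 <= t ->
  U t x m = V t x m + \int[m]_y (U t y m - V t y m).
Proof.
move=> solU solV t0; have [BU _ _] := solU; have [BV _ _] := solV.
have bU : bounded_measurable (fun y => U t y m).
  by apply: continuous_bounded_measurable; exact: Bt_continuous.
have bV : bounded_measurable (fun y => V t y m).
  by apply: continuous_bounded_measurable; exact: Bt_continuous.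
have := solution_diff_le_mean m x solU solV t0.
have := solution_diff_le_mean m x solV solU t0.
rewrite (expectB m bU bV) (expectB m bV bU).
by move=> h1 h2; apply/eqP; rewrite eq_le; apply/andP; split; move: h1 h2; lra.
Qed.

End comparison.

Theorem theorem5p3 (R : realType) (d : nat) (sigma lambda : R)
    (K : torus R d -> torus R d -> R)
    (H : torus R d -> 'rV[R]_d -> R)
    (f U0 : torus R d -> probability (torus R d) R -> R) :
  (1 < d)%N -> 0 < sigma -> 0 < lambda ->
  smooth2 K -> (forall x y, 0 <= K x y) ->
  (forall y, \int[torus_lebesgue R d]_x K x y = 1) ->
  C1_momentum H -> convex_momentum H ->
  continuous_xm f -> continuous_xm U0 -> monotone_xm f -> monotone_xm U0 ->
  (forall U V : R -> torus R d -> probability (torus R d) R -> R,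
     monotone_solution sigma lambda K H f U0 U ->
     monotone_solution sigma lambda K H f U0 V ->
     exists c : R -> probability (torus R d) R -> R,
       forall t x m, 0 <= t -> U t x m = V t x m + c t m) /\
  (forall U : R -> torus R d -> probability (torus R d) R -> R,
     monotone_solution sigma lambda K H f U0 U ->
     forall t, 0 <= t -> monotone_xm (U t)).
Proof.
move=> _ sigma0 lambda0 sK K0 K1 C1H cvxH cf _ mf mU0; split.
  move=> U V solU solV; exists (fun t (m : probability (torus R d) R) => \int[m]_y (U t y m - V t y m)).
  move=> t x m t0.
  exact: (solution_unique sigma0 lambda0 sK K0 K1 C1H cvxH cf mf mU0 m x solU solV t0).
move=> U solU t t0 mu nu.
exact: (solution_pairing_ge0 sigma0 lambda0 sK K0 K1 C1H cvxH cf mf mU0 mu nu solU solU t0).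
Qed.
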